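(* Let $n\ge3$, let $\mathbf\Gamma=(\Gamma_1,\Gamma_2,\gamma)$ be a Belavin--Drinfeld triple of type $A_{n-1}$, and let $\mathcal Q(U)=\rho(U)^{-1}U\rho(U)$, $\rho(U)=\tilde\gamma^*(U_-)(\tilde\gamma^* )^2(U_-)\cdots$. Let $\psi$ be any variable of the initial extended cluster of $\mathcal{GC}^\dagger_h(\mathbf\Gamma)$. Then: 1) if $\psi$ is a $\varphi$- or $c$-function, then $\mathcal Q^*(\psi)=\psi$; 2) if $\psi=h_{ij}$ with $2\le i\le j\le n$, and $\{\alpha_t\}_{t=0}^m$ is the $\gamma$-string with $i-1=\alpha_k$, then $$\mathcal Q^*(h_{ij}(U))=\tilde h_{ij}(U)\prod_{t\ge k+1}\tilde h_{\alpha_t+1,\alpha_t+1}(U),$$ where $\tilde h_{ij}$ are the $h$-functions for the trivial triple, $\tilde h_{ij}(U)=(-1)^{(j-i)(n-i)}\det U^{[j,n]}_{[i,n-j+i]}$. Moreover, $\mathcal Q:(G,\mathcal{GC}^\dagger_h(\mathbf\Gamma_{\rm std},G))\dashrightarrow(G,\mathcal{GC}^\dagger_h(\mathbf\Gamma,G))$ is a birational quasi-isomorphism for $G\in\{\mathrm{SL}_n(\mathbb C),\mathrm{GL}_n(\mathbb C)\}$.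
   Context: **Notation.** $[a,b]$ is an interval of integers; $A_I^J$ is the submatrix of $A$ with rows $I$ and columns $J$, $A^J$ the submatrix of columns $J$. $\mathcal N_-$ is the group of unipotent lower triangular matrices. A generic $U\in\mathrm{GL}_n(\mathbb C)$ is factored as $U=U_\oplus U_-$ with $U_\oplus$ upper triangular, $U_-\in\mathcal N_-$. **BD data.** $\Pi=[1,n-1]$. A BD triple is $\mathbf\Gamma=(\Gamma_1,\Gamma_2,\gamma)$, $\Gamma_1,\Gamma_2\subset\Pi$, $\gamma:\Gamma_1\to\Gamma_2$ a bijective isometry (preserving adjacency and non-adjacency in the Dynkin diagram), nilpotent: for every $\alpha\in\Gamma_1$ some $\gamma^m(\alpha)\notin\Gamma_1$. $\gamma^*:\Gamma_2\to\Gamma_1$ is the inverse. $\mathbf\Gamma_{\rm std}$ has $\Gamma_1=\Gamma_2=\emptyset$. $\tilde\gamma^*:\mathcal N_-\to\mathcal N_-$ integrates the Lie algebra homomorphism with $E_{i+1,i}\mapsto E_{\gamma^*(i)+1,\gamma^*(i)}$ for $i\in\Gamma_2$ and $E_{ab}\mapsto0$ ($a>b$) unless $[b,a-1]\subset\Gamma_2$. For $j-1,j\in\Gamma_2$, $\gamma<0$ at $j$ means $\gamma^*(j)=\gamma^*(j-1)-1$. The $\gamma$-string of $\alpha_0\in\Pi\setminus\Gamma_2$ is $\alpha_0,\alpha_1=\gamma(\alpha_0),\dots,\alpha_m$ with $\alpha_m\notin\Gamma_1$; $\gamma$-strings partition $\Pi$. $\mathcal F$ is the limit of the eventually constant sequence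 $\mathcal F_0(U)=U$, $\mathcal F_k(U)=\tilde\gamma^*([\mathcal F_{k-1}(U)]_-)U$. **Functions.** $\det(I+\lambda U)=\sum_{i=0}^n\lambda^i(-1)^{i(n-1)}c_i(U)$. $s_{kl}=(-1)^{k(l+1)}$ for $n$ even, $s_{kl}=(-1)^{(n-1)/2+k(k-1)/2+l(l-1)/2}$ for $n$ odd. For $k,l\ge1$, $k+l\le n$: $\varphi_{kl}(U)=s_{kl}\det[(U^0)^{[n-k+1,n]}\;U^{[n-l+1,n]}\;(U^2)^{\{n\}}\cdots(U^{n-k-l+1})^{\{n\}}]$. $h_{11}=\det U$. For a $\gamma$-string $\{\alpha_t\}_{t=0}^m$, $i\in[0,m]$, $j\in[\alpha_i+1,n]$, $$h_{\alpha_i+1,j}(U)=(-1)^{(j-\alpha_i-1)(n-\alpha_i-1)}\det[\mathcal F(U)]^{[j,n]}_{[\alpha_i+1,n-j+\alpha_i+1]}\prod_{t=i+1}^m\det[\mathcal F(U)]^{[\alpha_t+1,n]}_{[\alpha_t+1,n]}.$$ **Generalized cluster structures.** An extended seed in $\mathbb C(G)$ is $(\mathbf x,B,\mathcal P)$: $\mathbf x=(x_1,\dots,x_{N+M})$ algebraically independent generators of $\mathbb C(G)$ ($x_1,\dots,x_N$ cluster variables, the rest frozen); $B=(b_{ij})$ an integer $N\times(N+M)$ matrix with skew-symmetrizable principal part; multiplicities $d_i\ge1$ dividing all $b_{ij}$, $j\le N$; strings $p_i=(p_{ir})_{r=0}^{d_i}$ of monomials in frozen variables with $p_{i0}=p_{id_i}=1$.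 Mutation in direction $k\le N$ replaces $x_k$ by $x_k'$ with $$x_kx_k'=\sum_{r=0}^{d_k}p_{kr}\,u_{k;>}^r v_{k;>}^{[r]}\,u_{k;<}^{d_k-r}v_{k;<}^{[d_k-r]},$$ $u_{k;>}=\prod_{i\le N,b_{ki}>0}x_i^{b_{ki}/d_k}$, $u_{k;<}=\prod_{i\le N,b_{ki}<0}x_i^{-b_{ki}/d_k}$, $v_{k;>}^{[r]}=\prod_{i>N,b_{ki}>0}x_i^{\lfloor rb_{ki}/d_k\rfloor}$, $v_{k;<}^{[r]}=\prod_{i>N,b_{ki}<0}x_i^{\lfloor -rb_{ki}/d_k\rfloor}$; it replaces $B$ by $b'_{ij}=-b_{ij}$ if $k\in\{i,j\}$, $b'_{ij}=b_{ij}+\frac12(|b_{ik}|b_{kj}+b_{ik}|b_{kj}|)$ otherwise, and $p_{kr}$ by $p_{k,d_k-r}$. A generalized cluster structure is the set of all seeds obtained from an initial one by mutations. In each seed put $v_{i;>}=v_{i;>}^{[d_i]}$, $v_{i;<}=v_{i;<}^{[d_i]}$ and $\hat p_{ir}=p_{ir}^{d_i}(v_{i;>}^{[r]}v_{i;<}^{[d_i-r]})^{d_i}/(v_{i;>}^rv_{i;<}^{d_i-r})$. **Structure $\mathcal{GC}_h^\dagger(\mathbf\Gamma,\mathrm{GL}_n)$.** Initial extended cluster: $h_{ij}$ ($2\le i\le j\le n$), $\varphi_{kl}$ ($k,l\ge1$, $k+l\le n$), $c_1,\dots,c_{n-1}$, $h_{11}$. Frozen: $c_1,\dots,c_{n-1}$,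 $h_{11}$, and $h_{i+1,i+1}$ for $i\in\Pi\setminus\Gamma_2$. All multiplicities are $1$ with trivial strings except $\varphi_{11}$, of multiplicity $n$ with string $(1,c_1,\dots,c_{n-1},1)$. $B$ is encoded by a quiver: with $a(x,y)=\#(x\to y)-\#(y\to x)$, $b_{xy}=a(x,y)$ for $x\ne\varphi_{11}$; $b_{\varphi_{11},y}=n\,a(\varphi_{11},y)$ for $y$ a cluster variable and $=a(\varphi_{11},y)$ for $y$ frozen. The $c_i$ are isolated. With $h_{1j}:=\varphi_{j-1,n-j+1}$ ($2\le j\le n$), the arrows are (with multiplicity; arrows between frozen vertices are irrelevant): (a1) $\varphi_{kl}\to\varphi_{k,l-1}$ for $k\ge1$, $l\ge2$, $k+l\le n$; (a2) $\varphi_{kl}\to\varphi_{k+1,l}$ for $k\ge1$, $l\ge2$, $k+l<n$; (a3) $\varphi_{kl}\to\varphi_{k-1,l+1}$ for $k\ge2$, $l\ge1$, $k+l<n$; (a4) $\varphi_{k1}\to\varphi_{1k}$ for $2\le k\le n-1$; (a5) $\varphi_{1l}\to\varphi_{l+1,1}$ for $1\le l\le n-2$; (b1) $h_{ij}\to h_{i+1,j}$ for $1\le i<j\le n$; (b2) $h_{ij}\to h_{i,j+1}$ for $2\le i\le j\le n-1$; (b3) $h_{ij}\to h_{i-1,j-1}$ for $2\le i<j\le n$; (b4) $h_{11}\to\varphi_{1,n-1}$ and $\varphi_{11}\to h_{11}$; (c) for every $j\in\Gamma_2$ with $i=\gamma^*(j)$: $h_{i+1,n}\to h_{j+1,j+1}$,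 $h_{j+1,j+1}\to h_{i,n}$, and, if $j-1\notin\Gamma_2$ or $\gamma<0$ at $j$, also $h_{j+1,j+1}\to h_{jj}$. For $\mathrm{SL}_n$, restrict all functions to $\mathrm{SL}_n$ and delete $h_{11}$ together with its arrows. **Birational quasi-isomorphisms.** The initial variables of $\mathcal{GC}_h^\dagger(\mathbf\Gamma_{\rm std})$ and $\mathcal{GC}_h^\dagger(\mathbf\Gamma)$ are matched by names: each $\varphi_{kl}$, $c_i$ to itself and each $h_{ij}$ to $\tilde h_{ij}$. The marked labels are those of $h_{i+1,i+1}$, $i\in\Gamma_2$ (cluster variables for $\mathbf\Gamma$, frozen for $\mathbf\Gamma_{\rm std}$). A marked seed of $\mathcal{GC}_h^\dagger(\mathbf\Gamma)$ is one obtained from the initial seed by mutations at non-marked labels; its related seed in $\mathcal{GC}_h^\dagger(\mathbf\Gamma_{\rm std})$ is obtained by the same sequence of mutations. A birational map $\mathcal Q:G\dashrightarrow G$ is a birational quasi-isomorphism $(G,\mathcal{GC}_h^\dagger(\mathbf\Gamma_{\rm std}))\dashrightarrow(G,\mathcal{GC}_h^\dagger(\mathbf\Gamma))$ if: (1) the initial marked variables in both structures are regular; (2) $\mathcal Q^*$ induces an isomorphism $\mathbb C[G][h_{i+1,i+1}^{\pm1}\,|\,i\in\Gamma_2]\to\mathbb C[G][\tilde h_{i+1,i+1}^{\pm1}\,|\,i\in\Gamma_2]$; (3) for every marked extended cluster $(x_i)$ with related cluster $(\tilde x_i)$ there are integers $\lambda_{ij}$ with $\mathcal Q^*(x_i)=\tilde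 x_i\prod_{j\text{ marked}}\tilde x_j^{\lambda_{ij}}$ for $i$ non-marked and $\mathcal Q^*(x_i)=\prod_{j\text{ marked}}\tilde x_j^{\lambda_{ij}}$ for $i$ marked; (4) for every non-marked cluster label $i$ and every pair of related seeds, $\mathcal Q^*(\hat p_{ir})=\tilde{\hat p}_{ir}$ for all $r$. *)

(* Defs.v *)
From HB Require Import structures.
From mathcomp Require Import all_boot all_order all_algebra.
From mathcomp Require Import mpoly.
From mathcomp Require Import classical_sets.

Set Implicit Arguments.
Unset Strict Implicit.
Unset Printing Implicit Defensive.

Import Order.TTheory GRing.Theory Num.Theory.
Local Open Scope ring_scope.

(* Conventions. All indices (rows, columns, simple roots) are 1-based natural
   numbers, so that Pi = [1, n - 1].
   An element of the function field C(G) is represented by a total function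
   'M[C]_n -> C; two such functions denote the same rational function when they
   agree on a nonempty Zariski open subset of G ([eq_rat G] below). G = GL_n, SL_n
   is irreducible, so nonempty open subsets are dense. The totalized inverse
   x^-1 (0^-1 = 0) and the default values below matter only on proper closed
   subsets. *)

(* ------------------------------------------------------------------------ *)
(* Rational and regular functions, birational maps                          *)

Variant group_kind := GL | SL.

Section RationalFunctions.
Variables (C : fieldType) (n : nat).
Implicit Types (G : group_kind) (f g : 'M[C]_n -> C) (Q : 'M[C]_n -> 'M[C]_n).

Definition in_group G (U : 'M[C]_n) : Prop :=
  match G with GL => \det U != 0 | SL => \det U = 1 end.

Definition peval (p : {mpoly C[n * n]}) (U : 'M[C]_n) : C := p.@[mxvec U 0].

Definition generically G (P : 'M[C]_n -> Prop) : Prop :=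
  exists q : {mpoly C[n * n]},
    (exists2 U, in_group G U & peval q U != 0) /\
    (forall U, in_group G U -> peval q U != 0 -> P U).

Definition eq_rat G f g : Prop := generically G (fun U => f U = g U).

Definition pullback Q f : 'M[C]_n -> C := fun U => f (Q U).

Definition rational_fun G f : Prop :=
  exists p q : {mpoly C[n * n]},
    generically G (fun U => peval q U != 0 /\ f U = peval p U / peval q U).

(* C[GL_n] is generated by the matrix entries and 1 / det; C[SL_n] is the ring
   of restrictions of polynomials, and there det = 1. *)
Definition regular_fun G f : Prop :=
  exists (p : {mpoly C[n * n]}) (e : nat),
    eq_rat G f (fun U => peval p U / \det U ^+ e).

(* The subring C[G][g^{+-1} | g \in gs] of C(G). *)
Definition in_localization G (gs : seq ('M[C]_n -> C)) f : Prop :=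
  exists a : 'M[C]_n -> C, exists e : nat,
    regular_fun G a /\
    generically G (fun U => f U = a U / (\prod_(g <- gs) g U) ^+ e).

Definition rational_map G Q : Prop :=
  generically G (fun U => in_group G (Q U)) /\
  forall i j, rational_fun G (fun U => Q U i j).

(* Dominance is what makes composition with Q well defined modulo [eq_rat G]. *)
Definition dominant G Q : Prop :=
  forall P, generically G P -> generically G (fun U => P (Q U)).

Definition birational G Q : Prop :=
  [/\ rational_map G Q, dominant G Q &
      exists Q', [/\ rational_map G Q', dominant G Q',
                     generically G (fun U => Q' (Q U) = U) &
                     generically G (fun U => Q (Q' U) = U)]].

(* Q^* induces a bijection (hence a ring isomorphism, as Q^* respects the
   pointwise operations) from C[G][gs^{+-1}] onto C[G][gs'^{+-1}]. *)
Definition pullback_iso G Q (gs gs' : seq ('M[C]_n -> C)) : Prop :=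
  [/\ forall f, in_localization G gs f -> in_localization G gs' (pullback Q f),
      forall f g, in_localization G gs f -> in_localization G gs g ->
        eq_rat G (pullback Q f) (pullback Q g) -> eq_rat G f g &
      forall g, in_localization G gs' g ->
        exists2 f, in_localization G gs f & eq_rat G (pullback Q f) g].

End RationalFunctions.

(* ------------------------------------------------------------------------ *)
(* Belavin-Drinfeld triples                                                 *)

Definition adjacent (i j : nat) : bool := (i.+1 == j) || (j.+1 == i).

(* The values of [gam] outside Gamma1 and of [gams] outside Gamma2 are
   irrelevant. *)
Record BD_triple (n : nat) := BDTriple {
  Gam1 : pred nat;
  Gam2 : pred nat;
  gam : nat -> nat;
  gams : nat -> nat;
  _ : forall i, Gam1 i -> (1 <= i <= n.-1)%N;
  _ : forall i, Gam2 i -> (1 <= i <= n.-1)%N;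
  _ : forall i, Gam1 i -> Gam2 (gam i) /\ gams (gam i) = i;
  _ : forall j, Gam2 j -> Gam1 (gams j) /\ gam (gams j) = j;
  _ : forall i j, Gam1 i -> Gam1 j -> adjacent (gam i) (gam j) = adjacent i j;
  _ : forall i, Gam1 i -> exists m, ~~ Gam1 (iter m gam i)
}.

Definition BD_std (n : nat) : BD_triple n.
Proof. by apply: (@BDTriple n pred0 pred0 id id). Defined.

Definition gamma_string n (bd : BD_triple n) (alpha : nat -> nat) (m : nat) : Prop :=
  [/\ (1 <= alpha 0 <= n.-1)%N, ~~ Gam2 bd (alpha 0),
      forall t, (t < m)%N -> Gam1 bd (alpha t) /\ alpha t.+1 = gam bd (alpha t) &
      ~~ Gam1 bd (alpha m)].

(* The number of steps from a to the last element of its gamma-string. *)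
Definition steps n (bd : BD_triple n) (a : nat) : nat :=
  find (fun t => ~~ Gam1 bd (iter t (gam bd) a)) (iota 0 n).

(* ------------------------------------------------------------------------ *)
(* The maps tilde gamma^*, F, rho and Q                                     *)

Section Matrices.
Variables (C : fieldType) (n : nat).
Implicit Types (U N X : 'M[C]_n) (bd : BD_triple n).

Definition entry U (a b : nat) : C :=
  match insub a.-1, insub b.-1 with Some i, Some j => U i j | _, _ => 0 end.

(* det U_[r, r + s - 1]^[c, c + s - 1] *)
Definition minor U (r c s : nat) : C :=
  \det (\matrix_(a < s, b < s) entry U (r + a) (c + b)).

Definition unip_lower N : Prop := is_trig_mx N /\ forall i, N i i = 1.

(* U_-, where U = U_(+) U_-; unique for invertible U. *)
Definition low_part U : 'M[C]_n :=
  xget 1 [set N | unip_lower N /\ exists2 W : 'M[C]_n, is_trig_mx W^T & U = W *m N]%classic.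

Definition elem_mx (a b : nat) : 'M[C]_n :=
  \matrix_(i, j) ((i.+1 == a) && (j.+1 == b))%:R.

(* The image of E_{b+k+1,b} under the Lie algebra homomorphism, computed from
   E_{b+k+1,b} = [E_{b+k+1,b+k}, E_{b+k,b}]. It vanishes unless [b, b + k] is
   contained in Gamma2. *)
Fixpoint dgamma_elem bd (b k : nat) : 'M[C]_n :=
  let simple i := if Gam2 bd i then elem_mx (gams bd i).+1 (gams bd i) else 0 in
  if k is k'.+1 then
    simple (b + k)%N * dgamma_elem bd b k' - dgamma_elem bd b k' * simple (b + k)%N
  else simple b.

Definition dgamma bd X : 'M[C]_n :=
  \sum_(i < n) \sum_(j < n | (j < i)%N) X i j *: dgamma_elem bd j.+1 (i - j).-1.

(* exp and log; these finite sums are the full series on strictly lower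
   triangular, resp. unipotent lower triangular, matrices. *)
Definition nexp X : 'M[C]_n := \sum_(k < n) k`!%:R^-1 *: X ^+ k.

Definition ulog N : 'M[C]_n :=
  \sum_(1 <= k < n) ((-1) ^+ k.+1 / k%:R) *: (N - 1) ^+ k.

Definition tgamma bd N : 'M[C]_n := nexp (dgamma bd (ulog N)).

(* The limit of an eventually constant sequence of matrices. *)
Definition eventual_value (s : nat -> 'M[C]_n) : 'M[C]_n :=
  xget 0 [set V | exists K : nat, forall k : nat, (K <= k)%N -> s k = V]%classic.

Fixpoint Fseq bd U (k : nat) : 'M[C]_n :=
  if k is k'.+1 then tgamma bd (low_part (Fseq bd U k')) *m U else U.

Definition Fmap bd U : 'M[C]_n := eventual_value (Fseq bd U).

(* Only finitely many factors tilde gamma^*^k (U_-) differ from 1. *)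
Definition rho bd U : 'M[C]_n :=
  eventual_value (fun m => \prod_(1 <= k < m.+1) iter k (tgamma bd) (low_part U)).

Definition Qmap bd U : 'M[C]_n := invmx (rho bd U) *m U *m rho bd U.

(* ------------------------------------------------------------------------ *)
(* The functions c, phi and h                                               *)

Definition c_fun (i : nat) U : C :=
  (-1) ^+ (i * n.-1) * (\det (1%:M + 'X *: map_mx polyC U))`_i.

Definition phi_sign (k l : nat) : C :=
  if odd n then (-1) ^+ (n.-1./2 + (k * k.-1)./2 + (l * l.-1)./2)
  else (-1) ^+ (k * l.+1).

(* In the matrix the column index j is 0-based: the last k columns of U^0, the
   last l columns of U, then the last columns of U^2, ..., U^(n-k-l+1). *)
Definition phi_fun (k l : nat) U : C :=
  phi_sign k l *
  \det (\matrix_(i < n, j < n)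
     if (j < k)%N then entry (U ^+ 0) i.+1 (n - k + j).+1
     else if (j < k + l)%N then entry U i.+1 (n - l + (j - k)).+1
     else entry (U ^+ (j - (k + l)).+2) i.+1 n).

Definition h_fun bd (i j : nat) U : C :=
  if (i == 1%N) && (j == 1%N) then \det U
  else (-1) ^+ ((j - i) * (n - i)) * minor (Fmap bd U) i j (n - j).+1
       * \prod_(1 <= t < (steps bd i.-1).+1)
           let a := iter t (gam bd) i.-1 in minor (Fmap bd U) a.+1 a.+1 (n - a).

(* (-1)^((j-i)(n-i)) det U^[j, n]_[i, n - j + i] *)
Definition h_std (i j : nat) U : C :=
  (-1) ^+ ((j - i) * (n - i)) * minor U i j (n - j).+1.

End Matrices.

(* ------------------------------------------------------------------------ *)
(* Labels of the variables                                                  *)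

Variant label := Phi of nat & nat | H of nat & nat | Cc of nat.

Definition label_code (x : label) : (nat * nat) + (nat * nat) + nat :=
  match x with
  | Phi k l => inl (inl (k, l)) | H i j => inl (inr (i, j)) | Cc i => inr i
  end.

Definition label_decode (x : (nat * nat) + (nat * nat) + nat) : label :=
  match x with
  | inl (inl (k, l)) => Phi k l | inl (inr (i, j)) => H i j | inr i => Cc i
  end.

Lemma label_codeK : cancel label_code label_decode.
Proof. by case. Qed.

HB.instance Definition _ := Equality.copy label (can_type label_codeK).

(* ------------------------------------------------------------------------ *)
(* Extended seeds and generalized mutations                                 *)

(* Variables are functions on the group; the string entry p_{ir} is stored as
   the exponent vector of a monomial in the frozen variables. Only the values
   of [exmx s] at (cluster label, label) are meaningful. The record holds the
   data on which mutation operates; mutation makes no use of the algebraic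
   independence of the variables. *)
Record ext_seed (C : fieldType) (n : nat) := ExtSeed {
  cluster : seq label;
  frozen : seq label;
  var : label -> 'M[C]_n -> C;
  mult : label -> nat;
  exmx : label -> label -> int;
  pstr : label -> nat -> label -> nat
}.

Section Mutation.
Variables (C : fieldType) (n : nat).
Implicit Types (s : ext_seed C n) (U : 'M[C]_n).

Definition ext_cluster s : seq label := cluster s ++ frozen s.

Definition p_val s (i : label) (r : nat) U : C :=
  \prod_(j <- frozen s) var s j U ^+ pstr s i r j.

Definition u_gt s (k : label) U : C :=
  \prod_(i <- cluster s | 0 < exmx s k i) var s i U ^+ (`|exmx s k i| %/ mult s k)%N.

Definition u_lt s (k : label) U : C :=
  \prod_(i <- cluster s | exmx s k i < 0) var s i U ^+ (`|exmx s k i| %/ mult s k)%N.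

Definition v_gt s (k : label) (r : nat) U : C :=
  \prod_(i <- frozen s | 0 < exmx s k i) var s i U ^+ (r * `|exmx s k i| %/ mult s k)%N.

Definition v_lt s (k : label) (r : nat) U : C :=
  \prod_(i <- frozen s | exmx s k i < 0) var s i U ^+ (r * `|exmx s k i| %/ mult s k)%N.

Definition exchange_rhs s (k : label) U : C :=
  let d := mult s k in
  \sum_(r < d.+1) p_val s k r U * u_gt s k U ^+ r * v_gt s k r U
                  * u_lt s k U ^+ (d - r) * v_lt s k (d - r) U.

Definition p_hat s (i : label) (r : nat) U : C :=
  let d := mult s i in
  p_val s i r U ^+ d * (v_gt s i r U * v_lt s i (d - r) U) ^+ d
  / (v_gt s i d U ^+ r * v_lt s i d U ^+ (d - r)).

Definition mutate s (k : label) : ext_seed C n :=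
  {| cluster := cluster s;
     frozen := frozen s;
     var := fun i U => if i == k then exchange_rhs s k U / var s k U else var s i U;
     mult := mult s;
     exmx := fun i j =>
       let b := exmx s in
       if (i == k) || (j == k) then - b i j
       else b i j + ((`|b i k| * b k j + b i k * `|b k j|) %/ 2)%Z;
     pstr := fun i r => if i == k then pstr s k (mult s k - r)%N else pstr s i r |}.

Definition mutations s (ks : seq label) : ext_seed C n := foldl mutate s ks.

(* [st] and [s] are the initial extended seeds of the source and of the target
   structure, with variables matched by labels. *)
Definition birational_quasi_isomorphism (G : group_kind) (Q : 'M[C]_n -> 'M[C]_n)
    (st s : ext_seed C n) (marked : seq label) : Prop :=
  let nonmarked_seq ks := forall k, k \in ks -> (k \in cluster s) && (k \notin marked) in
  [/\ birational G Q,
      forall i, i \in marked -> regular_fun G (var st i) /\ regular_fun G (var s i),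
      pullback_iso G Q [seq var s i | i <- marked] [seq var st i | i <- marked],
      forall ks, nonmarked_seq ks ->
        let s1 := mutations s ks in let st1 := mutations st ks in
        exists lam : label -> label -> int,
        forall i, i \in ext_cluster s1 ->
          eq_rat G (pullback Q (var s1 i))
            (fun U => (if i \in marked then 1 else var st1 i U)
                      * \prod_(j <- marked) var st1 j U ^ lam i j) &
      forall ks, nonmarked_seq ks ->
        let s1 := mutations s ks in let st1 := mutations st ks in
        forall i, (i \in cluster s1) && (i \notin marked) ->
        forall r, (r <= mult s1 i)%N ->
          eq_rat G (pullback Q (p_hat s1 i r)) (p_hat st1 i r)].

End Mutation.

(* ------------------------------------------------------------------------ *)
(* The initial extended seed                                                *)

Section InitialSeed.
Variables (C : fieldType) (n : nat).
Implicit Types (bd : BD_triple n) (G : group_kind).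

Definition pairs : seq (nat * nat) :=
  [seq (i, j) | i <- iota 1 n, j <- iota 1 n].

Definition phi_labels : seq label :=
  [seq Phi p.1 p.2 | p <- pairs & (p.1 + p.2 <= n)%N].

Definition init_frozen G bd : seq label :=
  [seq Cc i | i <- iota 1 n.-1]
  ++ (if G is GL then [:: H 1 1] else [::])
  ++ [seq H i.+1 i.+1 | i <- iota 1 n.-1 & ~~ Gam2 bd i].

Definition init_cluster bd : seq label :=
  phi_labels
  ++ [seq H p.1 p.2 | p <- pairs &
        (2 <= p.1 <= p.2)%N && ((p.1 == p.2) ==> Gam2 bd p.1.-1)].

(* h_{1j} = phi_{j-1,n-j+1} for 2 <= j <= n *)
Definition Hv (i j : nat) : label :=
  if (i == 1%N) && (2 <= j)%N then Phi j.-1 (n - j).+1 else H i j.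

Definition arrows_a : seq (label * label) :=
  [seq (Phi p.1 p.2, Phi p.1 p.2.-1) | p <- pairs & (2 <= p.2)%N && (p.1 + p.2 <= n)%N]
  ++ [seq (Phi p.1 p.2, Phi p.1.+1 p.2) | p <- pairs & (2 <= p.2)%N && (p.1 + p.2 < n)%N]
  ++ [seq (Phi p.1 p.2, Phi p.1.-1 p.2.+1) | p <- pairs & (2 <= p.1)%N && (p.1 + p.2 < n)%N]
  ++ [seq (Phi k 1, Phi 1 k) | k <- iota 1 n & (2 <= k <= n.-1)%N]
  ++ [seq (Phi 1 l, Phi l.+1 1) | l <- iota 1 n & (l <= n - 2)%N].

Definition arrows_b : seq (label * label) :=
  [seq (Hv p.1 p.2, Hv p.1.+1 p.2) | p <- pairs & (p.1 < p.2)%N]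
  ++ [seq (Hv p.1 p.2, Hv p.1 p.2.+1) | p <- pairs & (2 <= p.1 <= p.2)%N && (p.2 <= n.-1)%N]
  ++ [seq (Hv p.1 p.2, Hv p.1.-1 p.2.-1) | p <- pairs & (2 <= p.1 < p.2)%N]
  ++ [:: (H 1 1, Phi 1 n.-1); (Phi 1 1, H 1 1)].

(* gamma < 0 at j, for j - 1 and j in Gamma2 *)
Definition gamma_neg bd (j : nat) : bool := (gams bd j).+1 == gams bd j.-1.

Definition arrows_c bd : seq (label * label) :=
  let G2 := [seq j <- iota 1 n.-1 | Gam2 bd j] in
  [seq (Hv (gams bd j).+1 n, Hv j.+1 j.+1) | j <- G2]
  ++ [seq (Hv j.+1 j.+1, Hv (gams bd j) n) | j <- G2]
  ++ [seq (Hv j.+1 j.+1, Hv j j) | j <- G2 & ~~ Gam2 bd j.-1 || gamma_neg bd j].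

(* a(x, y) *)
Definition arrow_count bd (x y : label) : int :=
  let ar := arrows_a ++ arrows_b ++ arrows_c bd in
  (count_mem (x, y) ar)%:Z - (count_mem (y, x) ar)%:Z.

Definition init_var bd (x : label) : 'M[C]_n -> C :=
  match x with
  | Phi k l => @phi_fun C n k l | H i j => h_fun bd i j | Cc i => @c_fun C n i
  end.

(* For G = SL the label H 1 1 belongs neither to the cluster nor to the frozen
   labels, so the arrows at it play no role. *)
Definition init_seed G bd : ext_seed C n :=
  {| cluster := init_cluster bd;
     frozen := init_frozen G bd;
     var := init_var bd;
     mult := fun x => if x == Phi 1 1 then n else 1%N;
     exmx := fun x y =>
       if (x == Phi 1 1) && (y \in init_cluster bd) then n%:Z * arrow_count bd x y
       else arrow_count bd x y;
     pstr := fun x r y =>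
       nat_of_bool [&& x == Phi 1 1, (0 < r < n)%N & y == Cc r] |}.

Definition marked_labels bd : seq label :=
  [seq H i.+1 i.+1 | i <- iota 1 n.-1 & Gam2 bd i].

Definition is_phi_or_c (x : label) : bool := if x is H _ _ then false else true.

End InitialSeed.

(* Main.v *)
(* The sequence defining F stabilizes at the unique factorable fixed point of
   V = tilde gamma^*(V_-) U. Since rho(U) = tilde gamma^*(U_- rho(U)), the matrix
   U rho(U) is such a fixed point for Q(U), so F(Q(U)) = U rho(U): right
   multiplication by a lower unipotent matrix changes neither the trailing minors
   that define the h-functions nor, as conjugation, the phi- and c-functions. In
   the other direction, nu(V) = tilde gamma^*(F(V)_-) recovers rho(U) from
   V = Q(U), which gives the inverse of Q.
   The marked variables for Gamma are regular because the product of trailing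
   minors of F(U) along a gamma-string is rewritten, by following the string and
   enlarging the determinant at each step, as one determinant polynomial in U;
   the same device shows that the entries of rho and nu have only marked
   denominators.
   The relations between related seeds persist under mutation: the exponents of
   the marked variables on the two sides of an exchange relation agree as soon as
   sum_x b_kx lambda_xm = tilde b_km, a condition preserved by matrix mutation. For
   the initial seeds it says that the arrows attached to gamma cancel, along each
   gamma-string, the arrows from the ends of the rows of the h-quiver. *)

Require Import Defs.
From mathcomp Require Import all_boot all_order all_algebra.
From mathcomp Require Import reals complex.
From mathcomp Require Import mpoly boolp classical_sets.
From mathcomp Require Import ring lra zify.

Set Implicit Arguments.
Unset Strict Implicit.
Unset Printing Implicit Defensive.

Import Order.TTheory GRing.Theory Num.Theory.
Local Open Scope ring_scope.

(** * Generic properties on the group *)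

(** Everything about [tgamma] rests on a closed formula. Gamma maps a connected piece of Gamma1
    monotonically onto an interval; where it preserves orientation [tgamma M] copies a block of M,
    where it reverses orientation it copies, up to signs, a reflected block of M^-1. Treating M and
    M^-1 as a pair makes this rule multiplicative. Nilpotency enters through the maximal parabolics
    [stab r]: if M lies in that of gamma(r), then [tgamma M] lies in that of r, and nothing is asked
    of M when r is outside Gamma1. Unipotent matrices are therefore compared root by root, by
    induction on [steps], which gives the stabilization of F and the uniqueness of its limit.
    Reversed pieces are also the obstacle to polynomiality along strings: rows of [tgamma M] then
    come from columns of M^-1, and complementary minors turn them into rows of M again. Generic
    claims about the maps are checked at the identity matrix, a common point of GL_n and SL_n that
    these maps fix. The classes of functions in play (polynomial, defined at the identity, regular,
    localized) all satisfy [funring], so closure under determinants and [tgamma] is proved once. *)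

Record funring (C : comNzRingType) (T : Type) (S : (T -> C) -> Prop) : Prop := FunRing {
  S_cst : forall c, S (fun=> c);
  S_add : forall f g, S f -> S g -> S (fun x => f x + g x);
  S_mul : forall f g, S f -> S g -> S (fun x => f x * g x) }.

Section FunRing.
Variables (C : comNzRingType) (T : Type) (S : (T -> C) -> Prop).
Hypothesis SR : funring S.

Lemma S_ext f g : S f -> f =1 g -> S g.
Proof. by move=> Sf /funext <-. Qed.

Lemma S_opp f : S f -> S (fun x => - f x).
Proof.
move=> Sf; apply: (S_ext (S_mul SR (S_cst SR (-1)) Sf)) => x.
by rewrite mulN1r.
Qed.

Lemma S_sum (I : Type) (r : seq I) (P : pred I) (F : I -> T -> C) :
  (forall i, P i -> S (F i)) -> S (fun x => \sum_(i <- r | P i) F i x).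
Proof.
move=> SF; elim: r => [|i r IH].
  by apply: (S_ext (S_cst SR 0)) => x; rewrite big_nil.
case Pi: (P i); last by apply: (S_ext IH) => x; rewrite big_cons Pi.
by apply: (S_ext (S_add SR (SF i Pi) IH)) => x; rewrite big_cons Pi.
Qed.

Lemma S_prod_seq (I : eqType) (r : seq I) (F : I -> T -> C) :
  (forall i, i \in r -> S (F i)) -> S (fun x => \prod_(i <- r) F i x).
Proof.
elim: r => [|i r IH] SF.
  by apply: (S_ext (S_cst SR 1)) => x; rewrite big_nil.
have SFr : S (fun x => \prod_(i <- r) F i x).
  by apply: IH => j jr; apply: SF; rewrite inE jr orbT.
have SFi : S (F i) by apply: SF; rewrite inE eqxx.
by apply: (S_ext (S_mul SR SFi SFr)) => x; rewrite big_cons.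
Qed.

Lemma S_prod (I : Type) (r : seq I) (F : I -> T -> C) :
  (forall i, S (F i)) -> S (fun x => \prod_(i <- r) F i x).
Proof.
move=> SF; elim: r => [|i r IH].
  by apply: (S_ext (S_cst SR 1)) => x; rewrite big_nil.
by apply: (S_ext (S_mul SR (SF i) IH)) => x; rewrite big_cons.
Qed.

Lemma S_exp f k : S f -> S (fun x => f x ^+ k).
Proof.
move=> Sf; elim: k => [|k IH]; first exact: (S_cst SR 1).
by apply: (S_ext (S_mul SR Sf IH)) => x; rewrite exprS.
Qed.

Definition S_mx m p (A : T -> 'M[C]_(m, p)) := forall i j, S (fun x => A x i j).

Lemma S_mx_cst m p (A : 'M[C]_(m, p)) : S_mx (fun=> A).
Proof. by move=> i j; apply: (S_cst SR). Qed.

Lemma S_mx_add m p (A B : T -> 'M[C]_(m, p)) :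
  S_mx A -> S_mx B -> S_mx (fun x => A x + B x).
Proof.
move=> SA SB i j; apply: (S_ext (S_add SR (SA i j) (SB i j))) => x.
by rewrite !mxE.
Qed.

Lemma S_mx_mul m p q (A : T -> 'M[C]_(m, p)) (B : T -> 'M[C]_(p, q)) :
  S_mx A -> S_mx B -> S_mx (fun x => A x *m B x).
Proof.
move=> SA SB i j.
apply: (@S_ext (fun x => \sum_k A x i k * B x k j)); last by move=> x; rewrite mxE.
by apply: S_sum => k _; apply: S_mul.
Qed.

Lemma S_mx_tr m p (A : T -> 'M[C]_(m, p)) : S_mx A -> S_mx (fun x => (A x)^T).
Proof. by move=> SA i j; apply: (S_ext (SA j i)) => x; rewrite mxE. Qed.

Lemma S_mx_col m1 m2 p (A : T -> 'M[C]_(m1, p)) (B : T -> 'M[C]_(m2, p)) :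
  S_mx A -> S_mx B -> S_mx (fun x => col_mx (A x) (B x)).
Proof.
move=> SA SB i j; rewrite -(splitK i); case: (split i) => k /=.
  by apply: (S_ext (SA k j)) => x; rewrite col_mxEu.
by apply: (S_ext (SB k j)) => x; rewrite col_mxEd.
Qed.

Lemma S_mx_row m p1 p2 (A : T -> 'M[C]_(m, p1)) (B : T -> 'M[C]_(m, p2)) :
  S_mx A -> S_mx B -> S_mx (fun x => row_mx (A x) (B x)).
Proof.
move=> SA SB i j; rewrite -(splitK j); case: (split j) => k /=.
  by apply: (S_ext (SA i k)) => x; rewrite row_mxEl.
by apply: (S_ext (SB i k)) => x; rewrite row_mxEr.
Qed.

Lemma S_det m (A : T -> 'M[C]_m) : S_mx A -> S (fun x => \det (A x)).
Proof.
move=> SA; apply: S_sum => s _; apply: (S_mul SR); first exact: (S_cst SR).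
by apply: S_prod => i; apply: SA.
Qed.

Lemma S_adj m (A : T -> 'M[C]_m) : S_mx A -> S_mx (fun x => \adj (A x)).
Proof.
move=> SA i j.
apply: (@S_ext (fun x => cofactor (A x) j i)); last by move=> x; rewrite mxE.
apply: (S_mul SR); first exact: (S_cst SR).
apply: S_det => k l; apply: (S_ext (SA (lift j k) (lift i l))) => x.
by rewrite !mxE.
Qed.

End FunRing.

Section Polynomials.
Variables (C : fieldType) (n : nat).
Implicit Types (f g : 'M[C]_n -> C) (p q : {mpoly C[n * n]}).

Lemma peval_cst c U : peval (c%:MP_[n * n]) U = c :> C.
Proof. by rewrite /peval mevalC. Qed.

Lemma pevalD p q U : peval (p + q) U = peval p U + peval q U.
Proof. by rewrite /peval mevalD. Qed.

Lemma pevalM p q U : peval (p * q) U = peval p U * peval q U.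
Proof. by rewrite /peval mevalM. Qed.

Definition polyfun f := exists p, f =1 peval p.

Lemma polyfun_funring : funring polyfun.
Proof.
split=> [c|f g [p fp] [q gq]|f g [p fp] [q gq]].
- by exists (c%:MP_[n * n]) => U; rewrite peval_cst.
- by exists (p + q) => U; rewrite pevalD fp gq.
- by exists (p * q) => U; rewrite pevalM fp gq.
Qed.

Lemma polyfun_mx : S_mx polyfun (fun U : 'M[C]_n => U).
Proof.
move=> i j; exists 'X_(mxvec_index i j) => U.
by rewrite /peval mevalXU mxvecE.
Qed.

Lemma peval_comp (T : Type) (S : (T -> C) -> Prop) (Q : T -> 'M[C]_n) p :
  funring S -> S_mx S Q -> S (fun x => peval p (Q x)).
Proof.
move=> SR SQ.
have SE : S (fun x => \sum_(m <- msupp p) p@_m * \prod_i mxvec (Q x) 0 i ^+ m i).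
  apply: (S_sum SR) => m _; apply: (S_mul SR); first exact: (S_cst SR).
  apply: (S_prod SR) => i; apply: (S_exp SR).
  case/mxvec_indexP: i => i j; apply: (S_ext (SQ i j)) => x.
  by rewrite mxvecE.
by apply: (S_ext SE) => x; rewrite /peval mevalE.
Qed.

Lemma polyfun_comp (T : Type) (S : (T -> C) -> Prop) (Q : T -> 'M[C]_n) f :
  funring S -> S_mx S Q -> polyfun f -> S (fun x => f (Q x)).
Proof.
move=> SR SQ [p fp]; apply: (S_ext (peval_comp p SR SQ)) => x.
by rewrite fp.
Qed.

Lemma polyfun_det : polyfun (fun U => \det U).
Proof. exact: (S_det polyfun_funring polyfun_mx). Qed.

End Polynomials.

(** * Irreducibility of the group, and functions defined at the identity *)

Section Irreducibility.
Variables (C : numFieldType) (n : nat).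
Hypothesis n_gt0 : (0 < n)%N.
Implicit Types (G : group_kind) (P : 'M[C]_n -> Prop).

(** In characteristic zero the naturals below [size h] are distinct, and they are too many to be all
    roots. *)
Lemma poly_nonroot (h : {poly C}) : h != 0 -> exists t, h.[t] != 0.
Proof.
move=> h0; pose rs : seq C := [seq k%:R | k <- iota 0 (size h)].
have [/hasP[t _ ht]|nh] := boolP (has (fun t => h.[t] != 0) rs); first by exists t.
have ar : all (root h) rs.
  by apply/allP => t tr; apply/negPn/(hasPn nh).
have ur : uniq rs.
  by rewrite map_inj_uniq ?iota_uniq // => a b /eqP; rewrite eqr_nat => /eqP.
by have := max_poly_roots h0 ar ur; rewrite size_map size_iota ltnn.
Qed.

(** The shape of a polynomial on matrices evaluated along a rational curve with denominator d;
    whether it vanishes identically is decided by the numerator [h]. *)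
Definition dfrac (d : {poly C}) (f : C -> C) : Prop :=
  exists (h : {poly C}) (e : nat), forall t, d.[t] != 0 -> f t = h.[t] / d.[t] ^+ e.

Lemma dfrac_funring d : funring (dfrac d).
Proof.
split=> [c|f g [h [e fh]] [k [l gk]]|f g [h [e fh]] [k [l gk]]].
- by exists c%:P, 0%N => t _; rewrite hornerC divr1.
- exists (h * d ^+ l + k * d ^+ e), (e + l)%N => t dt.
  rewrite fh // gk // ?hornerD !hornerM ?horner_exp exprD.
  move: (expf_neq0 e dt) (expf_neq0 l dt).
  by move: (d.[t] ^+ e) (d.[t] ^+ l) => x y x0 y0; field; rewrite ?x0 ?y0.
- exists (h * k), (e + l)%N => t dt.
  rewrite fh // gk // ?hornerD !hornerM ?horner_exp exprD.
  move: (expf_neq0 e dt) (expf_neq0 l dt).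
  by move: (d.[t] ^+ e) (d.[t] ^+ l) => x y x0 y0; field; rewrite ?x0 ?y0.
Qed.

(* For SL the segment from U0 to U1 is pushed back into the group by dividing
   the first row by the determinant. *)
Lemma group_curve G (U0 U1 : 'M[C]_n) : in_group G U0 -> in_group G U1 ->
  exists (d : {poly C}) (c : C -> 'M[C]_n),
    [/\ d.[0] != 0 /\ d.[1] != 0, c 0 = U0 /\ c 1 = U1,
        forall t, d.[t] != 0 -> in_group G (c t) & S_mx (dfrac d) c].
Proof.
move=> G0 G1; pose W (t : C) := U0 + t *: (U1 - U0).
pose Wp : 'M[{poly C}]_n := map_mx polyC U0 + 'X *: map_mx polyC (U1 - U0).
have Wh t i j : W t i j = (Wp i j).[t] by rewrite !mxE !hornerE.
pose d := \det Wp.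
have dE t : d.[t] = \det (W t).
  rewrite /d -[LHS]/(horner_eval t _) -det_map_mx; congr (\det _).
  by apply/matrixP => i j; rewrite Wh mxE.
have W0 : W 0 = U0 by rewrite /W scale0r addr0.
have W1 : W 1 = U1 by rewrite /W scale1r addrC subrK.
have SW : S_mx (dfrac d) W.
  by move=> i j; exists (Wp i j), 0%N => t _; rewrite Wh divr1.
case: G G0 G1 => /= G0 G1.
  exists d, W; split=> // [|t]; first by rewrite !dE W0 W1.
  by rewrite dE.
pose i0 := Ordinal n_gt0.
pose D t : 'M[C]_n := diag_mx (\row_i (if i == i0 then (d.[t])^-1 else 1)).
exists d, (fun t => D t *m W t); split.
- by rewrite !dE W0 W1 G0 G1 oner_eq0.
- have D1 t : d.[t] = 1 -> D t = 1%:M.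
    move=> dt; apply/matrixP => i j; rewrite !mxE dt invr1; by case: (i == i0).
  by rewrite !D1 ?dE ?W0 ?W1 // !mul1mx.
- move=> t dt; rewrite det_mulmx -dE det_diag (bigD1 i0) //= big1 ?mulr1 => [|i ni].
    by rewrite mxE eqxx mulVf.
  by rewrite mxE (negbTE ni).
- apply: (S_mx_mul (dfrac_funring d)) SW => i j.
  case: (eqVneq i j) => [->|nij]; last first.
    exists 0, 0%N => t _; rewrite !mxE (negbTE nij) mulr0n horner0 mul0r //.
  case: (eqVneq j i0) => [->|nj].
    by exists 1, 1%N => t _; rewrite !mxE !eqxx mulr1n hornerE expr1 mul1r.
  by exists 1, 0%N => t _; rewrite !mxE eqxx (negbTE nj) mulr1n hornerE divr1.
Qed.

(** Irreducibility of the group: the two witness points are joined by a rational curve, along which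
    both polynomials have nonzero numerators, and a product of nonzero one-variable polynomials has
    a nonroot. *)
Lemma generically_and G P P' :
  generically G P -> generically G P' -> generically G (fun U => P U /\ P' U).
Proof.
move=> [p [[U0 G0 p0] Pp]] [q [[U1 G1 q1] Pq]].
exists (p * q); split; last first.
  move=> U GU; rewrite pevalM mulf_eq0 negb_or => /andP[pU qU].
  by split; [apply: Pp|apply: Pq].
have [d [c [[d0 d1] [c0 c1] dG Sc]]] := group_curve G0 G1.
have [h [e hE]] := peval_comp p (dfrac_funring d) Sc.
have [k [l kE]] := peval_comp q (dfrac_funring d) Sc.
have nz0 : h != 0.
  by apply: contraNneq p0 => h0; rewrite -c0 hE // h0 horner0 mul0r.
have nz1 : k != 0.
  by apply: contraNneq q1 => k0; rewrite -c1 kE // k0 horner0 mul0r.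
have nzd : d != 0 by apply: contraNneq d0 => ->; rewrite horner0.
have [t] : exists t, (h * k * d).[t] != 0 by apply: poly_nonroot; rewrite !mulf_neq0.
rewrite !hornerM !mulf_eq0 !negb_or => /andP[/andP[ht kt] dt].
exists (c t); first exact: dG.
by rewrite pevalM hE // kE // !mulf_neq0 ?invr_neq0 ?expf_neq0.
Qed.

Lemma in_group1 G : @in_group C n G 1%:M.
Proof. by case: G => /=; rewrite det1 ?oner_eq0. Qed.

Lemma in_group_unit G (U : 'M[C]_n) : in_group G U -> U \in unitmx.
Proof. by case: G => /= GU; rewrite unitmxE unitfE // GU oner_eq0. Qed.

Lemma generically_mono G P P' :
  (forall U, in_group G U -> P U -> P' U) -> generically G P -> generically G P'.
Proof.
move=> PP' [q [qU qP]]; exists q; split=> // U GU qU'; apply: PP' => //.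
exact: qP.
Qed.

Lemma generically_all G P : (forall U, in_group G U -> P U) -> generically G P.
Proof.
move=> aP; exists 1%:MP; split=> [|U GU _]; last exact: aP.
by exists 1%:M; rewrite ?peval_cst ?oner_eq0 //; apply: in_group1.
Qed.

Lemma generically_in (I : eqType) (r : seq I) G (P : I -> 'M[C]_n -> Prop) :
  (forall i, i \in r -> generically G (P i)) ->
  generically G (fun U => forall i, i \in r -> P i U).
Proof.
elim: r => [|i r IH] H; first by apply: generically_all => U _ i.
have Hi : generically G (P i) by apply: H; rewrite inE eqxx.
have Hr : generically G (fun U => forall j, j \in r -> P j U).
  by apply: IH => j jr; apply: H; rewrite inE jr orbT.
apply: generically_mono (generically_and Hi Hr) => U _ [PiU PrU] j.
by rewrite inE => /orP[/eqP->|/PrU].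
Qed.

(** The identity belongs to both groups, so one such statement serves GL and SL at once, and
    conjunctions need no curve: the product of the two polynomials is nonzero at the identity. *)
Definition near1 P := exists q : {mpoly C[n * n]},
  peval q 1%:M != 0 /\ forall U, peval q U != 0 -> P U.

Lemma near1_generically G P : near1 P -> generically G P.
Proof.
move=> [q [q1 qP]]; exists q; split=> [|U _ /qP//].
by exists 1%:M => //; apply: in_group1.
Qed.

Lemma near1_and P P' : near1 P -> near1 P' -> near1 (fun U => P U /\ P' U).
Proof.
move=> [p [p1 pP]] [q [q1 qP]]; exists (p * q); rewrite pevalM mulf_neq0 //.
by split=> // U; rewrite pevalM mulf_eq0 negb_or => /andP[/pP ? /qP ?].
Qed.

Lemma near1_mono P P' : (forall U, P U -> P' U) -> near1 P -> near1 P'.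
Proof. by move=> PP' [p [p1 pP]]; exists p; split=> // U /pP /PP'. Qed.

Lemma near1_all P : (forall U, P U) -> near1 P.
Proof. by move=> aP; exists 1%:MP; rewrite peval_cst oner_eq0. Qed.

Lemma near1_in (I : eqType) (r : seq I) (P : I -> 'M[C]_n -> Prop) :
  (forall i, i \in r -> near1 (P i)) -> near1 (fun U => forall i, i \in r -> P i U).
Proof.
elim: r => [|i r IH] H; first by apply: near1_all => U i.
have Hi : near1 (P i) by apply: H; rewrite inE eqxx.
have Hr : near1 (fun U => forall j, j \in r -> P j U).
  by apply: IH => j jr; apply: H; rewrite inE jr orbT.
apply: near1_mono (near1_and Hi Hr) => U [PiU PrU] j.
by rewrite inE => /orP[/eqP->|/PrU].
Qed.

Lemma near1_unit : near1 (fun U => U \in unitmx).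
Proof.
have [p dp] := @polyfun_det C n; exists p; rewrite -dp det1 oner_eq0; split=> // U.
by rewrite -dp unitmxE unitfE.
Qed.

(** The local ring of matrix space at the identity, on total functions. Composition with a map
    fixing the identity stays inside it. *)
Definition reg1 (f : 'M[C]_n -> C) := exists p q : {mpoly C[n * n]},
  peval q 1%:M != 0 /\ forall U, peval q U != 0 -> f U = peval p U / peval q U.

Lemma reg1_funring : funring reg1.
Proof.
split=> [c|f g [p [q [q1 fE]]] [r [s [s1 gE]]]|f g [p [q [q1 fE]]] [r [s [s1 gE]]]].
- exists c%:MP, 1%:MP; rewrite !peval_cst oner_eq0; split=> // U _.
  by rewrite !peval_cst divr1.
- exists (p * s + r * q), (q * s); rewrite pevalM mulf_neq0 //; split=> // U.
  rewrite pevalD !pevalM mulf_eq0 negb_or => /andP[qU sU].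
  by rewrite fE // gE //; field; rewrite ?qU ?sU ?rU.
- exists (p * r), (q * s); rewrite pevalM mulf_neq0 //; split=> // U.
  rewrite !pevalM mulf_eq0 negb_or => /andP[qU sU].
  by rewrite fE // gE //; field; rewrite ?qU ?sU ?rU.
Qed.

Lemma reg1_near f g : reg1 f -> near1 (fun U => f U = g U) -> reg1 g.
Proof.
move=> [p [q [q1 fE]]] [r [r1 fg]]; exists (p * r), (q * r).
rewrite pevalM mulf_neq0 //; split=> // U.
rewrite !pevalM mulf_eq0 negb_or => /andP[qU rU].
by rewrite -fg // fE //; field; rewrite ?qU ?sU ?rU.
Qed.

Lemma reg1_neq0 f : reg1 f -> f 1%:M != 0 -> near1 (fun U => f U != 0).
Proof.
move=> [p [q [q1 fE]]] f1; exists (p * q); rewrite pevalM mulf_neq0 //; last first.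
  by move: f1; rewrite fE // mulf_eq0 negb_or => /andP[].
split=> // U; rewrite pevalM mulf_eq0 negb_or => /andP[pU qU].
by rewrite fE // mulf_neq0 ?invr_neq0.
Qed.

Lemma reg1_inv f : reg1 f -> f 1%:M != 0 -> reg1 (fun U => (f U)^-1).
Proof.
move=> [p [q [q1 fE]]] f1; exists (q * q), (p * q).
have p1 : peval p 1%:M != 0.
  by move: f1; rewrite fE // mulf_eq0 negb_or => /andP[].
rewrite pevalM mulf_neq0 //; split=> // U.
rewrite !pevalM mulf_eq0 negb_or => /andP[pU qU].
by rewrite fE //; field; rewrite ?qU ?pU.
Qed.

Lemma reg1_poly f : polyfun f -> reg1 f.
Proof.
move=> [p fp]; exists p, 1%:MP; rewrite peval_cst oner_eq0; split=> // U _.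
by rewrite peval_cst divr1.
Qed.

Lemma reg1_mx : S_mx reg1 (fun U => U).
Proof. by move=> i j; apply/reg1_poly/polyfun_mx. Qed.

Lemma near1_comp P (Q : 'M[C]_n -> 'M[C]_n) : S_mx reg1 Q -> Q 1%:M = 1%:M ->
  near1 P -> near1 (fun U => P (Q U)).
Proof.
move=> SQ Q1 [q [q1 qP]].
have : near1 (fun U => peval q (Q U) != 0).
  by apply: reg1_neq0; [apply: peval_comp reg1_funring SQ|rewrite Q1].
by apply: near1_mono => U; apply: qP.
Qed.

Lemma reg1_comp f (Q : 'M[C]_n -> 'M[C]_n) : S_mx reg1 Q -> Q 1%:M = 1%:M ->
  reg1 f -> reg1 (fun U => f (Q U)).
Proof.
move=> SQ Q1 [p [q [q1 fE]]].
have [] := (peval_comp p reg1_funring SQ, peval_comp q reg1_funring SQ) => Rp Rq.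
have q1' : peval q (Q 1%:M) != 0 by rewrite Q1.
apply: reg1_near (S_mul reg1_funring Rp (reg1_inv Rq q1')) _.
by apply: near1_mono (near1_comp SQ Q1 (ex_intro _ q (conj q1 fE))) => U ->.
Qed.

Lemma reg1_rational G f : reg1 f -> rational_fun G f.
Proof.
move=> [p [q [q1 fE]]]; exists p, q; exists q; split=> [|U _ qU].
  by exists 1%:M => //; apply: in_group1.
by split=> //; apply: fE.
Qed.

End Irreducibility.

(** * Strings of a Belavin-Drinfeld triple *)

Section BDCombinatorics.
Variables (n : nat) (bd : BD_triple n).
Local Notation G1 := (Gam1 bd).
Local Notation G2 := (Gam2 bd).
Local Notation g := (gam bd).
Local Notation gs := (gams bd).

Lemma G1_range i : G1 i -> (0 < i < n)%N.
Proof. by case: bd => ? ? ? ? H ? ? ? ? ? /= /H; lia. Qed.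

Lemma G2_range i : G2 i -> (0 < i < n)%N.
Proof. by case: bd => ? ? ? ? ? H ? ? ? ? /= /H; lia. Qed.

Lemma gam_G2 i : G1 i -> G2 (g i).
Proof. by case: bd => ? ? ? ? ? ? H ? ? ? /= /H[]. Qed.

Lemma gamK i : G1 i -> gs (g i) = i.
Proof. by case: bd => ? ? ? ? ? ? H ? ? ? /= /H[]. Qed.

Lemma gams_G1 i : G2 i -> G1 (gs i).
Proof. by case: bd => ? ? ? ? ? ? ? H ? ? /= /H[]. Qed.

Lemma gamsK i : G2 i -> g (gs i) = i.
Proof. by case: bd => ? ? ? ? ? ? ? H ? ? /= /H[]. Qed.

Lemma gam_adj i j : G1 i -> G1 j -> adjacent (g i) (g j) = adjacent i j.
Proof. by case: bd => ? ? ? ? ? ? ? ? H ? /=; apply: H. Qed.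

Lemma gam_nil i : G1 i -> exists m, ~~ G1 (iter m g i).
Proof. by case: bd => ? ? ? ? ? ? ? ? ? H /=; apply: H. Qed.

Lemma gam_inj i j : G1 i -> G1 j -> g i = g j -> i = j.
Proof. by move=> Gi Gj gij; rewrite -(gamK Gi) gij gamK. Qed.

(* The roots j + 1, ..., i, i.e. the interval attached to the matrix position
   (i, j) with 0-based indices. *)
Definition seg j i := all G1 (iota j.+1 (i - j)).

Lemma segP j i : reflect (forall c, (j < c <= i)%N -> G1 c) (seg j i).
Proof.
apply: (iffP allP) => H c; last by rewrite mem_iota => cji; apply: H; lia.
by move=> cji; apply: H; rewrite mem_iota; lia.
Qed.

Lemma seg_cat j k i : (j <= k <= i)%N -> seg j i = seg j k && seg k i.
Proof.
move=> jki; apply/segP/andP => [H|[/segP H /segP H'] c cji].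
  by split; apply/segP => c ?; apply: H; lia.
by have [ck|kc] := leqP c k; [apply: H|apply: H']; lia.
Qed.

(** Isometry makes consecutive roots go to neighbours, and injectivity forbids turning back, so the
    direction chosen at the first step is kept along the whole segment. *)
Lemma seg_mono j i : (j < i)%N -> seg j i ->
  (forall c, (j < c <= i)%N -> g c = g j.+1 + (c - j.+1))%N \/
  (forall c, (j < c <= i)%N -> g c + (c - j.+1) = g j.+1)%N.
Proof.
elim: i => // i IH ji; have [<-|nij] := eqVneq j i.
  move=> _; left=> c cj; have -> : c = j.+1 by lia.
  by rewrite subnn addn0.
have ji' : (j < i)%N by lia.
rewrite (@seg_cat j i i.+1); last by lia.
case/andP=> s s1; have Gi : G1 i by move/segP: s; apply; lia.
have Gi1 : G1 i.+1 by move/segP: s1; apply; lia.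
have adj : adjacent (g i) (g i.+1) by rewrite gam_adj // /adjacent eqxx.
have npre : (j.+1 < i)%N -> g i.+1 <> g i.-1.
  move=> ji2 e; have Gi' : G1 i.-1 by move/segP: s; apply; lia.
  by have := gam_inj Gi1 Gi' e; lia.
case: (IH ji' s) => H.
- have gi := H i; have gi' := H i.-1.
  have [e|e] := eqVneq i j.+1.
    subst i; move: adj; rewrite /adjacent => /orP[]/eqP e.
      left=> c cj; have [->|->] : c = j.+1 \/ c = j.+2 by lia.
        by lia.
      by lia.
    right=> c cj; have [->|->] : c = j.+1 \/ c = j.+2 by lia.
      by lia.
    by lia.
  left=> c cj; have [/H->//|->] : (j < c <= i)%N \/ c = i.+1 by lia.
  by move: adj; rewrite /adjacent => /orP[]/eqP; lia.
- have gi := H i; have gi' := H i.-1.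
  have [e|e] := eqVneq i j.+1.
    subst i; move: adj; rewrite /adjacent => /orP[]/eqP e.
      left=> c cj; have [->|->] : c = j.+1 \/ c = j.+2 by lia.
        by lia.
      by lia.
    right=> c cj; have [->|->] : c = j.+1 \/ c = j.+2 by lia.
      by lia.
    by lia.
  right=> c cj; have [/H->//|->] : (j < c <= i)%N \/ c = i.+1 by lia.
  by move: adj; rewrite /adjacent => /orP[]/eqP; lia.
Qed.

Lemma seg_inc j i c : (j < c <= i)%N -> seg j i -> (g j.+1 <= g i)%N ->
  (g c = g j.+1 + (c - j.+1))%N.
Proof.
move=> cji s; have ji : (j < i)%N by lia.
case: (seg_mono ji s) => H; first by move=> _; apply: H.
move=> le; have := H i; have := H c cji => Hc Hi.
(* A decreasing image whose last value is not below its first comes from a single root. *)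
have e : (i = j.+1)%N by lia.
have -> : c = j.+1 by lia.
by rewrite subnn addn0.
Qed.

Lemma seg_dec j i c : (j < c <= i)%N -> seg j i -> (g i <= g j.+1)%N ->
  (g c + (c - j.+1) = g j.+1)%N.
Proof.
move=> cji s; have ji : (j < i)%N by lia.
case: (seg_mono ji s) => H; last by move=> _; apply: H.
move=> le; have := H i; have := H c cji => Hc Hi.
have e : (i = j.+1)%N by lia.
have -> : c = j.+1 by lia.
by rewrite subnn addn0.
Qed.

Hypothesis n_gt0 : (0 < n)%N.

(* Pigeonhole: a repeated iterate would make the string periodic, against nilpotency. *)
Lemma steps_exists a : (0 < a)%N -> exists2 t, (t < n)%N & ~~ G1 (iter t g a).
Proof.
move=> a0; apply: contrapT => H.
have aG t : (t < n)%N -> G1 (iter t g a).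
  by move=> tn; apply: contraPT H => nG; case; exists t.
have : ~~ uniq [seq iter t g a | t <- iota 0 n].
  apply/negP => u; have: (size [seq iter t g a | t <- iota 0 n] <= size (iota 1 n.-1))%N.
    apply: uniq_leq_size u _ => x /mapP[t]; rewrite mem_iota => tn ->.
    have /aG/G1_range : (t < n)%N by lia.
    by rewrite mem_iota; lia.
  by rewrite size_map !size_iota; lia.
case/(uniqPn 0%N) => s [t]; rewrite size_map size_iota => -[st tn].
rewrite !(nth_map 0%N) ?size_iota ?nth_iota ?add0n; [|lia..] => e.
have [m /negP] := gam_nil (aG s (ltn_trans st tn)).
have per k : iter (k * (t - s)) g (iter s g a) = iter s g a.
  elim: k => // k IH; rewrite mulSn iterD IH -iterD subnK 1?ltnW //.
apply.
have -> : m = (m %% (t - s) + m %/ (t - s) * (t - s))%N by rewrite addnC -divn_eq.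
rewrite iterD per -iterD; apply: aG.
have : (m %% (t - s) < t - s)%N by rewrite ltn_mod; lia.
lia.
Qed.

Lemma steps_ltn a : (0 < a)%N -> (steps bd a < n)%N.
Proof.
move=> /steps_exists[t tn nG]; rewrite /steps -[ltnRHS](size_iota 0 n) -has_find.
by apply/hasP; exists t; rewrite ?mem_iota.
Qed.

Lemma steps_G1 a t : (0 < a)%N -> (t < steps bd a)%N -> G1 (iter t g a).
Proof.
move=> a0 tsa; have := before_find 0%N tsa; rewrite nth_iota; last first.
  by have := steps_ltn a0; lia.
by move=> /negbT/negPn.
Qed.

Lemma steps_last a : (0 < a)%N -> ~~ G1 (iter (steps bd a) g a).
Proof.
move=> a0; have sn := steps_ltn a0.
have /(nth_find 0%N) : has (fun t => ~~ G1 (iter t g a)) (iota 0 n).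
  by rewrite has_find size_iota.
by rewrite nth_iota.
Qed.

Lemma steps_uniq a m : (0 < a)%N -> (forall t, (t < m)%N -> G1 (iter t g a)) ->
  ~~ G1 (iter m g a) -> steps bd a = m.
Proof.
move=> a0 H nG; have [sm|ms|//] := ltngtP (steps bd a) m.
  by have := steps_last a0; rewrite H.
by have := steps_G1 a0 ms; rewrite (negbTE nG).
Qed.

Lemma stepsS a : G1 a -> steps bd a = (steps bd (g a)).+1.
Proof.
move=> Ga; have a0 : (0 < a)%N by have := G1_range Ga; lia.
have g0 : (0 < g a)%N by have := G2_range (gam_G2 Ga); lia.
apply: steps_uniq => // [[|t] //|].
  by rewrite ltnS iterSr => /(steps_G1 g0).
by rewrite iterSr steps_last.
Qed.

Lemma steps0 a : ~~ G1 a -> (0 < a)%N -> steps bd a = 0%N.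
Proof. by move=> nG a0; apply: steps_uniq. Qed.

End BDCombinatorics.

Lemma sum_shift (V : nmodType) a b (F : nat -> V) :
  \sum_(a <= k < b) F k = \sum_(0 <= t < b - a) F (t + a)%N.
Proof. by rewrite -{1}[a]add0n big_addn. Qed.

(** * The homomorphism of unipotent groups *)

Section Entries.
Variables (C : fieldType) (n : nat).
Implicit Types X Y : 'M[C]_n.

Lemma entryE X (i j : 'I_n) : entry X i.+1 j.+1 = X i j.
Proof.
by rewrite /entry /= (insubT (fun k => (k < n)%N) (ltn_ord i)) (insubT (fun k => (k < n)%N) (ltn_ord j)) /=; congr (X _ _); apply: val_inj.
Qed.

Lemma entry_default X i j : (n <= i)%N || (n <= j)%N -> entry X i.+1 j.+1 = 0.
Proof.
rewrite /entry /=; case: insubP => // i' _ <-; case: insubP => // j' _ <-.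
by rewrite leqNgt ltn_ord leqNgt ltn_ord.
Qed.

Lemma entry_fun (f : nat -> nat -> C) i j : (i < n)%N -> (j < n)%N ->
  entry (\matrix_(i < n, j < n) f i j) i.+1 j.+1 = f i j.
Proof. by move=> i_n j_n; rewrite (entryE _ (Ordinal i_n) (Ordinal j_n)) mxE. Qed.

Lemma entry_inj X Y :
  (forall i j, (i < n)%N -> (j < n)%N -> entry X i.+1 j.+1 = entry Y i.+1 j.+1) -> X = Y.
Proof. by move=> XY; apply/matrixP => i j; rewrite -!entryE XY. Qed.

Lemma entryD X Y i j : entry (X + Y) i j = entry X i j + entry Y i j.
Proof.
rewrite /entry; case: insub => [x|]; last by rewrite addr0.
by case: insub => [y|]; rewrite ?addr0 // mxE.
Qed.

Lemma entryZ a X i j : entry (a *: X) i j = a * entry X i j.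
Proof.
rewrite /entry; case: insub => [x|]; last by rewrite mulr0.
by case: insub => [y|]; rewrite ?mulr0 // mxE.
Qed.

Lemma entryN X i j : entry (- X) i j = - entry X i j.
Proof. by rewrite -scaleN1r entryZ mulN1r. Qed.

Lemma entryM X Y i j : entry (X *m Y) i.+1 j.+1 =
  \sum_(0 <= k < n) entry X i.+1 k.+1 * entry Y k.+1 j.+1.
Proof.
have [ini|ni] := ltnP i n; last first.
  rewrite entry_default ?ni // big1 // => k _.
  by rewrite entry_default ?mul0r ?ni.
have [jn|nj] := ltnP j n; last first.
  rewrite entry_default ?nj ?orbT // big1 // => k _.
  by rewrite (@entry_default Y) ?mulr0 ?nj ?orbT.
rewrite (entryE _ (Ordinal ini) (Ordinal jn)) mxE big_mkord.
by apply: eq_bigr => k _; rewrite -!entryE.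
Qed.

Definition strict_lower X := forall i j : 'I_n, (i <= j)%N -> X i j = 0.

Lemma strict_entry X i j : strict_lower X -> (i <= j)%N -> entry X i.+1 j.+1 = 0.
Proof.
move=> sX ij; have [H|] := boolP ((n <= i)%N || (n <= j)%N).
  exact: entry_default.
rewrite negb_or -!ltnNge => /andP[i_n j_n].
by rewrite (entryE _ (Ordinal i_n) (Ordinal j_n)) sX.
Qed.

Lemma entryM_strict X Y i j : strict_lower X -> strict_lower Y -> (i <= n)%N ->
  entry (X *m Y) i.+1 j.+1 =
    \sum_(j.+1 <= k < i) entry X i.+1 k.+1 * entry Y k.+1 j.+1.
Proof.
move=> sX sY i_n; rewrite entryM.
have [ji|ij] := leqP j.+1 i; last first.
  rewrite [RHS]big_geq; last by lia.
  rewrite big1 // => k _.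
  have [ik|ki] := leqP i k; first by rewrite (strict_entry sX) ?mul0r.
  by rewrite (strict_entry sY) ?mulr0 //; lia.
rewrite (big_cat_nat (n := j.+1)) //=; last by lia.
rewrite [X in _ + X](big_cat_nat (n := i)) //=.
rewrite [X in X + _]big_nat_cond [X in _ + (_ + X)]big_nat_cond.
rewrite [X in X + _]big1 ?[X in _ + (_ + X)]big1 ?add0r ?addr0 // => k /andP[kij _].
  by rewrite (strict_entry sX) ?mul0r //; lia.
by rewrite (strict_entry sY) ?mulr0 //; lia.
Qed.

Lemma strict_mul X Y : strict_lower X -> strict_lower Y -> strict_lower (X *m Y).
Proof.
move=> sX sY i j ij; rewrite -entryE entryM_strict //; last by rewrite ltnW.
by rewrite big_geq //; lia.
Qed.

Lemma strict_mul_sub X Y c : strict_lower X -> strict_lower Y ->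
  entry (X *m Y) c.+1 c = 0.
Proof.
move=> sX sY; case: c => [|c].
  (* [entry] takes predecessors of its indices, so column 0 is read as column 1. *)
  have e : entry (X *m Y) 1 0 = entry (X *m Y) 1 1 by [].
  by rewrite e; apply: strict_entry => //; apply: strict_mul.
have [cn|nc] := ltnP c.+1 n; last by rewrite entry_default ?nc.
by rewrite entryM_strict ?big_geq //; lia.
Qed.

Lemma strict_add X Y : strict_lower X -> strict_lower Y -> strict_lower (X + Y).
Proof. by move=> sX sY i j ij; rewrite mxE sX ?sY ?addr0. Qed.

Lemma strict_scale a X : strict_lower X -> strict_lower (a *: X).
Proof. by move=> sX i j ij; rewrite mxE sX ?mulr0. Qed.

Lemma strict_opp X : strict_lower X -> strict_lower (- X).
Proof. by move=> sX i j ij; rewrite mxE sX ?oppr0. Qed.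

Lemma strict_0 : strict_lower 0.
Proof. by move=> i j _; rewrite mxE. Qed.

Lemma strict_sum (I : Type) (r : seq I) (P : pred I) (F : I -> 'M[C]_n) :
  (forall i, P i -> strict_lower (F i)) -> strict_lower (\sum_(i <- r | P i) F i).
Proof.
move=> H; elim/big_rec: _ => [|i X Pi]; first exact: strict_0.
by apply/strict_add/H.
Qed.

End Entries.

(** * The Lie algebra homomorphism as a block map *)

Section BlockMap.
Variables (C : fieldType) (n : nat) (bd : BD_triple n).
Local Notation g := (gam bd).
Implicit Types X Y : 'M[C]_n.

(* The map X |-> gamma^*(X) on strictly lower triangular matrices. Where gamma
   preserves the orientation it copies blocks of X; where gamma reverses it, it
   reflects them, which turns products around: the second argument Y carries the
   data for these blocks. On Lie algebra elements Y = - X, on group elements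
   X = M - 1 and Y = M^-1 - 1. *)
Definition rgn X Y i j : C :=
  if (j < i)%N && seg bd j i then
    if (g j.+1 <= g i)%N then entry X (g i).+1 (g j.+1)
    else (-1) ^+ (i - j) * entry Y (g j.+1).+1 (g i)
  else 0.

Definition rg X Y : 'M[C]_n := \matrix_(i, j) rgn X Y i j.

Lemma seg_ltn j i : (j < i)%N -> seg bd j i -> (i < n)%N.
Proof.
move=> ji /segP H; have /H/G1_range : (j < i <= i)%N by lia.
by lia.
Qed.

Lemma rg_entry X Y i j : entry (rg X Y) i.+1 j.+1 = rgn X Y i j.
Proof.
have [H|] := boolP ((n <= i)%N || (n <= j)%N); last first.
  by rewrite negb_or -!ltnNge => /andP[i_n j_n]; apply: entry_fun.
rewrite entry_default // /rgn; case: ifP => // /andP[ji s].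
by have := seg_ltn ji s; move: H; lia.
Qed.

Lemma rg_strict X Y : strict_lower (rg X Y).
Proof. by move=> i j ij; rewrite mxE /rgn ltnNge ij. Qed.

(** A segment with a single root has both orientations; this condition makes the two branches of
    [rgn] agree on it. Pairs of products satisfy it trivially, their entries just below the diagonal
    being zero. *)
Definition consistent X Y := forall c, entry X c.+2 c.+1 = - entry Y c.+2 c.+1.

Lemma gam_pos c : Gam1 bd c -> (g c = (g c).-1.+1)%N.
Proof. by move=> /gam_G2/G2_range; lia. Qed.

Lemma rgn_inc X Y i j : (j < i)%N -> seg bd j i -> (g j.+1 <= g i)%N ->
  rgn X Y i j = entry X (g i).+1 (g j.+1).
Proof. by rewrite /rgn => -> -> ->. Qed.

Lemma rgn_dec X Y i j : (j < i)%N -> seg bd j i -> (g i <= g j.+1)%N ->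
  consistent X Y -> rgn X Y i j = (-1) ^+ (i - j) * entry Y (g j.+1).+1 (g i).
Proof.
move=> ji s le c; rewrite /rgn ji s /=; case: ifP => // le'.
have := @seg_inc _ bd j i i; have := @seg_dec _ bd j i i.
rewrite ji leqnn s le le' => /(_ _ _ _)/esym e1 e2.
have e : (i = j.+1)%N by move: (e1 isT isT isT) (e2 isT isT isT); lia.
subst i; rewrite subSnn expr1 mulN1r.
have /gam_pos -> : Gam1 bd j.+1 by move/segP: s; apply; lia.
exact: c.
Qed.

(** An intermediate index k splits the segment of (i, j) into two segments of the same orientation,
    so the block product matches term by term. On a reversed segment the images of the two halves
    come in the opposite order, which is why the second arguments are multiplied backwards; the
    signs are multiplicative in the length. *)
Lemma rg_mul X Y X' Y' :
  strict_lower X -> strict_lower Y -> strict_lower X' -> strict_lower Y' ->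
  consistent X Y -> consistent X' Y' ->
  rg X Y *m rg X' Y' = rg (X *m X') (Y' *m Y).
Proof.
move=> sX sY sX' sY' c c'; apply: entry_inj => i j i_n j_n.
rewrite entryM_strict ?rg_entry; [|exact: rg_strict..|exact: ltnW].
have [/andP[ji s]|nji] := boolP ((j < i)%N && seg bd j i); last first.
  rewrite /rgn (negbTE nji); rewrite big_nat_cond big1 // => k /andP[kij _].
  rewrite !rg_entry /rgn.
  have [/andP[ki ski]|_] := boolP ((k < i)%N && seg bd k i); last by rewrite mul0r.
  have [/andP[jk skj]|_] := boolP ((j < k)%N && seg bd j k); last by rewrite mulr0.
  case/negP: nji; apply/andP; split; first lia.
  by rewrite (@seg_cat _ _ j k i) ?skj ?ski //; lia.
have Gi : Gam1 bd i by move/segP: s; apply; lia.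
have Gj : Gam1 bd j.+1 by move/segP: s; apply; lia.
have gin := G2_range (gam_G2 Gi); have gjn := G2_range (gam_G2 Gj).
have sk k : (j.+1 <= k < i)%N -> seg bd j k /\ seg bd k i.
  by move=> kij; apply/andP; rewrite -seg_cat //; lia.
have [le|lt] := leqP (g j.+1) (g i).
  rewrite rgn_inc // (gam_pos Gj) entryM_strict //; last by lia.
  have gc k : (j < k <= i)%N -> (g k = g j.+1 + (k - j.+1))%N.
    by move=> kij; apply: seg_inc kij s le.
  rewrite -(gam_pos Gj).
  rewrite (sum_shift j.+1) (sum_shift (g j.+1)).
  rewrite (_ : g i - g j.+1 = i - j.+1)%N; last by have := gc i; lia.
  rewrite big_nat_cond [RHS]big_nat_cond; apply: eq_bigr => t /andP[tb _].
  rewrite !rg_entry.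
  have [s1 s2] : seg bd j (t + j.+1) /\ seg bd (t + j.+1) i by apply: sk; lia.
  have e1 := gc (t + j.+1)%N; have e2 := gc (t + j.+1).+1.
  have e0 := gc i.
  have e1' : (g (t + j.+1) = t + g j.+1)%N by lia.
  have e2' : (g (t + j.+1).+1 = (t + g j.+1).+1)%N by lia.
  rewrite rgn_inc ?e2' //; try lia.
  rewrite rgn_inc ?e1' //; try lia.
have le := ltnW lt.
have cc : consistent (X *m X') (Y' *m Y).
  by move=> d; rewrite !strict_mul_sub ?oppr0.
rewrite rgn_dec // (gam_pos Gi) entryM_strict //; last by lia.
rewrite -(gam_pos Gi).
have gc k : (j < k <= i)%N -> (g k + (k - j.+1) = g j.+1)%N.
  by move=> kij; apply: seg_dec kij s le.
have eg : (g j.+1 = i - j.+1 + g i)%N by have := gc i; lia.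
rewrite (sum_shift j.+1) (sum_shift (g i)) (_ : g j.+1 - g i = i - j.+1)%N; last by lia.
rewrite mulr_sumr.
(* As k increases, its image under gamma decreases, so one of the sums is run backwards. *)
rewrite [RHS]big_nat_rev /= add0n.
rewrite big_nat_cond [RHS]big_nat_cond; apply: eq_bigr => t /andP[tb _].
rewrite !rg_entry.
have [s1 s2] : seg bd j (t + j.+1) /\ seg bd (t + j.+1) i by apply: sk; lia.
have e1 := gc (t + j.+1)%N; have e2 := gc (t + j.+1).+1.
set l := (i - j.+1 - t.+1 + g i)%N; have e0 := gc i.
have e1' : (g (t + j.+1) = l.+1)%N by rewrite /l; lia.
have e2' : (g (t + j.+1).+1 = l)%N by rewrite /l; lia.
rewrite rgn_dec ?e2' //; try lia.
rewrite rgn_dec ?e1' //; try lia.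
have -> : (i - j = (i - (t + j.+1)) + (t + j.+1 - j))%N by lia.
rewrite exprD; ring.
Qed.

Lemma rgD X Y X' Y' : rg X Y + rg X' Y' = rg (X + X') (Y + Y').
Proof.
apply/matrixP => i j; rewrite !mxE /rgn !entryD.
by case: ifP => _; rewrite ?addr0 //; case: ifP => _ //; rewrite mulrDr.
Qed.

Lemma rgZ a X Y : a *: rg X Y = rg (a *: X) (a *: Y).
Proof.
apply/matrixP => i j; rewrite !mxE /rgn !entryZ.
by case: ifP => _; rewrite ?mulr0 //; case: ifP => _ //; rewrite mulrCA.
Qed.

Lemma rg0 : rg 0 0 = 0.
Proof. by have := rgZ 0 0 0; rewrite !scale0r. Qed.

Lemma rg_sum (I : Type) (r : seq I) (P : pred I) (F F' : I -> 'M[C]_n) :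
  \sum_(i <- r | P i) rg (F i) (F' i) =
  rg (\sum_(i <- r | P i) F i) (\sum_(i <- r | P i) F' i).
Proof.
elim: r => [|i r IH]; first by rewrite !big_nil rg0.
by rewrite !big_cons; case: ifP => // _; rewrite IH rgD.
Qed.

Definition Lg X := rg X (- X).

Lemma consistentN X : consistent X (- X).
Proof. by move=> c; rewrite entryN opprK. Qed.

(** By [rg_mul] the second argument of the first product is (-X')(-X) = X'X, so the second argument
    of the commutator is again minus the first. *)
Lemma Lg_bracket X X' : strict_lower X -> strict_lower X' ->
  Lg X *m Lg X' - Lg X' *m Lg X = Lg (X *m X' - X' *m X).
Proof.
move=> sX sX'; have sNX := strict_opp sX; have sNX' := strict_opp sX'.
rewrite /Lg !rg_mul //; do ?exact: consistentN.
rewrite !mulNmx !mulmxN !opprK -[- rg _ _]scaleN1r rgZ rgD !scaleN1r.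
by rewrite opprB addrC.
Qed.

Lemma elem_entry a b i j : (i < n)%N -> (j < n)%N ->
  entry (elem_mx C n a b) i.+1 j.+1 = ((i.+1 == a) && (j.+1 == b))%:R.
Proof. by move=> i_n j_n; rewrite (entry_fun (fun i j => ((i.+1 == a) && (j.+1 == b))%:R)). Qed.

Lemma elem_strict a b : (b < a)%N -> strict_lower (elem_mx C n a b).
Proof.
move=> ba i j ij; rewrite mxE; case: eqP => //= ia; case: eqP => //= jb; lia.
Qed.

Lemma elem_mul a b c : (0 < b <= n)%N ->
  elem_mx C n a b *m elem_mx C n b c = elem_mx C n a c.
Proof.
move=> bn; apply/matrixP => i j; rewrite !mxE.
have bn' : (b.-1 < n)%N by lia.
rewrite (bigD1 (Ordinal bn')) //= big1 ?addr0 => [|k kb]; rewrite !mxE /=.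
  by rewrite prednK ?eqxx; [case: eqP; rewrite ?mul1r ?mul0r|lia].
case: (k.+1 =P b) => [kb'|]; last by rewrite andbF mul0r.
by case/eqP: kb; apply: val_inj => /=; lia.
Qed.

Lemma elem_mul0 a b c d : b != c -> elem_mx C n a b *m elem_mx C n c d = 0.
Proof.
move=> bc; apply/matrixP => i j; rewrite !mxE big1 // => k _; rewrite !mxE.
case: (k.+1 =P b) => [->|_]; last by rewrite andbF mul0r.
by rewrite (negbTE bc) mulr0.
Qed.

Lemma elem_out a b : (n < a)%N -> elem_mx C n a b = 0.
Proof.
move=> na; apply/matrixP => i j; rewrite !mxE; case: eqP => //= e.
by have := ltn_ord i; lia.
Qed.

Lemma Lg_simple b : (0 < b)%N -> Lg (elem_mx C n b.+1 b) =
  if Gam2 bd b then elem_mx C n (gams bd b).+1 (gams bd b) else 0.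
Proof.
move=> b0; apply/matrixP => i j; rewrite mxE /rgn.
have [/andP[ji s]|nji] := boolP ((j < i)%N && seg bd j i); last first.
  case: ifP => [G2b|]; rewrite ?mxE //; case: eqP => //= -[e1]; case: eqP => //= e2.
  case/negP: nji; rewrite -e2 in e1; rewrite e1 ltnSn /=; apply/segP => c cj.
  have -> : c = gams bd b by lia.
  exact: gams_G1.
have Gi : Gam1 bd i by move/segP: s; apply; lia.
have Gj : Gam1 bd j.+1 by move/segP: s; apply; lia.
have gin := G2_range (gam_G2 Gi); have gjn := G2_range (gam_G2 Gj).
rewrite entryN; case: (leqP (g j.+1) (g i)) => [le|lt].
  rewrite {1}(gam_pos Gj) elem_entry -?(gam_pos Gj) ?eqSS; [|lia|lia].
  case: eqP => [gib|gib] /=; last first.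
    case: ifP => [G2b|]; rewrite mxE //; case: eqP => //= -[e1].
    by case: gib; rewrite e1 gamsK.
  have G2b : Gam2 bd b by rewrite -gib gam_G2.
  rewrite G2b mxE -gib gamK // eqxx /=; congr ((nat_of_bool _)%:R).
  apply/eqP/eqP => [e|->//]; exact: (gam_inj Gj Gi e).
rewrite {1}(gam_pos Gi) elem_entry -?(gam_pos Gi) ?eqSS; [|lia|lia].
have -> : (g j.+1 == b) && (g i == b) = false.
  by apply/negP => /andP[/eqP e1 /eqP e2]; lia.
rewrite oppr0 mulr0; case: ifP => [G2b|]; rewrite mxE //.
case: eqP => //= -[e1]; case: eqP => //= e2; move: lt.
by rewrite e1 e2 ltnn.
Qed.

Lemma dgamma_elemE b k : (0 < b)%N ->
  @dgamma_elem C n bd b k = Lg (elem_mx C n (b + k).+1 b).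
Proof.
move=> b0; elim: k => [|k IH]; first by rewrite addn0 Lg_simple.
have bk0 : (0 < b + k.+1)%N by lia.
rewrite /= IH -(Lg_simple bk0) Lg_bracket; [|by apply: elem_strict; lia..].
congr Lg; rewrite addnS.
rewrite (@elem_mul0 _ b (b + k).+2); last by lia.
rewrite subr0; have [le|lt] := leqP (b + k).+1 n; first by rewrite elem_mul.
by rewrite !elem_out ?mul0mx //; lia.
Qed.

Lemma rg_low X X' Y Y' :
  (forall i j : 'I_n, (j < i)%N -> X i j = X' i j) ->
  (forall i j : 'I_n, (j < i)%N -> Y i j = Y' i j) -> rg X Y = rg X' Y'.
Proof.
have low (Z Z' : 'M[C]_n) a b : (forall i j : 'I_n, (j < i)%N -> Z i j = Z' i j) ->
    (0 < b <= a)%N -> entry Z a.+1 b = entry Z' a.+1 b.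
  move=> ZZ' ba; have eb : b = b.-1.+1 by lia.
  rewrite eb; have [H|] := boolP ((n <= a)%N || (n <= b.-1)%N).
    by rewrite !entry_default.
  rewrite negb_or -!ltnNge => /andP[a_n b_n].
  by rewrite !(entryE _ (Ordinal a_n) (Ordinal b_n)) ZZ' //=; lia.
move=> XX' YY'; apply/matrixP => i j; rewrite !mxE /rgn.
case: ifP => // /andP[ji s].
have Gi : Gam1 bd i by move/segP: s; apply; lia.
have Gj : Gam1 bd j.+1 by move/segP: s; apply; lia.
have gin := G2_range (gam_G2 Gi); have gjn := G2_range (gam_G2 Gj).
case: leqP => le; first by rewrite (low _ _ _ _ XX') //; lia.
by rewrite (low _ _ _ _ YY') //; lia.
Qed.

Lemma dgammaE X : dgamma bd X = Lg X.
Proof.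
rewrite /dgamma /Lg.
pose F (i j : 'I_n) : 'M[C]_n := X i j *: elem_mx C n i.+1 j.+1.
transitivity (\sum_(i < n) \sum_(j < n | (j < i)%N) rg (F i j) (- F i j)).
  apply: eq_bigr => i _; apply: eq_bigr => j ji; rewrite dgamma_elemE // /Lg rgZ.
  have -> : (j.+1 + (i - j).-1).+1 = i.+1 by lia.
  by rewrite scalerN.
under eq_bigr do rewrite rg_sum.
rewrite rg_sum.
have E : \sum_(i < n) \sum_(j < n | (j < i)%N) - F i j =
         - \sum_(i < n) \sum_(j < n | (j < i)%N) F i j.
  by rewrite -sumrN; apply: eq_bigr => i _; rewrite sumrN.
rewrite E.
have FE (i j : 'I_n) : (j < i)%N ->
    (\sum_(i < n) \sum_(j < n | (j < i)%N) F i j) i j = X i j.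
  move=> ji; rewrite summxE (bigD1 i) //= [X in _ + X]big1 ?addr0; last first.
    move=> k ki; rewrite summxE big1 // => l _; rewrite !mxE eqSS val_eqE eq_sym.
    by rewrite (negbTE ki) mulr0.
  rewrite summxE (bigD1 j) //= [X in _ + X]big1 ?addr0; last first.
    move=> k /andP[_ kj]; rewrite !mxE !eqSS !val_eqE [j == k]eq_sym (negbTE kj).
    by rewrite andbF mulr0.
  by rewrite !mxE !eqxx mulr1.
by apply: rg_low => i j ji; rewrite ?[in RHS]mxE ?[in LHS]mxE FE.
Qed.

End BlockMap.

(** * Truncated exponential and logarithm of unipotent matrices *)

Section ExpLog.
Variables (C : numFieldType) (m : nat).

Definition log_poly : {poly C} :=
  \sum_(1 <= k < m.+1) ((-1) ^+ k.+1 / k%:R) *: 'X^k.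

Definition exp_log_poly (c : C) : {poly C} :=
  \sum_(k < m.+1) k`!%:R^-1 *: (c *: log_poly) ^+ k.

Lemma natf_neq0 k : (k.+1%:R : C) != 0.
Proof. by rewrite pnatr_eq0. Qed.

Lemma exprNX k : (- 'X) ^+ k = (-1) ^+ k *: 'X^k :> {poly C}.
Proof.
rewrite (exprNn 'X) -signr_odd -[in RHS]signr_odd.
by case: (odd k); rewrite ?expr0 ?expr1 ?mul1r ?scale1r ?mulN1r ?scaleN1r.
Qed.

Lemma deriv_log : (1 + 'X) * log_poly^`() = 1 - (- 'X) ^+ m.
Proof.
have -> : log_poly^`() = \sum_(k < m) (- 'X) ^+ k.
  rewrite /log_poly raddf_sum /= big_add1 big_mkord; apply: eq_bigr => k _.
  rewrite /= derivZ derivXn /= -scaler_nat scalerA divfK ?natf_neq0 //.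
  by rewrite exprNX !exprS !mulN1r opprK.
have := subrX1 (- 'X : {poly C}) m.
rewrite -[1 - _]opprB => ->; rewrite -mulNr opprB opprK.
by [].
Qed.

Lemma coef_mulXn (R : nzSemiRingType) k l (p : {poly R}) :
  (k < l)%N -> ('X^l * p)`_k = 0.
Proof. by move=> kl; rewrite coefXnM kl. Qed.

(** Modulo X^m the polynomial satisfies (1 + X) f' = c f, the differential equation of (1 + X)^c;
    comparing coefficients gives the binomial recursion. It is used for c = 1 and c = -1. *)
Lemma exp_log_deriv c k : (k < m)%N ->
  (exp_log_poly c)`_k.+1 * k.+1%:R = (c - k%:R) * (exp_log_poly c)`_k.
Proof.
move=> km; set f := exp_log_poly c; pose q := c *: log_poly.
have fS : f = \sum_(k < m) k`!%:R^-1 *: q ^+ k + m`!%:R^-1 *: q ^+ m.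
  by rewrite /f /exp_log_poly big_ord_recr.
have df : f^`() = q^`() * (f - m`!%:R^-1 *: q ^+ m).
  rewrite {2}fS addrK /f /exp_log_poly raddf_sum /= big_ord_recl /= expr0 derivZ derivC.
  rewrite scaler0 add0r mulr_sumr; apply: eq_bigr => i _.
  rewrite /bump /= add1n derivZ deriv_exp /= -scaler_nat scalerA -scalerAr.
  congr (_ *: _); by rewrite factS natrM invfM mulrAC mulVf ?mul1r ?natf_neq0.
have [s sE] : exists s, q = 'X * s.
  exists (c *: \sum_(1 <= k < m.+1) ((-1) ^+ k.+1 / k%:R) *: 'X^(k.-1)).
  rewrite -scalerAr mulr_sumr; congr (_ *: _); rewrite /log_poly !big_add1 /=.
  by apply: eq_bigr => i _; rewrite -scalerAr -exprS.
(* [r] collects the truncation errors of both series; the one of the exponential is divisible by X^m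
   because the logarithm has no constant term. *)
have [r rE] : exists r, (1 + 'X) * f^`() = c *: f + 'X^m * r.
  exists (- c *: (m`!%:R^-1 *: s ^+ m + (-1) ^+ m * (f - m`!%:R^-1 *: q ^+ m))).
  rewrite df mulrA /q derivZ -scalerAr deriv_log -/q.
  have -> : q ^+ m = 'X^m * s ^+ m by rewrite sE exprMn.
  rewrite (exprNn 'X) -!mul_polyC !rmorphN; ring.
have := congr1 (fun p : {poly C} => p`_k) rE.
rewrite coefD coefZ coef_mulXn // addr0 mulrDl mul1r coefD coef_deriv coefXM.
case: k km => [|k] km /=; first by rewrite addr0 mulr1n mulr1 subr0.
rewrite coef_deriv -mulr_natr -[X in _ + X]mulr_natr => e.
by rewrite mulrBl -e [X in _ - X]mulrC addrK mul1r mulr_natr.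
Qed.

Lemma exp_log0 c : (exp_log_poly c)`_0 = 1.
Proof.
rewrite /exp_log_poly coef_sum big_ord_recl /= coefZ coefC /= fact0 invr1 mul1r.
rewrite big1 ?addr0 // => i _; rewrite coefZ exprS coef0M coefZ.
suff -> : log_poly`_0 = 0 by rewrite mulr0 mul0r mulr0.
rewrite /log_poly coef_sum big_add1 big1 //= => k _.
by rewrite coefZ coefXn mulr0.
Qed.

Lemma exp_log_coef k : (k < m.+1)%N -> (exp_log_poly 1)`_k = (1 + 'X : {poly C})`_k.
Proof.
rewrite coefD coefC coefX.
case: k => [|[|k]] km /=; first by rewrite exp_log0 addr0.
  have := exp_log_deriv 1 (k := 0) km.
  by rewrite exp_log0 mulr1 subr0 mulr1 add0r.
elim: k km => [|k IH] km; rewrite addr0.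
  have := exp_log_deriv 1 (k := 1) km; rewrite subrr mul0r => /eqP.
  by rewrite mulf_eq0 (negbTE (natf_neq0 _)) orbF => /eqP.
have := exp_log_deriv 1 (k := k.+2) km.
rewrite IH ?addr0; last by lia.
by rewrite mulr0 => /eqP; rewrite mulf_eq0 (negbTE (natf_neq0 _)) orbF => /eqP.
Qed.

Lemma exp_log_coefN k : (k < m.+1)%N -> (exp_log_poly (-1))`_k = (-1) ^+ k.
Proof.
elim: k => [|k IH] km; first by rewrite exp_log0.
have := @exp_log_deriv (-1) k; rewrite IH //; last by lia.
move=> /(_ km) H; apply: (mulIf (natf_neq0 k)); rewrite H exprS -natr1; ring.
Qed.

Local Notation n := m.+1.
Implicit Types X M : 'M[C]_n.

Lemma strict_exp X k (i j : 'I_n) : strict_lower X -> (i < j + k)%N -> (X ^+ k) i j = 0.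
Proof.
move=> sX; elim: k i j => [|k IH] i j ij.
  rewrite expr0 !mxE; case: eqP => // e; move: ij; rewrite e; lia.
rewrite exprS mxE big1 // => l _.
have [il|li] := leqP i l; first by rewrite sX ?mul0r.
by rewrite IH ?mulr0 //; lia.
Qed.

Lemma strict_nil X : strict_lower X -> X ^+ n = 0.
Proof.
move=> sX; apply/matrixP => i j; rewrite mxE strict_exp //.
by have := ltn_ord i; lia.
Qed.

Lemma horner_mx_take X (p : {poly C}) :
  strict_lower X -> horner_mx X (take_poly n p) = horner_mx X p.
Proof.
move=> sX; rewrite -{2}(poly_take_drop n p) rmorphD rmorphM rmorphXn /=.
by rewrite horner_mx_X strict_nil // mulr0 addr0.
Qed.

Lemma horner_log M : horner_mx (M - 1) log_poly = ulog M.
Proof.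
rewrite /log_poly rmorph_sum /ulog; apply: eq_bigr => k _.
by rewrite /= horner_mxZ rmorphXn /= horner_mx_X.
Qed.

Lemma horner_exp_log M c :
  horner_mx (M - 1) (exp_log_poly c) = nexp (c *: ulog M).
Proof.
rewrite rmorph_sum /nexp; apply: eq_bigr => k _.
by rewrite /= horner_mxZ rmorphXn /= horner_mxZ horner_log.
Qed.

Lemma nexp_ulog M : strict_lower (M - 1) -> nexp (ulog M) = M.
Proof.
move=> sM; rewrite -[ulog M]scale1r -horner_exp_log -horner_mx_take //.
have -> : take_poly n (exp_log_poly 1) = take_poly n (1 + 'X).
  by apply/polyP => k; rewrite !coef_take_poly; case: ifP => // /exp_log_coef.
by rewrite horner_mx_take // rmorphD rmorph1 /= horner_mx_X addrC subrK.
Qed.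

(** The low coefficients of exp(- log(1 + X)) are those of the geometric series, evaluated here at a
    nilpotent matrix. This identifies the second argument of [rg] on the group as the inverse of
    M. *)
Lemma nexp_ulogN M : strict_lower (M - 1) -> M *m nexp (- ulog M) = 1.
Proof.
move=> sM; rewrite -scaleN1r -horner_exp_log -horner_mx_take //.
have -> : take_poly n (exp_log_poly (-1)) = \sum_(k < n) (- 'X) ^+ k.
  have -> : \sum_(k < n) (- 'X) ^+ k = \poly_(k < n) (-1) ^+ k :> {poly C}.
    by rewrite poly_def; apply: eq_bigr => i _; rewrite exprNX.
  apply/polyP => k; rewrite coef_take_poly coef_poly.
  by case: ifP => // /exp_log_coefN.
have e := subrX1 (- 'X : {poly C}) n.
have := congr1 (horner_mx (M - 1)) e.
rewrite rmorphB rmorphM rmorphXn rmorphB rmorphN rmorph1 /= horner_mx_X.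
rewrite strict_nil; last exact: strict_opp.
by rewrite sub0r opprB addrAC subrr sub0r mulNr => /oppr_inj/esym.
Qed.

End ExpLog.

Lemma invmx_mul (R : comUnitRingType) k (A B : 'M[R]_k) :
  A \in unitmx -> B \in unitmx -> invmx (A *m B) = invmx B *m invmx A.
Proof.
move=> Au Bu; have ABu : A *m B \in unitmx by rewrite unitmx_mul Au.
by rewrite -[RHS](mulKmx ABu) -[A *m B *m _]mulmxA mulKVmx // mulmxV // mulmx1.
Qed.

(** * Triangular factorization and the maps F, rho and Q *)

Section Unipotent.
Variables (C : fieldType) (n : nat).
Implicit Types (M X W : 'M[C]_n).

Lemma unip_strict M : unip_lower M <-> strict_lower (M - 1%:M).
Proof.
split=> [[/is_trig_mxP tM dM] i j ij|sM].
  rewrite !mxE; have [->|nij] := eqVneq i j; first by rewrite dM subrr.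
  by rewrite tM ?subr0 // ltn_neqAle ij andbT.
have dM i : M i i = 1.
  by apply/eqP; rewrite -subr_eq0; have := sM i i (leqnn _); rewrite !mxE eqxx => ->.
split=> //; apply/is_trig_mxP => i j ij; have := sM i j (ltnW ij).
by rewrite !mxE; case: eqVneq ij => [->|_ _]; rewrite ?ltnn ?subr0.
Qed.

Lemma unip_1 : unip_lower (1%:M : 'M[C]_n).
Proof. by apply/unip_strict; rewrite subrr; apply: strict_0. Qed.

Lemma unip_det M : unip_lower M -> \det M = 1.
Proof. by case=> tM dM; rewrite det_trig // big1. Qed.

Lemma unip_unit M : unip_lower M -> M \in unitmx.
Proof. by move=> uM; rewrite unitmxE unip_det ?unitr1. Qed.

Lemma unip_mul M M' : unip_lower M -> unip_lower M' -> unip_lower (M *m M').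
Proof.
move=> /unip_strict sM /unip_strict sM'; apply/unip_strict.
have -> : M *m M' - 1%:M = (M - 1%:M) *m (M' - 1%:M) + (M - 1%:M) + (M' - 1%:M).
  rewrite mulmxBl !mulmxBr !mul1mx !mulmx1; move: (M *m M') => A.
  by apply/matrixP => i j; rewrite !mxE; ring.
by apply: strict_add => //; apply: strict_add => //; apply: strict_mul.
Qed.

Lemma unip_invE M : unip_lower M -> invmx M = \adj M.
Proof. by move=> uM; rewrite /invmx unip_unit // unip_det // invr1 scale1r. Qed.

Lemma unip_inv M : unip_lower M -> unip_lower (invmx M).
Proof.
move=> uM; have Mu := unip_unit uM; case: (uM) => tM dM.
have /is_trig_mxP tM' := tM.
have rec (i j : 'I_n) : (invmx M) i j =
    (i == j)%:R - \sum_(k < n | (k < i)%N) M i k * (invmx M) k j.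
  have := mulmxV Mu; move=> /matrixP/(_ i j); rewrite !mxE (bigID (fun k : 'I_n => (k < i)%N)) /=.
  move=> <-; rewrite addrAC subrr add0r (bigD1 i) ?ltnn //= dM mul1r big1 ?addr0 // => k.
  by rewrite -leqNgt => /andP[ik ki]; rewrite tM' ?mul0r // ltn_neqAle eq_sym ki.
have up : forall m (i j : 'I_n), (i < m)%N -> (i <= j)%N -> (invmx M) i j = (i == j)%:R.
  elim=> // m IH i j im ij; rewrite rec big1 ?subr0 // => k ki.
  rewrite IH; [|lia|lia]; case: eqP => [kj|]; rewrite ?mulr0 //.
  by move: ki; rewrite kj; lia.
split=> [|i]; last by rewrite (up n) ?eqxx.
apply/is_trig_mxP => i j ij; rewrite (up n) ?(ltnW ij) //.
by rewrite (_ : i == j = false) //; apply/negP => /eqP e; move: ij; rewrite e ltnn.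
Qed.

(* Matrices preserving the span of the last n - r basis row vectors, i.e. the
   maximal parabolic attached to the simple root r. *)
Definition stab r M := forall i j : 'I_n, (j < r)%N -> (r <= i)%N -> M i j = 0.

Definition upper W := is_trig_mx W^T.

Lemma upperP W : upper W <-> forall i j : 'I_n, (j < i)%N -> W i j = 0.
Proof.
split=> [/is_trig_mxP tW i j ji|tW]; first by have := tW j i ji; rewrite mxE.
by apply/is_trig_mxP => i j ij; rewrite mxE tW.
Qed.

Lemma stab_upper r W : upper W -> stab r W.
Proof. by move/upperP=> uW i j jr ri; rewrite uW //; lia. Qed.

Lemma stab_mul r M M' : stab r M -> stab r M' -> stab r (M *m M').
Proof.
move=> sM sM' i j jr ri; rewrite mxE big1 // => k _.
have [kr|rk] := ltnP k r; first by rewrite sM ?mul0r.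
by rewrite sM' ?mulr0.
Qed.

Lemma upper_diag_neq0 W i : upper W -> W \in unitmx -> W i i != 0.
Proof.
move=> uW; rewrite unitmxE unitfE -det_tr det_trig // => /prodf_neq0/(_ i isT).
by rewrite mxE.
Qed.

(** The block of X is cleared row by row from the bottom, dividing by the nonzero diagonal entries
    of W. *)
Lemma stab_divl r W X : upper W -> W \in unitmx -> stab r (W *m X) -> stab r X.
Proof.
move=> uW Wu sWX; have /upperP tW := uW.
suff H : forall m (i j : 'I_n), (n - i <= m)%N -> (j < r)%N -> (r <= i)%N -> X i j = 0.
  by move=> i j; apply: (H n); lia.
elim=> [|m IH] i j im jr ri; first by have := ltn_ord i; lia.
have := sWX i j jr ri; rewrite mxE (bigD1 i) //= big1 ?addr0 => [|k ki].
  by move/eqP; rewrite mulf_eq0 (negbTE (upper_diag_neq0 i uW Wu)) => /eqP.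
have [lt|le] := ltnP k i; first by rewrite tW ?mul0r.
have {}ki : (i < k)%N by rewrite ltn_neqAle le eq_sym ki.
by rewrite IH ?mulr0 //; have := ltn_ord k; lia.
Qed.

(** Lying in every maximal parabolic means being upper triangular. *)
Lemma stab_all M : unip_lower M -> (forall r, (0 < r < n)%N -> stab r M) -> M = 1%:M.
Proof.
move=> [/is_trig_mxP tM dM] sM; apply/matrixP => i j; rewrite mxE.
have [ij|ji|e] := ltngtP i j.
- by rewrite tM // -val_eqE; case: eqP => //= e; lia.
- rewrite (sM i) //; last by have := ltn_ord i; lia.
  by rewrite -val_eqE; case: eqP => //= e; lia.
- by rewrite (val_inj e) dM eqxx.
Qed.

Lemma stab_inv r M : unip_lower M -> stab r M -> stab r (invmx M).
Proof.
move=> uM sM; have [/is_trig_mxP tM dM] := uM.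
suff H : forall m (i j : 'I_n), (i < m)%N -> (j < r)%N -> (r <= i)%N -> invmx M i j = 0.
  by move=> i j; apply: (H n).
elim=> // m IH i j im jr ri.
have := mulmxV (unip_unit uM) => /matrixP/(_ i j); rewrite !mxE (bigD1 i) //= dM mul1r.
rewrite big1 ?addr0 => [->|k ki].
  by rewrite -val_eqE; case: eqP => //= e; lia.
have [kr|rk] := ltnP k r; first by rewrite sM ?mul0r.
have [lt|le] := ltnP k i; first by rewrite IH ?mulr0 //; lia.
by rewrite tM ?mul0r // ltn_neqAle le eq_sym ki.
Qed.

Definition is_lu W M X := [/\ upper W, unip_lower M & X = W *m M].

Definition factorable X := exists W M, is_lu W M X.

Lemma lu_unit W M X : is_lu W M X -> X \in unitmx -> W \in unitmx.
Proof. by case=> _ _ ->; rewrite unitmx_mul => /andP[]. Qed.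

Lemma low_part_unip X : unip_lower (low_part X).
Proof.
rewrite /low_part; case: xgetP => [M _ [] //|_]; exact: unip_1.
Qed.

Lemma low_partP X : factorable X -> exists W, is_lu W (low_part X) X.
Proof.
move=> [W [M [uW uM XE]]]; rewrite /low_part; case: xgetP => [M' _ /= [uM' [W' uW' ->]]|].
  by exists W'.
by move=> /(_ M) H; case: H; split=> //; exists W.
Qed.

(** From W' M' = E W M, the quotient M' M^-1 equals W'^-1 E W, a product of elements of the
    parabolic. *)
Lemma lu_stab r E W M W' M' X : is_lu W M X -> is_lu W' M' (E *m X) ->
  W' \in unitmx -> stab r E -> stab r (M' *m invmx M).
Proof.
move=> [uW uM XE] [uW' uM' EXE] W'u sE; apply: (stab_divl uW' W'u).
rewrite mulmxA -EXE XE mulmxA mulmxK ?unip_unit //.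
by apply: stab_mul => //; apply: stab_upper.
Qed.

Lemma lu_uniq W M W' M' X : X \in unitmx -> is_lu W M X -> is_lu W' M' X -> M' = M.
Proof.
move=> Xu lu lu'; have [_ uM _] := lu; have [_ uM' _] := lu'.
have e : M' *m invmx M = 1%:M.
  apply: stab_all => [|r _]; first by apply/unip_mul/unip_inv.
  apply: (lu_stab (E := 1%:M) lu _ (lu_unit lu' Xu)); rewrite ?mul1mx //.
  by move=> i j jr ri; rewrite mxE -val_eqE; case: eqP => //= e; lia.
by rewrite -[M'](mulmxKV (unip_unit uM)) e mul1mx.
Qed.

Lemma low_part_lu W M X : X \in unitmx -> is_lu W M X -> low_part X = M.
Proof.
move=> Xu lu; have [W' lu'] := low_partP (ex_intro _ W (ex_intro _ M lu)).
exact: lu_uniq lu lu'.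
Qed.

Lemma lu_mulr W M X N : is_lu W M X -> unip_lower N -> is_lu W (M *m N) (X *m N).
Proof. by move=> [uW uM ->] uN; split; rewrite ?mulmxA //; apply: unip_mul. Qed.

Lemma low_part_mulr X N : X \in unitmx -> factorable X -> unip_lower N ->
  low_part (X *m N) = low_part X *m N.
Proof.
move=> Xu /low_partP[W lu] uN; apply: low_part_lu (lu_mulr lu uN).
by rewrite unitmx_mul Xu unip_unit.
Qed.

End Unipotent.

Section Tgamma.
Variables (C : numFieldType) (n : nat) (bd : BD_triple n).
Hypothesis n_gt0 : (0 < n)%N.
Local Notation g := (gam bd).
Implicit Types (M X : 'M[C]_n).

(** For M = 1 + x and M^-1 = 1 + y one has x y = -(x + y), and a product of strictly lower
    triangular matrices vanishes just below the diagonal. *)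
Lemma unip_consistent M : unip_lower M -> consistent (M - 1%:M) (invmx M - 1%:M).
Proof.
move=> uM; set x := M - 1%:M; set y := invmx M - 1%:M; move=> c.
have sx : strict_lower x by apply/unip_strict.
have sy : strict_lower y by apply/unip_strict/unip_inv.
have e : x *m y = - (x + y).
  rewrite /x /y mulmxBl !mulmxBr mulmxV ?unip_unit // !mul1mx !mulmx1.
  by apply/matrixP => i j; rewrite !mxE; ring.
have := strict_mul_sub c.+1 sx sy; rewrite e entryN entryD => /eqP.
by rewrite oppr_eq0 addr_eq0 => /eqP.
Qed.

End Tgamma.

Section TgammaS.
Variables (C : numFieldType) (m : nat).
Local Notation n := m.+1.
Variables (bd : BD_triple n).
Implicit Types (M X : 'M[C]_n).

Lemma Lg_exp X k : strict_lower X ->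
  Lg bd X ^+ k.+1 = rg bd (X ^+ k.+1) ((- X) ^+ k.+1).
Proof.
move=> sX; have sNX := strict_opp sX.
(* Strictness and consistency of the powers are carried along, since [rg_mul] asks for them at the
   next power. *)
suff [-> _] : Lg bd X ^+ k.+1 = rg bd (X ^+ k.+1) ((- X) ^+ k.+1) /\
   [/\ strict_lower (X ^+ k.+1), strict_lower ((- X) ^+ k.+1) &
       consistent (X ^+ k.+1) ((- X) ^+ k.+1)] by [].
elim: k => [|k [IH [s1 s2 c]]].
  by rewrite !expr1; split=> //; split=> //; apply: consistentN.
rewrite !(exprSr _ k.+1); split; last first.
  split; [exact: strict_mul..|].
  move=> d; rewrite !(strict_mul_sub (X := _ ^+ _)) ?oppr0 //.
rewrite IH [LHS](rg_mul bd s1 s2 sX sNX c (consistentN X)).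
by congr (rg bd _ _); rewrite -exprSr [RHS]exprS.
Qed.

Lemma nexp_Lg X : strict_lower X ->
  nexp (Lg bd X) = 1 + rg bd (nexp X - 1) (nexp (- X) - 1).
Proof.
move=> sX; pose E (Y : 'M[C]_n) := \sum_(k < m) (k.+1)`!%:R^-1 *: Y ^+ k.+1.
have nE Y : nexp Y = 1 + E Y.
  by rewrite /nexp big_ord_recl expr0 fact0 invr1 scale1r.
rewrite !nE ![1 + _ - 1]addrC !addKr; congr (1 + _).
rewrite /E -rg_sum; apply: eq_bigr => k _.
by rewrite Lg_exp // rgZ.
Qed.

Lemma strict_ulog M : strict_lower (M - 1) -> strict_lower (ulog M).
Proof.
move=> sM; rewrite /ulog big_add1; apply: strict_sum => k _; apply: strict_scale.
elim: k => [|k IH]; first by rewrite expr1.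
by rewrite exprS; apply: strict_mul.
Qed.

(** [rg] is linear and turns powers into powers, so it passes through the exponential series; in
    each of its two arguments the exponential then undoes the logarithm, giving M in one and M^-1 in
    the other. *)
Lemma tgammaE_S M : unip_lower M ->
  tgamma bd M = 1%:M + rg bd (M - 1%:M) (invmx M - 1%:M).
Proof.
move=> uM; have sM : strict_lower (M - 1) by apply/unip_strict.
rewrite /tgamma dgammaE nexp_Lg; last exact: strict_ulog.
rewrite nexp_ulog //; congr (1 + rg _ _ (_ - 1)).
by rewrite -[LHS](mulKmx (unip_unit uM)) nexp_ulogN // mulmx1.
Qed.

End TgammaS.

(** * Nilpotency of [tgamma]; convergence of F, uniqueness of rho, the inverse of Q *)

Section TgammaTheory.
Variables (C : numFieldType) (n : nat) (bd : BD_triple n).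
Hypothesis n_gt0 : (0 < n)%N.
Local Notation g := (gam bd).
Local Notation tg := (tgamma bd).
Implicit Types (M X N U V W : 'M[C]_n).

Lemma tgammaE M : unip_lower M ->
  tg M = 1%:M + rg bd (M - 1%:M) (invmx M - 1%:M).
Proof. by case: n bd n_gt0 M => // m bd' _ M; apply: tgammaE_S. Qed.

Lemma tgamma_unip M : unip_lower M -> unip_lower (tg M).
Proof.
by move=> uM; rewrite tgammaE //; apply/unip_strict; rewrite addrAC subrr add0r; apply: rg_strict.
Qed.

Lemma tgamma1 : tg (1%:M : 'M[C]_n) = 1%:M.
Proof. by rewrite tgammaE ?invmx1 ?subrr ?rg0 ?addr0 //; apply: unip_1. Qed.

Lemma tgammaM M M' : unip_lower M -> unip_lower M' -> tg (M *m M') = tg M *m tg M'.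
Proof.
move=> uM uM'; rewrite !tgammaE //; last exact: unip_mul.
have [sM sM'] : strict_lower (M - 1%:M) /\ strict_lower (M' - 1%:M).
  by split; apply/unip_strict.
have [siM siM'] : strict_lower (invmx M - 1%:M) /\ strict_lower (invmx M' - 1%:M).
  by split; apply/unip_strict/unip_inv.
rewrite mulmxDl !mulmxDr !mul1mx !mulmx1 rg_mul //; do ?exact: unip_consistent.
rewrite -addrA; congr (_ + _); rewrite !rgD; congr (rg bd _ _).
  rewrite mulmxBl !mulmxBr !mul1mx !mulmx1; move: (M *m M') => A.
  by apply/matrixP => i j; rewrite !mxE; ring.
have -> : invmx (M *m M') = invmx M' *m invmx M.
  exact: invmx_mul (unip_unit uM) (unip_unit uM').
rewrite mulmxBl !mulmxBr !mul1mx !mulmx1; move: (invmx M' *m invmx M) => A.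
by apply/matrixP => i j; rewrite !mxE; ring.
Qed.

Lemma tgammaV M : unip_lower M -> tg (invmx M) = invmx (tg M).
Proof.
move=> uM; have uV := unip_inv uM.
have e : tg (invmx M) *m tg M = 1%:M.
  by rewrite -tgammaM // mulVmx ?unip_unit ?tgamma1.
by rewrite -[RHS]mul1mx -e mulmxK // unip_unit //; apply: tgamma_unip.
Qed.

Lemma tgamma_entry M (i j : 'I_n) : unip_lower M -> (j < i)%N ->
  tg M i j = rgn bd (M - 1%:M) (invmx M - 1%:M) i j.
Proof.
move=> uM ji; rewrite tgammaE // !mxE -val_eqE; case: eqP => [e|_]; last by rewrite add0r.
by move: ji; rewrite e ltnn.
Qed.

Lemma stab_entry r (X : 'M[C]_n) a b : stab r X -> (b <= r)%N -> (r <= a)%N -> (0 < b)%N ->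
  entry X a.+1 b = 0.
Proof.
case: b => // b sX br ra _; have [H|] := boolP ((n <= a)%N || (n <= b)%N).
  exact: entry_default.
rewrite negb_or -!ltnNge => /andP[a_n b_n].
by rewrite (entryE _ (Ordinal a_n) (Ordinal b_n)) sX.
Qed.

Lemma stab_sub1 r X : stab r X -> stab r (X - 1%:M).
Proof.
move=> sX i j jr ri; rewrite !mxE sX // -val_eqE; case: eqP => [e|_]; last by rewrite subr0.
by move: e => /= e; lia.
Qed.

(** An entry of [tgamma M] in the block cut out by r has a segment containing r; the entry of M or
    of M^-1 that it copies has a segment containing gamma(r), so it vanishes by assumption. Outside
    Gamma1 no segment contains r at all. *)
Lemma tgamma_stab r M : unip_lower M -> (Gam1 bd r -> stab (g r) M) -> stab r (tg M).
Proof.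
move=> uM sM i j jr ri; have ji : (j < i)%N by lia.
rewrite tgamma_entry // /rgn ji /=; case: ifP => // s.
have Gr : Gam1 bd r by move/segP: s; apply; lia.
have Gi : Gam1 bd i by move/segP: s; apply; lia.
have Gj : Gam1 bd j.+1 by move/segP: s; apply; lia.
have gin := G2_range (gam_G2 Gi); have gjn := G2_range (gam_G2 Gj).
have {}sM := sM Gr.
have rj : (j < r <= i)%N by lia.
have ij : (j < i <= i)%N by lia.
case: leqP => [le|lt].
  have := seg_inc rj s le; have := seg_inc ij s le => e1 e2.
  by apply: (stab_entry (stab_sub1 sM)); lia.
have := seg_dec rj s (ltnW lt); have := seg_dec ij s (ltnW lt) => e1 e2.
rewrite (stab_entry (r := g r)) ?mulr0 //; try lia.
by apply/stab_sub1/stab_inv.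
Qed.

Lemma iter_tgamma_unip k M : unip_lower M -> unip_lower (iter k tg M).
Proof. by move=> uM; elim: k => //= k IH; apply: tgamma_unip. Qed.

(** Each application of [tgamma] moves the condition one step along the string of r, and beyond the
    end of the string nothing is left to check. *)
Lemma iter_tgamma_stab k M r : unip_lower M -> (0 < r)%N -> (steps bd r < k)%N ->
  stab r (iter k tg M).
Proof.
move=> uM; elim: k r => // k IH r r0 sr /=; apply: tgamma_stab.
  exact: iter_tgamma_unip.
move=> Gr; apply: IH; first by have := G2_range (gam_G2 Gr); lia.
by move: sr; rewrite stepsS.
Qed.

Lemma iter_tgamma1 k M : unip_lower M -> (n <= k)%N -> iter k tg M = 1%:M.
Proof.
move=> uM nk; apply: stab_all; first exact: iter_tgamma_unip.
move=> r /andP[r0 _]; apply: iter_tgamma_stab => //.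
exact: leq_trans (steps_ltn _ _ r0) nk.
Qed.

Lemma eventual_valueP (s : nat -> 'M[C]_n) V K :
  (forall k, (K <= k)%N -> s k = V) -> eventual_value s = V.
Proof.
move=> sK; rewrite /eventual_value; case: xgetP => [V' _ [K' sK']|/(_ V) []].
  by rewrite -(sK (maxn K K')) ?leq_maxl // sK' ?leq_maxr.
by exists K.
Qed.

Lemma rhoE U : rho bd U = \prod_(1 <= k < n.+1) iter k tg (low_part U).
Proof.
apply: (@eventual_valueP _ _ n) => k nk.
rewrite (big_cat_nat (n := n.+1)) //= [X in _ * X]big_nat_cond [X in _ * X]big1 ?mulr1 //.
move=> l /andP[ln _]; apply: iter_tgamma1; first exact: low_part_unip.
by lia.
Qed.

Lemma prod_unip (r : seq nat) (F : nat -> 'M[C]_n) :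
  (forall k, unip_lower (F k)) -> unip_lower (\prod_(k <- r) F k).
Proof.
by move=> uF; elim/big_ind: _ => //; [apply: unip_1|move=> x y; apply: unip_mul].
Qed.

Lemma rho_unip U : unip_lower (rho bd U).
Proof. by rewrite rhoE; apply: prod_unip => k; apply/iter_tgamma_unip/low_part_unip. Qed.

Lemma tgamma_prod (r : seq nat) (F : nat -> 'M[C]_n) : (forall k, unip_lower (F k)) ->
  tg (\prod_(k <- r) F k) = \prod_(k <- r) tg (F k).
Proof.
move=> uF; elim: r => [|k r IH]; first by rewrite !big_nil tgamma1.
by rewrite !big_cons -IH; apply: tgammaM => //; apply: prod_unip.
Qed.

Lemma rho_eq U : tg (low_part U *m rho bd U) = rho bd U.
Proof.
have uk k : unip_lower (iter k tg (low_part U)).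
  exact/iter_tgamma_unip/low_part_unip.
transitivity (tg (low_part U) * tg (rho bd U)).
  by apply: tgammaM; [exact: low_part_unip|exact: rho_unip].
rewrite {1}rhoE tgamma_prod // [RHS]rhoE [RHS]big_ltn //=; congr (_ * _).
rewrite [RHS]big_add1 /= [LHS]big_nat_recr //=.
have -> : tg (iter n tg (low_part U)) = iter n.+1 tg (low_part U) by [].
by rewrite [X in _ * X]iter_tgamma1 ?mulr1 //; apply: low_part_unip.
Qed.

(** The quotient of two solutions is a unipotent fixed point of [tgamma], and n iterations send
    every unipotent matrix to the identity. *)
Lemma rho_uniq U N : unip_lower N -> tg (low_part U *m N) = N -> N = rho bd U.
Proof.
move=> uN eN; have uR := rho_unip U; have uL := low_part_unip U.
pose D := invmx (rho bd U) *m N.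
have uD : unip_lower D by apply: unip_mul => //; apply: unip_inv.
have tD : tg D = D.
  have := rho_eq U; rewrite tgammaM // => e1.
  have := eN; rewrite tgammaM // => e2.
  have [tL tR] := (tgamma_unip uL, tgamma_unip uR).
  rewrite /D tgammaM ?tgammaV //; last exact: unip_inv.
  rewrite -[X in _ = invmx X *m _]e1 -[X in _ = _ *m X]e2.
  by rewrite invmx_mul ?unip_unit // -mulmxA mulKmx // unip_unit.
have D1 : D = 1%:M.
  have it k : iter k tg D = D by elim: k => //= k ->.
  by rewrite -(iter_tgamma1 uD (leqnn n)) it.
by rewrite -[N](mulKVmx (unip_unit uR)) -/D D1 mulmx1.
Qed.

(** Only n + 1 iterates are constrained, so that this is a finite conjunction of open conditions;
    the later iterates coincide with the last of them. *)
Definition goodF U := U \in unitmx /\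
  forall k, (k <= n)%N -> factorable (Fseq bd U k).

Lemma Fseq_unit U k : U \in unitmx -> Fseq bd U k \in unitmx.
Proof.
case: k => //= k Uu; rewrite unitmx_mul Uu andbT unip_unit //.
exact/tgamma_unip/low_part_unip.
Qed.

Lemma unip_div M M' : unip_lower M -> unip_lower M' -> unip_lower (M' *m invmx M).
Proof. by move=> uM uM'; apply/unip_mul/unip_inv. Qed.

Lemma tg_div M M' U : unip_lower M -> unip_lower M' ->
  tg M' *m U = tg (M' *m invmx M) *m (tg M *m U).
Proof.
move=> uM uM'; rewrite mulmxA -tgammaM //; last exact: unip_div.
by rewrite mulmxKV // unip_unit.
Qed.

Lemma Fseq_stab U k r : goodF U -> (k < n)%N -> (0 < r)%N -> (steps bd r <= k)%N ->
  stab r (low_part (Fseq bd U k.+1) *m invmx (low_part (Fseq bd U k))).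
Proof.
move=> [Uu fU]; elim: k r => [|k IH] r kn r0 sr.
  have [W lu] := low_partP (fU 0%N isT); have [W' lu'] := low_partP (fU 1%N kn).
  have W'u := lu_unit lu' (Fseq_unit 1 Uu).
  apply: (lu_stab (E := tg (low_part U)) lu lu' W'u).
  apply: tgamma_stab; first exact: low_part_unip.
  by move=> Gr; move: sr; rewrite stepsS.
have [W lu] := low_partP (fU k.+1 (ltnW kn)); have [W' lu'] := low_partP (fU k.+2 kn).
have u1 := low_part_unip (Fseq bd U k.+1); have u0 := low_part_unip (Fseq bd U k).
have W'u := lu_unit lu' (Fseq_unit k.+2 Uu).
have eF : Fseq bd U k.+2 =
    tg (low_part (Fseq bd U k.+1) *m invmx (low_part (Fseq bd U k))) *m Fseq bd U k.+1.
  exact: tg_div.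
rewrite {2}eF in lu'; apply: lu_stab lu lu' W'u _.
apply: tgamma_stab; first exact: unip_div.
move=> Gr; apply: IH; [by lia| |by move: sr; rewrite stepsS].
by have := G2_range (gam_G2 Gr); lia.
Qed.

(** Strings have fewer than n steps, so the last quotient in [Fseq_stab] lies in all parabolics and
    is the identity. *)
Lemma Fseq_const U k : goodF U -> (n <= k)%N -> Fseq bd U k = Fseq bd U n.
Proof.
move=> gU nk.
have e : low_part (Fseq bd U n) = low_part (Fseq bd U n.-1).
  have uu k' := low_part_unip (Fseq bd U k').
  rewrite -[LHS](mulmxKV (unip_unit (uu n.-1))) -[RHS]mul1mx; congr (_ *m _).
  apply: stab_all => [|r /andP[r0 _]]; first exact: unip_div.
  have := @Fseq_stab U n.-1 r gU; rewrite prednK // => H; apply: H => //.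
  by have := steps_ltn bd n_gt0 r0; lia.
suff H : forall l, Fseq bd U (l + n) = Fseq bd U n by rewrite -(subnK nk).
have eS : Fseq bd U n = tg (low_part (Fseq bd U n.-1)) *m U.
  have HS l : (0 < l)%N -> Fseq bd U l = tg (low_part (Fseq bd U l.-1)) *m U by case: l.
  exact: HS.
by elim=> // l IH; rewrite addSn /= IH e -eS.
Qed.

Lemma FmapE U : goodF U -> Fmap bd U = Fseq bd U n.
Proof. by move=> gU; apply: (@eventual_valueP _ _ n) => k /(Fseq_const gU). Qed.

Lemma Fmap_factorable U : goodF U -> factorable (Fmap bd U).
Proof. by move=> gU; rewrite FmapE //; apply: gU.2. Qed.

Lemma Fmap_eq U : goodF U -> Fmap bd U = tg (low_part (Fmap bd U)) *m U.
Proof.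
move=> gU; rewrite FmapE // -{1}(Fseq_const gU (leqnSn n)).
by [].
Qed.

Lemma Fmap_uniq U X : goodF U -> factorable X -> X = tg (low_part X) *m U -> X = Fmap bd U.
Proof.
move=> gU /low_partP[W lu] eX; have Uu := gU.1.
have [W' lu'] := low_partP (Fmap_factorable gU).
have uF := low_part_unip (Fmap bd U); have uX := low_part_unip X.
have eF := Fmap_eq gU.
suff e : low_part X = low_part (Fmap bd U) by rewrite eX e -eF.
rewrite -[LHS](mulmxKV (unip_unit uF)) -[RHS]mul1mx; congr (_ *m _).
have Xu : X \in unitmx.
  by rewrite eX unitmx_mul Uu unip_unit //; apply: tgamma_unip.
have {}eX : X = tg (low_part X *m invmx (low_part (Fmap bd U))) *m Fmap bd U.
  by rewrite {1}eX (tg_div U uF uX) -eF.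
apply: stab_all => [|r /andP[r0 _]]; first exact: unip_div.
move: {2}(steps bd r) (leqnn (steps bd r)) => s; elim: s r r0 => [|s IH] r r0 sr.
  have lu2 := lu; rewrite {2}eX in lu2; apply: lu_stab lu' lu2 _ _.
    by apply: lu_unit lu _.
  apply: tgamma_stab; first exact: unip_div.
  by move=> Gr; move: sr; rewrite stepsS.
have lu2 := lu; rewrite {2}eX in lu2; apply: lu_stab lu' lu2 _ _.
  by apply: lu_unit lu _.
apply: tgamma_stab; first exact: unip_div.
move=> Gr; apply: IH; last by move: sr; rewrite stepsS.
by have := G2_range (gam_G2 Gr); lia.
Qed.

Lemma Fmap_Q U : U \in unitmx -> factorable U -> goodF (Qmap bd U) ->
  Fmap bd (Qmap bd U) = U *m rho bd U.
Proof.
move=> Uu fU gQ; have uR := rho_unip U; apply/esym/Fmap_uniq => //.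
  have [W lu] := low_partP fU.
  by exists W, (low_part U *m rho bd U); apply: lu_mulr.
rewrite low_part_mulr // rho_eq /Qmap -!mulmxA mulKVmx //.
exact: unip_unit.
Qed.

Definition nu V := tg (low_part (Fmap bd V)).
Definition Qinv V := nu V *m V *m invmx (nu V).

Lemma nu_unip V : unip_lower (nu V).
Proof. exact/tgamma_unip/low_part_unip. Qed.

Lemma QinvK U : U \in unitmx -> factorable U -> goodF (Qmap bd U) ->
  Qinv (Qmap bd U) = U.
Proof.
move=> Uu fU gQ; have uR := rho_unip U.
have e : nu (Qmap bd U) = rho bd U.
  by rewrite /nu Fmap_Q // low_part_mulr // rho_eq.
rewrite /Qinv e /Qmap !mulmxA mulmxV ?unip_unit // mul1mx mulmxK //.
exact: unip_unit.
Qed.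

Lemma QinvE V : goodF V -> Qinv V = Fmap bd V *m invmx (nu V).
Proof. by move=> gV; rewrite /Qinv {1}/nu -Fmap_eq. Qed.

Lemma Fmap_unit V : goodF V -> Fmap bd V \in unitmx.
Proof. by move=> gV; rewrite FmapE //; apply: Fseq_unit; apply: gV.1. Qed.

Lemma rho_Qinv V : goodF V -> rho bd (Qinv V) = nu V.
Proof.
move=> gV; apply/esym/rho_uniq; first exact: nu_unip.
rewrite QinvE // low_part_mulr; [|exact: Fmap_unit|exact: Fmap_factorable|exact/unip_inv/nu_unip].
by rewrite mulmxKV ?unip_unit //; apply: nu_unip.
Qed.

Lemma QmapK V : goodF V -> Qmap bd (Qinv V) = V.
Proof.
move=> gV; have nuu := unip_unit (nu_unip V).
by rewrite /Qmap rho_Qinv // /Qinv !mulmxA mulVmx // mul1mx mulmxKV.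
Qed.

End TgammaTheory.

(** * Trailing minors and birationality of Q *)

Section TrailingMinors.
Variables (C : fieldType) (n : nat).
Implicit Types (A M W X Z : 'M[C]_n).

Definition rowsel p r (Z X : 'M[C]_(n, p)) : 'M[C]_(n, p) :=
  \matrix_(i, j) if (i < r)%N then Z i j else X i j.

(** The trailing minor of size n - r, padded by rows of the identity so that all of them are
    determinants of n x n matrices. *)
Definition tdet r X := \det (rowsel r 1%:M X).

Definition colrep (i j : 'I_n) X : 'M[C]_n :=
  \matrix_(k, l) X k (if l == i then j else l).

Lemma rowsel_upper p r W (Z A : 'M[C]_(n, p)) : upper W ->
  rowsel r Z (W *m A) = rowsel r 1%:M W *m rowsel r Z A.
Proof.
move=> /upperP uW; apply/matrixP => k m; rewrite !mxE; case: ifP => kr.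
  rewrite (bigD1 k) //= big1 => [|l lk]; first by rewrite !mxE kr eqxx mul1r addr0.
  by rewrite !mxE kr eq_sym (negbTE lk) mul0r.
apply: eq_bigr => l _; rewrite !mxE kr; case: ifP => // lr.
by rewrite uW ?mul0r //; move: kr lr; lia.
Qed.

Lemma rowsel_tri r X : is_trig_mx X -> is_trig_mx (rowsel r 1%:M X).
Proof.
move=> /is_trig_mxP tX; apply/is_trig_mxP => i j ij; rewrite !mxE; case: ifP => _; last exact: tX.
by rewrite -val_eqE; case: eqP => //= e; lia.
Qed.

Lemma tdet_unip r M : unip_lower M -> tdet r M = 1.
Proof.
move=> [tM dM]; rewrite /tdet det_trig ?rowsel_tri // big1 // => i _.
by rewrite !mxE dM eqxx; case: ifP.
Qed.

Lemma tdet_lu r W M X : is_lu W M X -> tdet r X = tdet r W.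
Proof.
move=> [uW uM ->]; rewrite /tdet rowsel_upper // det_mulmx.
by rewrite -/(tdet r M) tdet_unip // mulr1.
Qed.

Lemma tdet_upper_neq0 r W : upper W -> W \in unitmx -> tdet r W != 0.
Proof.
move=> uW Wu; rewrite /tdet -det_tr det_trig.
  apply/prodf_neq0 => i _; rewrite !mxE eqxx; case: ifP => _; first exact: oner_neq0.
  exact: upper_diag_neq0.
apply/is_trig_mxP => i j ij; rewrite !mxE; case: ifP => _; last by move/upperP: uW; apply.
by rewrite -val_eqE; case: eqP => //= e; lia.
Qed.

(* Cramer's rule for the unipotent factor of X = W M. *)
Lemma lu_entry W M X (i j : 'I_n) : is_lu W M X -> (j < i)%N ->
  tdet i (colrep i j X) = tdet i X * M i j.
Proof.
move=> lu ji; rewrite (tdet_lu i lu); have [uW [/is_trig_mxP tM dM] ->] := lu.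
have -> : colrep i j (W *m M) = W *m colrep i j M.
  by apply/matrixP => k l; rewrite !mxE; apply: eq_bigr => q _; rewrite !mxE.
rewrite /tdet rowsel_upper // det_mulmx; congr (_ * _).
rewrite det_trig; last first.
  apply/is_trig_mxP => k l kl; rewrite !mxE; case: ifP => ki.
    by rewrite -val_eqE; case: eqP => //= e; lia.
  case: eqP => [e|_]; last exact: tM.
  by move: kl ki; rewrite e; lia.
rewrite (bigD1 i) //= big1 ?mulr1 => [|k ki].
  by rewrite !mxE ltnn eqxx.
by rewrite !mxE eqxx (negbTE ki) dM; case: ifP.
Qed.

Lemma low_part_entry X (i j : 'I_n) : X \in unitmx -> factorable X -> (j < i)%N ->
  low_part X i j = tdet i (colrep i j X) / tdet i X.
Proof.
move=> Xu /low_partP[W lu] ji; rewrite (lu_entry lu ji) mulrC mulKf //.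
by rewrite (tdet_lu i lu) tdet_upper_neq0 ?(lu_unit lu) //; case: lu.
Qed.

Lemma tdet_neq0 r X : X \in unitmx -> factorable X -> tdet r X != 0.
Proof.
move=> Xu /low_partP[W lu].
by rewrite (tdet_lu r lu) tdet_upper_neq0 ?(lu_unit lu) //; case: lu.
Qed.

Lemma tdet0 X : tdet 0 X = \det X.
Proof. by congr (\det _); apply/matrixP => i j; rewrite mxE ltn0. Qed.

End TrailingMinors.

(** Induction on the size, splitting off the first row and column: the trailing minors of the
    remaining block are trailing minors of X. *)
Lemma lu_exists (C : fieldType) (n : nat) (X : 'M[C]_n) :
  (forall r, (0 < r < n)%N -> tdet r X != 0) -> factorable X.
Proof.
elim: n X => [|n IH] X nz.
  exists 1%:M, 1%:M; split; [|exact: unip_1|by apply/matrixP; case].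
  by apply/upperP; case.
pose X' : 'M[C]_(1 + n) := X.
pose D := drsubmx X'; pose c := dlsubmx X'; pose b := ursubmx X'; pose a := ulsubmx X'.
have XE : X' = block_mx a b c D by rewrite submxK.
have tD r : tdet r D = tdet r.+1 X.
  rewrite /tdet.
  have -> : rowsel r.+1 1%:M X = block_mx 1%:M 0 (rowsel r 0 c) (rowsel r 1%:M D) :> 'M_(1 + n).
    apply/matrixP => i j; rewrite -(splitK i) -(splitK j).
    case: (split i) => i'; case: (split j) => j' /=.
    - by rewrite block_mxEul !mxE !ord1 /=.
    - by rewrite block_mxEur !mxE !ord1 /=.
    - rewrite block_mxEdl !mxE /= add1n ltnS; case: ifP => // _.
      by rewrite -val_eqE /= ord1.
    - by rewrite block_mxEdr !mxE /= add1n ltnS; case: ifP.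
  by rewrite [RHS](det_lblock (1%:M : 'M_1) (rowsel r 0 c)) det1 mul1r.
have [W' [M' [uW' uM' DE]]] : factorable D.
  by apply: IH => r rn; rewrite tD nz; lia.
have Wu : W' \in unitmx.
  case: (posnP n) => [n0|n_gt0].
    by rewrite unitmxE (_ : \det W' = 1) ?unitr1 //; move: W' {DE uW'}; rewrite n0 => W'; apply: det_mx00.
  have := nz 1%N; rewrite -tD tdet0 DE det_mulmx (unip_det uM') mulr1 unitmxE unitfE.
  by apply; lia.
have Mu := unip_unit uM'.
(* The corner of [W] is the Schur complement of the lower right block; the other blocks are forced
   by X = W M. *)
pose W : 'M[C]_(1 + n) := block_mx (a - b *m invmx D *m c) (b *m invmx M') 0 W'.
pose M : 'M[C]_(1 + n) := block_mx 1%:M 0 (invmx W' *m c) M'.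
have uWW : upper W.
  apply/upperP => i j; rewrite -(splitK i) -(splitK j).
  case: (split i) => i'; case: (split j) => j' /= ji.
  + by move: ji; rewrite !ord1.
  + by move: ji; rewrite !ord1 /=.
  + by rewrite block_mxEdl mxE.
  + by rewrite block_mxEdr; move/upperP: uW'; apply; move: ji; rewrite !add1n ltnS.
have uMM : unip_lower M.
  case: uM' => /is_trig_mxP tM' dM'; split=> [|i].
    apply/is_trig_mxP => i j; rewrite -(splitK i) -(splitK j).
    case: (split i) => i'; case: (split j) => j' /= ji.
    + by move: ji; rewrite !ord1.
    + by rewrite block_mxEur mxE.
    + by move: ji; rewrite !ord1 /=.
    + by rewrite block_mxEdr tM'.
  rewrite -(splitK i); case: (split i) => i' /=; last by rewrite block_mxEdr.
  by rewrite block_mxEul !ord1 mxE.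
have XWM : X' = W *m M.
  rewrite /W /M mulmx_block !mulmx0 !mul0mx !mulmx1 ?add0r ?addr0.
  rewrite XE mulmxKV // mulKVmx // -DE DE invmx_mul // -DE.
  by congr block_mx; rewrite !mulmxA subrK.
by exists W, M.
Qed.

(** * Regularity at the identity, and birationality of Q *)

Section Regularity1.
Variables (C : numFieldType) (n : nat) (bd : BD_triple n).
Hypothesis n_gt0 : (0 < n)%N.
Local Notation g := (gam bd).
Local Notation tg := (tgamma bd).
Implicit Types (M X N U V W : 'M[C]_n).

(** [tgamma] reads only the entries of its argument whose segment lies in Gamma2. For [low_part] the
    entries in row i have denominator [tdet i], so only marked denominators will occur. *)
Definition seg2 j i := forall r, (j < r <= i)%N -> Gam2 bd r.

Lemma seg2_inc j i : (j < i)%N -> seg bd j i -> (g j.+1 <= g i)%N -> seg2 (g j.+1).-1 (g i).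
Proof.
move=> ji s le r rb; have Gj : Gam1 bd j.+1 by move/segP: s; apply; lia.
have gjn := G2_range (gam_G2 Gj).
have e1 := seg_inc (c := i) _ s le; have e2 := seg_inc (c := j.+1 + (r - g j.+1)) _ s le.
have -> : r = g (j.+1 + (r - g j.+1)) by rewrite e2; lia.
by apply: gam_G2; move/segP: s; apply; lia.
Qed.

Lemma seg2_dec j i : (j < i)%N -> seg bd j i -> (g i <= g j.+1)%N -> seg2 (g i).-1 (g j.+1).
Proof.
move=> ji s le r rb; have Gi : Gam1 bd i by move/segP: s; apply; lia.
have gin := G2_range (gam_G2 Gi).
have e1 := seg_dec (c := i) _ s le; have e2 := seg_dec (c := j.+1 + (g j.+1 - r)) _ s le.
have -> : r = g (j.+1 + (g j.+1 - r)) by lia.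
by apply: gam_G2; move/segP: s; apply; lia.
Qed.

Section Closure.
Variables (T : Type) (S : (T -> C) -> Prop) (M : T -> 'M[C]_n).
Hypothesis SR : funring S.
Hypothesis uM : forall x, unip_lower (M x).
Hypothesis SM : forall i j : 'I_n, (j < i)%N -> seg2 j i -> S (fun x => M x i j).

(** Forward substitution expresses this entry through positions whose segments are contained in that
    of (i, j), hence again in Gamma2. *)
Lemma S_unip_inv (i j : 'I_n) : (j < i)%N -> seg2 j i -> S (fun x => invmx (M x) i j).
Proof.
suff H : forall m (i j : 'I_n), (i < m)%N -> (j < i)%N -> seg2 j i ->
    S (fun x => invmx (M x) i j) by apply: (H n).
elim=> // m IH {}i {}j im ji s.
pose f x := M x i j + \sum_(k < n | (j < k < i)%N) M x i k * invmx (M x) k j.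
have Sf : S f.
  apply: (S_add SR); first exact: SM.
  apply: (S_sum SR) => k /andP[jk ki]; apply: (S_mul SR).
    by apply: SM => // r rb; apply: s; lia.
  by apply: IH => //; [lia|move=> r rb; apply: s; lia].
apply: (S_ext (S_opp SR Sf)) => x.
have [/is_trig_mxP tM dM] := uM x; have [/is_trig_mxP tN dN] := unip_inv (uM x).
apply/esym/eqP; rewrite -addr_eq0 /f.
have : (M x *m invmx (M x)) i j = 0.
  by rewrite mulmxV ?unip_unit // mxE -val_eqE; case: eqP => //= e; lia.
rewrite mxE (bigD1 i) //= dM mul1r (bigD1 j) /=; last first.
  by apply: contraTneq ji => ->; rewrite ltnn.
rewrite dN mulr1 => e; apply/eqP; rewrite -[RHS]e; congr (_ + (_ + _)).
rewrite [RHS](bigID (fun k : 'I_n => (j < k < i)%N)) /= [X in _ = _ + X]big1 ?addr0.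
  apply: eq_bigl => k; rewrite -!val_eqE; apply/idP/idP => H.
    by rewrite H andbT; apply/andP; split; apply/eqP => /= ?; lia.
  by case/andP: H.
move=> k /andP[/andP[ki kj] nb].
have [lt|le] := ltnP k j; first by rewrite [X in _ * X]tN ?mulr0.
have [lt'|le'] := ltnP i k; first by rewrite tM ?mul0r.
by case/negP: nb; move: ki kj; rewrite -!val_eqE => /eqP/= ? /eqP/= ?; lia.
Qed.

Lemma S_entry_ord (A : T -> 'M[C]_n) a b (a_n : (a < n)%N) (b_n : (b < n)%N) :
  S (fun x => A x (Ordinal a_n) (Ordinal b_n)) -> S (fun x => entry (A x) a.+1 b.+1).
Proof. by move=> SA; apply: (S_ext SA) => x; rewrite -entryE. Qed.

Lemma S_tgamma : S_mx S (fun x => tg (M x)).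
Proof.
move=> i j; have [ij|ji|e] := ltngtP i j.
- apply: (S_ext (S_cst SR 0)) => x.
  by have [/is_trig_mxP -> //] := tgamma_unip bd n_gt0 (uM x).
- apply: (@S_ext _ _ _ (fun x => rgn bd (M x - 1%:M) (invmx (M x) - 1%:M) i j)); last first.
    by move=> x; rewrite tgamma_entry.
  rewrite /rgn ji /=; have [s|_] := boolP (seg bd j i); last exact: (S_cst SR).
  have Gi : Gam1 bd i by move/segP: s; apply; lia.
  have Gj : Gam1 bd j.+1 by move/segP: s; apply; lia.
  have gin := G2_range (gam_G2 Gi); have gjn := G2_range (gam_G2 Gj).
  have key (A : T -> 'M[C]_n) a b : (0 < b <= a)%N -> (a < n)%N -> seg2 b.-1 a ->
      (forall i j : 'I_n, (j < i)%N -> seg2 j i -> S (fun x => A x i j)) ->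
      S (fun x => entry (A x - 1%:M) a.+1 b).
    case: b => //= b ba a_n s2 SA; have b_n : (b < n)%N by lia.
    apply: (S_entry_ord (a_n := a_n) (b_n := b_n)).
    apply: (@S_ext _ _ _ (fun x => A x (Ordinal a_n) (Ordinal b_n))); last first.
      move=> x; rewrite !mxE -val_eqE /=; case: eqP => [e|_]; last by rewrite subr0.
      by exfalso; lia.
    exact: SA.
  have [le|lt] := leqP (g j.+1) (g i).
    by apply: key SM; [lia|lia|apply: seg2_inc].
  apply: (S_mul SR); first exact: (S_cst SR).
  by apply: key S_unip_inv; [lia|lia|apply/seg2_dec/ltnW].
- apply: (S_ext (S_cst SR 1)) => x; rewrite (val_inj e).
  by have [_ ->] := tgamma_unip bd n_gt0 (uM x).
Qed.

End Closure.

Lemma S_unip_inv_all (T : Type) (S : (T -> C) -> Prop) (M : T -> 'M[C]_n) :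
  funring S -> (forall x, unip_lower (M x)) -> S_mx S M -> S_mx S (fun x => invmx (M x)).
Proof.
move=> SR uM SM i j; apply: (S_ext (S_adj SR SM i j)) => x.
by rewrite unip_invE.
Qed.

Lemma polyfun_tdet r : polyfun (tdet r : 'M[C]_n -> C).
Proof.
apply: (S_det (polyfun_funring _ _)) => i j.
have [ir|ir] := boolP (i < r)%N.
  by apply: (S_ext (S_cst (polyfun_funring _ _) (1%:M i j))) => U; rewrite [RHS]mxE ir.
by apply: (S_ext (@polyfun_mx C n i j)) => U; rewrite [RHS]mxE (negbTE ir).
Qed.

Lemma tdet1 r : tdet r (1%:M : 'M[C]_n) = 1.
Proof. by rewrite tdet_unip //; apply: unip_1. Qed.

Lemma near1_factorable : near1 (fun U : 'M[C]_n => U \in unitmx /\ factorable U).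
Proof.
apply: near1_and; first exact: near1_unit.
have : near1 (fun U : 'M[C]_n => forall r, r \in iota 1 n.-1 -> tdet r U != 0).
  apply: near1_in => r _; apply: reg1_neq0; first exact/reg1_poly/polyfun_tdet.
  by rewrite tdet1 oner_eq0.
apply: near1_mono => U H; apply: lu_exists => r rn; apply: H.
by rewrite mem_iota; lia.
Qed.

Lemma low_part1 : low_part (1%:M : 'M[C]_n) = 1%:M.
Proof.
apply: (low_part_lu (W := 1%:M)); first exact: unitmx1.
split; rewrite ?mulmx1 //; last exact: unip_1.
by apply/upperP => i j ji; rewrite mxE -val_eqE; case: eqP => //= e; lia.
Qed.

Lemma reg1_low_part : S_mx (@reg1 C n) (fun U => low_part U).
Proof.
move=> i j; have SR := reg1_funring C n; have [ij|ji|e] := ltngtP i j.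
- apply: (S_ext (S_cst SR 0)) => U.
  by have [/is_trig_mxP -> //] := low_part_unip U.
- apply: (@reg1_near _ _ (fun U => tdet i (colrep i j U) * (tdet i U)^-1)); last first.
    by apply: near1_mono near1_factorable => U [Uu fU]; rewrite low_part_entry.
  apply: (S_mul SR); last first.
    by apply: reg1_inv; [exact/reg1_poly/polyfun_tdet|rewrite tdet1 oner_eq0].
  apply: reg1_poly; apply: (polyfun_comp (polyfun_funring _ _)) (polyfun_tdet _) => k l.
  apply: (S_ext (@polyfun_mx C n k (if l == i then j else l))) => U.
  by rewrite mxE.
- apply: (S_ext (S_cst SR 1)) => U; rewrite (val_inj e).
  by have [_ ->] := low_part_unip U.
Qed.

Lemma reg1_tg (M : 'M[C]_n -> 'M[C]_n) : (forall U, unip_lower (M U)) ->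
  S_mx (@reg1 C n) M -> S_mx (@reg1 C n) (fun U => tg (M U)).
Proof. by move=> uM SM; apply: S_tgamma => //; apply: reg1_funring. Qed.

Lemma Fseq1 k : Fseq bd (1%:M : 'M[C]_n) k = 1%:M.
Proof. by elim: k => //= k ->; rewrite low_part1 tgamma1 // mulmx1. Qed.

Lemma reg1_mxcomp (A Q : 'M[C]_n -> 'M[C]_n) : S_mx (@reg1 C n) Q -> Q 1%:M = 1%:M ->
  S_mx (@reg1 C n) A -> S_mx (@reg1 C n) (fun U => A (Q U)).
Proof. by move=> SQ Q1 SA i j; apply: (reg1_comp SQ Q1 (SA i j)). Qed.

Lemma reg1_Fseq k : S_mx (@reg1 C n) (fun U => Fseq bd U k).
Proof.
elim: k => [|k IH]; first exact: reg1_mx.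
apply: (S_mx_mul (reg1_funring C n)); last exact: reg1_mx.
apply: reg1_tg => [U|]; first exact: low_part_unip.
exact: reg1_mxcomp IH (Fseq1 k) reg1_low_part.
Qed.

Lemma near1_goodF : near1 (fun U : 'M[C]_n => goodF bd U).
Proof.
apply: near1_and; first exact: near1_unit.
have : near1 (fun U : 'M[C]_n => forall k, k \in iota 0 n.+1 ->
    Fseq bd U k \in unitmx /\ factorable (Fseq bd U k)).
  apply: near1_in => k _; apply: near1_comp near1_factorable; first exact: reg1_Fseq.
  exact: Fseq1.
by apply: near1_mono => U H k kn; have [] := H k; rewrite ?mem_iota.
Qed.

Lemma reg1_Fmap : S_mx (@reg1 C n) (fun U => Fmap bd U).
Proof.
move=> i j; apply: reg1_near (reg1_Fseq n i j) _.
by apply: near1_mono near1_goodF => U gU; rewrite FmapE.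
Qed.

Lemma goodF1 : goodF bd (1%:M : 'M[C]_n).
Proof.
split=> [|k _]; first exact: unitmx1.
rewrite Fseq1; apply: lu_exists => r _; by rewrite tdet1 oner_eq0.
Qed.

Lemma Fmap1 : Fmap bd (1%:M : 'M[C]_n) = 1%:M.
Proof. by rewrite FmapE ?Fseq1 //; apply: goodF1. Qed.

Lemma nu1 : nu bd (1%:M : 'M[C]_n) = 1%:M.
Proof. by rewrite /nu Fmap1 low_part1 tgamma1. Qed.

Lemma reg1_nu : S_mx (@reg1 C n) (fun U => nu bd U).
Proof.
apply: reg1_tg => [U|]; first exact: low_part_unip.
exact: reg1_mxcomp reg1_Fmap Fmap1 reg1_low_part.
Qed.

Lemma Qinv1 : Qinv bd (1%:M : 'M[C]_n) = 1%:M.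
Proof. by rewrite /Qinv nu1 mulmx1 invmx1 mulmx1. Qed.

Lemma reg1_Qinv : S_mx (@reg1 C n) (fun U => Qinv bd U).
Proof.
have SR := reg1_funring C n; apply: (S_mx_mul SR).
  by apply: (S_mx_mul SR); [exact: reg1_nu|exact: reg1_mx].
by apply: S_unip_inv_all => //; [exact: nu_unip|exact: reg1_nu].
Qed.

Lemma rho1 : rho bd (1%:M : 'M[C]_n) = 1%:M.
Proof.
apply/esym/rho_uniq => //; first exact: unip_1.
by rewrite low_part1 mulmx1 tgamma1.
Qed.

(** The restriction to Gamma2 matters for the first [tgamma] only; all entries of its value lie in
    the ring, and the further iterates stay there. *)
Lemma S_rho (S : ('M[C]_n -> C) -> Prop) : funring S ->
  (forall i j : 'I_n, (j < i)%N -> seg2 j i -> S (fun U => low_part U i j)) ->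
  S_mx S (fun U => rho bd U).
Proof.
move=> SR SL i j.
apply: (@S_ext _ _ _ (fun U => (\prod_(1 <= k < n.+1) iter k tg (low_part U)) i j)); last first.
  by move=> U; rewrite rhoE.
have Sk k : S_mx S (fun U => iter k.+1 tg (low_part U)).
  elim: k => [|k IH]; first by apply: S_tgamma => // U; apply: low_part_unip.
  apply: (S_tgamma (M := fun U => iter k.+1 tg (low_part U))) => // U.
  exact/iter_tgamma_unip/low_part_unip.
suff H : forall r, S_mx S (fun U => \prod_(k <- r) iter k.+1 tg (low_part U)).
  by apply: (S_ext (H (iota 0 n) i j)) => U; rewrite big_add1 /index_iota subn0.
elim=> [|k r IH] {}i {}j.
  by apply: (S_ext (S_cst SR (1%:M i j))) => U; rewrite big_nil.
by apply: (S_ext (S_mx_mul SR (Sk k) IH i j)) => U; rewrite big_cons.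
Qed.

Lemma reg1_rho : S_mx (@reg1 C n) (fun U => rho bd U).
Proof. by apply: S_rho; [exact: reg1_funring|move=> i j _ _; apply: reg1_low_part]. Qed.

Lemma Qmap1 : Qmap bd (1%:M : 'M[C]_n) = 1%:M.
Proof. by rewrite /Qmap rho1 invmx1 !mulmx1. Qed.

Lemma reg1_Qmap : S_mx (@reg1 C n) (fun U => Qmap bd U).
Proof.
have SR := reg1_funring C n; apply: (S_mx_mul SR); last exact: reg1_rho.
apply: (S_mx_mul SR); last exact: reg1_mx.
by apply: S_unip_inv_all => //; [exact: rho_unip|exact: reg1_rho].
Qed.

Lemma det_Qmap U : \det (Qmap bd U) = \det U.
Proof.
have uR := rho_unip bd n_gt0 U.
by rewrite /Qmap !det_mulmx (unip_det uR) (unip_det (unip_inv uR)) mul1r mulr1.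
Qed.

Lemma det_Qinv U : \det (Qinv bd U) = \det U.
Proof.
have uR := nu_unip bd n_gt0 U.
by rewrite /Qinv !det_mulmx (unip_det uR) (unip_det (unip_inv uR)) mul1r mulr1.
Qed.

Lemma in_group_Qmap G U : in_group G U -> in_group G (Qmap bd U).
Proof. by case: G; rewrite /= det_Qmap. Qed.

Lemma in_group_Qinv G U : in_group G U -> in_group G (Qinv bd U).
Proof. by case: G; rewrite /= det_Qinv. Qed.

Definition goodQ U := [/\ U \in unitmx, factorable U & goodF bd (Qmap bd U)].

Lemma near1_goodQ : near1 (fun U : 'M[C]_n => goodQ U).
Proof.
have := near1_comp reg1_Qmap Qmap1 near1_goodF => H.
by apply: near1_mono (near1_and near1_factorable H) => U [[]].
Qed.

Lemma rational_Qmap G : rational_map G (@Qmap C n bd).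
Proof.
split=> [|i j]; first by apply: generically_all => // U; apply: in_group_Qmap.
exact/reg1_rational/reg1_Qmap.
Qed.

Lemma rational_Qinv G : rational_map G (@Qinv C n bd).
Proof.
split=> [|i j]; first by apply: generically_all => // U; apply: in_group_Qinv.
exact/reg1_rational/reg1_Qinv.
Qed.

Lemma generically_QmapK G : generically G (fun U : 'M[C]_n => Qmap bd (Qinv bd U) = U).
Proof. by apply/near1_generically/(near1_mono _ near1_goodF) => U; apply: QmapK. Qed.

Lemma generically_QinvK G : generically G (fun U : 'M[C]_n => Qinv bd (Qmap bd U) = U).
Proof. by apply/near1_generically/(near1_mono _ near1_goodQ) => U []; apply: QinvK. Qed.

(** Take a point V1 where the given polynomial is nonzero and Q(Q' V1) = V1; then Q' V1 shows that
    its composition with Q is not identically zero on the group. Numerator times denominator of that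
    composition is the required polynomial. *)
Lemma dominant_inverse G (Q Q' : 'M[C]_n -> 'M[C]_n) :
  S_mx (@reg1 C n) Q -> S_mx (@reg1 C n) Q' -> Q' 1%:M = 1%:M ->
  (forall U, in_group G U -> in_group G (Q U)) ->
  (forall U, in_group G U -> in_group G (Q' U)) ->
  generically G (fun U => Q (Q' U) = U) -> dominant G Q.
Proof.
move=> RQ RQ' Q'1 GQ GQ' QK P [q [[V GV qV] qP]].
have [a [b [b1 abE]]] := peval_comp q (reg1_funring C n) RQ.
have gq : generically G (fun U => peval q U != 0) by exists q; split=> //; exists V.
have gb : generically G (fun U => peval b (Q' U) != 0).
  apply: near1_generically; apply: (near1_comp RQ' Q'1 (P := fun U => peval b U != 0)).
  by exists b.
have [r [[V1 GV1 rV1] rP]] := generically_and n_gt0 (generically_and n_gt0 gq gb) QK.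
have [[qV1 bV1] QV1] := rP V1 GV1 rV1.
exists (a * b); split.
  exists (Q' V1); first exact: GQ'.
  rewrite pevalM mulf_neq0 //.
  by have := abE _ bV1; rewrite QV1 => e; move: qV1; rewrite e mulf_eq0 negb_or => /andP[].
move=> U GU; rewrite pevalM mulf_eq0 negb_or => /andP[aU bU].
by apply: qP; [exact: GQ|rewrite abE // mulf_neq0 ?invr_neq0].
Qed.

Lemma dominant_Qmap G : dominant G (@Qmap C n bd).
Proof.
apply: (dominant_inverse reg1_Qmap reg1_Qinv Qinv1); [| |exact: generically_QmapK].
  exact: in_group_Qmap.
exact: in_group_Qinv.
Qed.

Lemma dominant_Qinv G : dominant G (@Qinv C n bd).
Proof.
apply: (dominant_inverse reg1_Qinv reg1_Qmap Qmap1); [| |exact: generically_QinvK].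
  exact: in_group_Qinv.
exact: in_group_Qmap.
Qed.

Lemma birational_Qmap G : birational G (@Qmap C n bd).
Proof.
split; [exact: rational_Qmap|exact: dominant_Qmap|exists (@Qinv C n bd)].
by split; [exact: rational_Qinv|exact: dominant_Qinv|exact: generically_QinvK
          |exact: generically_QmapK].
Qed.

End Regularity1.

(** * The variables under Q *)

Section Invariance.
Variables (C : fieldType) (n : nat).
Hypothesis n_gt0 : (0 < n)%N.
Implicit Types (N U X R : 'M[C]_n).

Lemma unip_entry0 N i j : unip_lower N -> (i < j)%N -> entry N i.+1 j.+1 = 0.
Proof.
move=> [/is_trig_mxP tN _] ij; have [H|] := boolP ((n <= i)%N || (n <= j)%N).
  exact: entry_default.
rewrite negb_or -!ltnNge => /andP[i_n j_n].
by rewrite (entryE _ (Ordinal i_n) (Ordinal j_n)) tN.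
Qed.

Lemma unip_entry1 N i : unip_lower N -> (i < n)%N -> entry N i.+1 i.+1 = 1.
Proof. by move=> [_ dN] i_n; rewrite (entryE _ (Ordinal i_n) (Ordinal i_n)) dN. Qed.

(** Lower triangular N mixes a column only with later ones, so the last s columns of X N depend on
    the last s columns of X alone. *)
Lemma entry_mul_unip X N i s j : unip_lower N -> (s <= n)%N -> (j < s)%N ->
  entry (X *m N) i.+1 (n - s + j).+1 =
  \sum_(k < s) entry X i.+1 (n - s + k).+1 * entry N (n - s + k).+1 (n - s + j).+1.
Proof.
move=> uN sn js; rewrite entryM (big_cat_nat (n := (n - s)%N)) //=; last by lia.
rewrite [X in X + _]big_nat_cond big1 ?add0r => [|k /andP[kb _]]; last first.
  by rewrite (unip_entry0 uN) ?mulr0 //; lia.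
rewrite sum_shift subKn // big_mkord; apply: eq_bigr => k _.
by rewrite addnC.
Qed.

Lemma entry_mul_last X N i : unip_lower N -> entry (X *m N) i.+1 n = entry X i.+1 n.
Proof.
move=> uN; have := entry_mul_unip X i uN n_gt0 (ltnSn 0).
have e : (n - 1 + 0).+1 = n by lia.
by rewrite big_ord1 /= unip_entry1 ?e ?mulr1 //; lia.
Qed.

Lemma det_unip_block N s (B : 'M[C]_s) : unip_lower N -> (s <= n)%N ->
  (forall i j, B i j = entry N (n - s + i).+1 (n - s + j).+1) -> \det B = 1.
Proof.
move=> uN sn BE; rewrite det_trig.
  by rewrite big1 // => i _; rewrite BE unip_entry1 //; have := ltn_ord i; lia.
by apply/is_trig_mxP => i j ij; rewrite BE unip_entry0 //; lia.
Qed.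

Lemma minor_mul_unip X N i j : unip_lower N -> (0 < i)%N -> (0 < j <= n)%N ->
  minor (X *m N) i j (n - j).+1 = minor X i j (n - j).+1.
Proof.
move=> uN i0 jn; set s := (n - j).+1; have sn : (s <= n)%N by rewrite /s; lia.
have ej b : (j + b = (n - s + b).+1)%N by rewrite /s; lia.
pose B : 'M[C]_s := \matrix_(a, b) entry N (n - s + a).+1 (n - s + b).+1.
have dB : \det B = 1 by apply: (det_unip_block uN sn) => a b; rewrite mxE.
rewrite /minor -[RHS]mulr1 -dB -det_mulmx; congr (\det _); apply/matrixP => a b.
rewrite !mxE ej (_ : i + a = (i + a).-1.+1)%N; last by lia.
rewrite entry_mul_unip //; apply: eq_bigr => k _.
by rewrite !mxE ej prednK //; lia.
Qed.

Lemma sum_window (f : nat -> C) k l : (k + l <= n)%N ->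
  \sum_(m < n) (if (k <= m < k + l)%N then f (m - k)%N else 0) = \sum_(m < l) f m.
Proof.
move=> kln; pose F m := if (k <= m < k + l)%N then f (m - k)%N else 0.
rewrite -(big_mkord xpredT F) (big_cat_nat (n := k)) //=; last by lia.
rewrite [X in _ + X](big_cat_nat (n := (k + l)%N)) //=; last by lia.
rewrite [X in X + _]big_nat_cond [X in _ + (_ + X)]big_nat_cond.
rewrite [X in X + _]big1 => [|m /andP[mb _]]; last by rewrite /F ifF //; lia.
rewrite [X in _ + (_ + X)]big1 => [|m /andP[mb _]]; last by rewrite /F ifF //; lia.
rewrite add0r addr0 sum_shift addKn big_mkord; apply: eq_bigr => m _.
by rewrite /F addnK ifT //; have := ltn_ord m; lia.
Qed.

(* The columns defining phi_kl, with the powers of U replaced by P. *)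
Definition phimx k l (P : nat -> 'M[C]_n) : 'M[C]_n := \matrix_(i, j)
  if (j < k)%N then entry (P 0%N) i.+1 (n - k + j).+1
  else if (j < k + l)%N then entry (P 1%N) i.+1 (n - l + (j - k)).+1
  else entry (P (j - (k + l)).+2) i.+1 n.

Lemma entry_mull R X (i : 'I_n) c : (0 < c)%N ->
  entry (R *m X) i.+1 c = \sum_k R i k * entry X k.+1 c.
Proof.
case: c => // c _; rewrite entryM big_mkord.
by apply: eq_bigr => k _; rewrite entryE.
Qed.

Lemma phimx_mull k l R P : phimx k l (fun m => R *m P m) = R *m phimx k l P.
Proof.
apply/matrixP => i j; rewrite !mxE; case: ifP => jk; last case: ifP => jkl;
  by rewrite entry_mull //; apply: eq_bigr => m _; rewrite !mxE jk ?jkl.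
Qed.

Lemma phimx_mulr k l N P : (k + l <= n)%N -> unip_lower N ->
  \det (phimx k l (fun m => P m *m N)) = \det (phimx k l P).
Proof.
move=> kln uN.
(* Block diagonal: the trailing blocks of N of sizes k and l act on the columns of the first two
   groups, and the remaining columns are untouched because the last column of a product with N is
   that of the left factor. *)
pose B : 'M[C]_n := \matrix_(i, j)
  if (j < k)%N then if (i < k)%N then entry N (n - k + i).+1 (n - k + j).+1 else 0
  else if (j < k + l)%N then
    if (k <= i < k + l)%N then entry N (n - l + (i - k)).+1 (n - l + (j - k)).+1 else 0
  else (i == j)%:R.
have dB : \det B = 1.
  rewrite det_trig.
    rewrite big1 // => i _; rewrite !mxE; have := ltn_ord i => lti.
    have [ik|ki] := ltnP i k; first by rewrite unip_entry1 //; lia.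
    by have [ikl|kli] := ltnP i (k + l); rewrite ?eqxx // unip_entry1 //; lia.
  apply/is_trig_mxP => i j ij; rewrite !mxE.
  have [jk|kj] := ltnP j k; first by rewrite (ltn_trans ij jk) unip_entry0 //; lia.
  have [jkl|klj] := ltnP j (k + l).
    by case: ifP => // ki; rewrite unip_entry0 //; lia.
  by rewrite -val_eqE; case: eqP => //= e; lia.
rewrite -[RHS]mulr1 -dB -det_mulmx; congr (\det _); apply/matrixP => i j; rewrite !mxE.
have [jk|kj] := ltnP j k.
  rewrite entry_mul_unip //; last by lia.
  pose f m := entry (P 0%N) i.+1 (n - k + m).+1 * entry N (n - k + m).+1 (n - k + j).+1.
  rewrite -(@sum_window f 0 k); last by lia.
  apply: eq_bigr => m _; rewrite !mxE jk add0n leq0n subn0 /=.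
  by case: ifP => mk; rewrite ?mulr0.
have [jkl|klj] := ltnP j (k + l).
  rewrite entry_mul_unip; [|by []|lia|lia].
  pose f m := entry (P 1%N) i.+1 (n - l + m).+1 * entry N (n - l + m).+1 (n - l + (j - k)).+1.
  rewrite -(@sum_window f k l) //.
  apply: eq_bigr => m _; rewrite !mxE (leq_gtF kj) jkl.
  have [mk|km] := ltnP m k; first by rewrite /= mulr0.
  by rewrite /=; case: ifP => mkl; rewrite ?mulr0.
rewrite (bigD1 j) //= !mxE big1 ?addr0 => [|m mj]; rewrite ?mxE (leq_gtF kj) (leq_gtF klj).
  rewrite eqxx mulr1.
  exact: entry_mul_last.
by rewrite (negbTE mj) mulr0.
Qed.

Lemma conj_exp N U k : unip_lower N ->
  (invmx N *m U *m N) ^+ k = invmx N *m U ^+ k *m N.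
Proof.
move=> uN; have Nu := unip_unit uN; elim: k => [|k IH].
  by rewrite !expr0 (mulmx1 (invmx N)) mulVmx.
rewrite exprSr IH [U ^+ k.+1]exprSr -!mulmxE !mulmxA.
by rewrite -[invmx N *m U ^+ k *m N *m invmx N]mulmxA mulmxV // mulmx1.
Qed.

Lemma phi_funE k l U : phi_fun k l U = phi_sign C n k l * \det (phimx k l (fun m => U ^+ m)).
Proof. by []. Qed.

Lemma phi_conj k l N U : (k + l <= n)%N -> unip_lower N ->
  phi_fun k l (invmx N *m U *m N) = phi_fun k l U.
Proof.
move=> kln uN; rewrite !phi_funE; congr (_ * _).
transitivity (\det (phimx k l (fun m => invmx N *m U ^+ m *m N))).
  congr (\det _); apply/matrixP => i j; rewrite !mxE.
  by case: ifP => _; last case: ifP => _; rewrite conj_exp.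
rewrite phimx_mulr // phimx_mull det_mulmx.
by rewrite (unip_det (unip_inv uN)) mul1r.
Qed.

Lemma c_conj i N U : unip_lower N -> c_fun i (invmx N *m U *m N) = c_fun i U.
Proof.
move=> uN; have Nu := unip_unit uN; rewrite /c_fun; congr (_ * (polyseq _)`_i).
have -> : 1%:M + 'X *: map_mx polyC (invmx N *m U *m N) =
    map_mx polyC (invmx N) *m (1%:M + 'X *: map_mx polyC U) *m map_mx polyC N.
  have e : map_mx polyC (invmx N) *m map_mx polyC N = 1%:M.
    by rewrite -map_mxM mulVmx // map_mx1.
  by rewrite !map_mxM mulmxDr mulmx1 mulmxDl e -scalemxAr -scalemxAl.
rewrite !det_mulmx !det_map_mx (unip_det uN) (unip_det (unip_inv uN)) rmorph1.
by rewrite mul1r mulr1.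
Qed.

Lemma tdet_minor X a : (a < n)%N -> minor X a.+1 a.+1 (n - a) = tdet a X.
Proof.
move=> an; have [s ns] : exists s, n = (a + s)%N by exists (n - a)%N; lia.
rewrite /minor /tdet; move: X; rewrite ns addKn => X.
have -> : rowsel a 1%:M X = block_mx 1%:M 0 (dlsubmx X) (drsubmx X).
  apply/matrixP => i j; rewrite -(splitK i) -(splitK j).
  case: (split i) => i'; case: (split j) => j' /=.
  - by rewrite block_mxEul !mxE /= ltn_ord -!val_eqE.
  - rewrite block_mxEur !mxE /= ltn_ord -val_eqE /=; case: eqP => // e.
    by have := ltn_ord i'; lia.
  - by rewrite block_mxEdl !mxE /= ltnNge leq_addr.
  - by rewrite block_mxEdr !mxE /= ltnNge leq_addr.
rewrite det_lblock det1 mul1r; congr (\det _); apply/matrixP => i j; rewrite !mxE.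
by rewrite !addSn -(entryE X (rshift a i) (rshift a j)).
Qed.

End Invariance.

Section HFunctions.
Variables (C : numFieldType) (n : nat) (bd : BD_triple n).
Hypothesis n_gt0 : (0 < n)%N.
Local Notation g := (gam bd).
Implicit Types (U : 'M[C]_n).

Lemma tgamma_std (M : 'M[C]_n) : unip_lower M -> tgamma (BD_std n) M = 1%:M.
Proof.
move=> uM; rewrite tgammaE // (_ : rg _ _ _ = 0) ?addr0 //.
apply/matrixP => i j; rewrite !mxE /rgn; case: ifP => // /andP[ji /segP/(_ i)].
by move=> H; have : Gam1 (BD_std n) i by apply: H; rewrite ji leqnn.
Qed.

Lemma Fmap_std U : Fmap (BD_std n) U = U.
Proof.
apply: (@eventual_valueP _ _ _ _ 0) => k _; elim: k => //= k ->.
by rewrite tgamma_std ?mul1mx //; apply: low_part_unip.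
Qed.

Lemma h_fun_std i j U : (1 < i)%N -> h_fun (BD_std n) i j U = h_std i j U.
Proof.
move=> i1; rewrite /h_fun ifF; last by apply/negP => /andP[/eqP]; lia.
by rewrite Fmap_std steps0 ?big_geq ?mulr1 //; lia.
Qed.

Lemma h_std_diag a U : (a < n)%N -> h_std a.+1 a.+1 U = tdet a U.
Proof.
move=> an; rewrite /h_std subnn mul0n expr0 mul1r -tdet_minor //.
by congr (minor _ _ _ _); lia.
Qed.

Lemma iter_range a t : (0 < a < n)%N -> (t <= steps bd a)%N -> (0 < iter t g a < n)%N.
Proof.
move=> ra; case: t => // t ts; have a0 : (0 < a)%N by case/andP: ra.
by rewrite iterS; apply: G2_range; apply: gam_G2; apply: steps_G1.
Qed.

Lemma h_funE i j U : (1 < i <= n)%N -> h_fun bd i j U =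
  (-1) ^+ ((j - i) * (n - i)) * minor (Fmap bd U) i j (n - j).+1
  * \prod_(1 <= t < (steps bd i.-1).+1) tdet (iter t g i.-1) (Fmap bd U).
Proof.
move=> ri; rewrite /h_fun ifF; last by apply/negP => /andP[/eqP]; lia.
congr (_ * _); rewrite big_nat_cond [RHS]big_nat_cond; apply: eq_bigr => t /andP[tb _].
have /andP[_ lt] : (0 < iter t g i.-1 < n)%N by apply: iter_range; lia.
by rewrite tdet_minor.
Qed.

Lemma h_fun_Q i j U : (1 < i)%N -> (i <= j <= n)%N -> goodQ bd U ->
  h_fun bd i j (Qmap bd U) =
  h_std i j U * \prod_(1 <= t < (steps bd i.-1).+1) tdet (iter t g i.-1) U.
Proof.
move=> i1 ij [Uu fU gQ]; have uR := rho_unip bd n_gt0 U.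
rewrite h_funE ?Fmap_Q //; last by lia.
rewrite /h_std minor_mul_unip //; [|lia|lia].
congr (_ * _); rewrite big_nat_cond [RHS]big_nat_cond; apply: eq_bigr => t /andP[tb _].
have ra : (0 < iter t g i.-1 < n)%N by apply: iter_range; lia.
set a := iter t g i.-1 in ra *; have /andP[_ an] := ra.
rewrite -[LHS]tdet_minor // -[RHS]tdet_minor //.
have e : (n - a = (n - a.+1).+1)%N by lia.
by rewrite e minor_mul_unip //; lia.
Qed.

Lemma gamma_string_iter alpha m k : gamma_string bd alpha m -> (k <= m)%N ->
  [/\ (0 < alpha k < n)%N, steps bd (alpha k) = (m - k)%N &
      forall t, (t <= m - k)%N -> alpha (k + t)%N = iter t g (alpha k)].
Proof.
move=> [a0 nG aS nGm] km.
have it t : (t <= m - k)%N -> alpha (k + t)%N = iter t g (alpha k).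
  elim: t => [|t IH] tm; first by rewrite addn0.
  have lt : (k + t < m)%N by lia.
  have [_ e] := aS _ lt.
  by rewrite addnS e iterS -IH //; lia.
have ra : (0 < alpha k < n)%N.
  case: k km {it} => [|k] km; first by lia.
  by have [Gk ->] := aS k km; apply/G2_range/gam_G2.
split=> //; apply: steps_uniq => //; first by case/andP: ra.
  move=> t tm; rewrite -it; last by lia.
  have lt : (k + t < m)%N by lia.
  by have [] := aS _ lt.
by rewrite -it // subnKC.
Qed.

End HFunctions.

Lemma addmxE (V : nmodType) p q (A B : 'M[V]_(p, q)) i j : (A + B) i j = A i j + B i j.
Proof. by rewrite mxE. Qed.

Lemma oppmxE (V : zmodType) p q (A : 'M[V]_(p, q)) i j : (- A) i j = - A i j.
Proof. by rewrite mxE. Qed.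

(** * Regularity along gamma-strings *)

Section Projectors.
Variables (C : fieldType) (n : nat).

Definition dp (A : pred nat) : 'M[C]_n := \matrix_(i, j) ((i == j) && A i)%:R.

Lemma dplE p A (X : 'M[C]_(n, p)) i j : (dp A *m X) i j = if A i then X i j else 0.
Proof.
rewrite mxE (bigD1 i) //= big1 ?addr0 => [|k ki]; rewrite mxE.
  by rewrite eqxx /=; case: (A i); rewrite ?mul1r ?mul0r.
by rewrite eq_sym (negbTE ki) mul0r.
Qed.

Lemma dprE p A (X : 'M[C]_(p, n)) i j : (X *m dp A) i j = if A j then X i j else 0.
Proof.
rewrite mxE (bigD1 j) //= big1 ?addr0 => [|k kj]; rewrite mxE.
  by rewrite eqxx /=; case: (A j); rewrite ?mulr1 ?mulr0.
by rewrite (negbTE kj) mulr0.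
Qed.

Lemma tr_dp A : (dp A)^T = dp A.
Proof. by apply/matrixP => i j; rewrite !mxE eq_sym; case: eqP => // ->. Qed.

Lemma dpM A B : dp A *m dp B = dp (predI A B).
Proof.
apply/matrixP => i j; rewrite dplE !mxE /=; case: (A i); rewrite ?andbF //=.
Qed.

Lemma dp_eq (A B : pred nat) : (forall i, (i < n)%N -> A i = B i) -> dp A = dp B.
Proof. by move=> AB; apply/matrixP => i j; rewrite !mxE AB. Qed.

Lemma dp0 (A : pred nat) : (forall i, (i < n)%N -> A i = false) -> dp A = 0.
Proof. by move=> A0; apply/matrixP => i j; rewrite !mxE A0 ?andbF. Qed.

Lemma dp1 (A : pred nat) : (forall i, (i < n)%N -> A i) -> dp A = 1%:M.
Proof. by move=> A1; apply/matrixP => i j; rewrite !mxE A1 ?andbT. Qed.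

Lemma dpD (A B : pred nat) : (forall i, ~~ (A i && B i)) -> dp A + dp B = dp (predU A B).
Proof.
move=> AB; apply/matrixP => i j; rewrite !mxE -natrD /=; congr (_%:R).
by case: (i == j) => //=; move: (AB i); case: (A i); case: (B i).
Qed.

Lemma rowselE p r (Z X : 'M[C]_(n, p)) :
  rowsel r Z X = dp (fun i => (i < r)%N) *m Z + dp (fun i => (r <= i)%N) *m X.
Proof.
apply/matrixP => i j; rewrite mxE [RHS]mxE !dplE (leqNgt r).
by case: (i < r)%N; rewrite ?addr0 ?add0r.
Qed.

End Projectors.

(** * Enlarging determinants *)

Section BlockDeterminants.
Variables (C : fieldType) (n m : nat).
Implicit Types (M : 'M[C]_n) (J : 'M[C]_(m, n)) (X : 'M[C]_(n, m)) (W : 'M[C]_m).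
Local Notation dp := (dp C n).

Lemma det_ul_upper (A : 'M[C]_n) (B : 'M[C]_(n, m)) (D : 'M[C]_m) :
  \det (block_mx A B 0 D) = \det A * \det D.
Proof. exact: det_ublock. Qed.

(* M enters the small determinant only through its rows b, ..., q. The rows
   after q can be added because they are unitriangular on the columns after q. *)
Lemma det_extend_rows b q J :
  let P := dp (fun i => (b <= i <= q)%N) in
  J *m P = J -> J^T *m J = P ->
  exists2 c, c != 0 & forall M X W, unip_lower M -> J^T *m W = 0 ->
    \det (J *m M *m X + W) =
    c * \det (col_mx (rowsel b (row_mx 1%:M 0) (M *m row_mx (dp (fun i => (q < i)%N)) X))
                     (row_mx J W)).
Proof.
move=> P JP JJ.
(* An orthogonal matrix exchanging, up to sign, the rows b, ..., q with the rows that [J]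
   selects. *)
pose S : 'M[C]_(n + m) := block_mx (1%:M - P) (- J^T) J (1%:M - J *m J^T).
have PT : P^T = P by rewrite tr_dp.
have PP : P *m P = P by rewrite dpM; apply: dp_eq => i _ /=; rewrite andbb.
have PJT : P *m J^T = J^T by rewrite -{1}PT -trmx_mul JP.
have SS : S *m S^T = 1%:M.
  have -> : S^T = block_mx (1%:M - P) J^T (- J) (1%:M - J *m J^T).
    by rewrite tr_block_mx !raddfB /= !trmx1 PT raddfN /= trmx_mul !trmxK.
  have PP1 : (1%:M - P) *m (1%:M - P) = 1%:M - P.
    by rewrite mulmxBr mulmx1 mulmxBl mul1mx PP subrr subr0.
  have JPJ : J *m J^T *m J = J by rewrite -mulmxA JJ.
  rewrite mulmx_block scalar_mx_block; congr block_mx.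
  - by rewrite PP1 mulmxN mulNmx opprK JJ subrK.
  - rewrite mulmxBl mul1mx PJT subrr add0r mulNmx mulmxBr mulmx1 mulmxA JJ PJT.
    by rewrite subrr oppr0.
  - rewrite mulmxBr mulmx1 JP subrr add0r mulmxN mulmxBl mul1mx JPJ.
    by rewrite subrr oppr0.
  - rewrite mulmxBr mulmx1 mulmxBl mul1mx mulmxA JPJ subrr subr0.
    by rewrite addrC subrK.
have S0 : \det S != 0.
  have := congr1 determinant SS; rewrite det_mulmx det1 det_tr => e.
  by apply: contraTneq (oner_neq0 C) => s0; rewrite -e s0 mul0r eqxx.
pose PL := dp (fun i => (i < b)%N); pose PG := dp (fun i => (b <= i)%N).
pose E := dp (fun i => (q < i)%N).
(* The product is [\det A] below; being a product of signs it is its own inverse, so it can be moved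
   to the other side. *)
exists (\det S * (\prod_(i < n) (if (b <= i <= q)%N then -1 else 1))).
  rewrite mulf_neq0 //; apply/prodf_neq0 => i _.
  by case: ifP; rewrite ?oppr_eq0 oner_eq0.
move=> M X W uM JW; have [/is_trig_mxP tM dM] := uM.
have PME : P *m (M *m E) = 0.
  apply/matrixP => i j; rewrite dplE [RHS]mxE; case: ifP => // bi.
  by rewrite dprE; case: ifP => // qj; rewrite tM //; lia.
have JPG : J *m PG = J.
  rewrite -{1}JP -mulmxA dpM (_ : dp _ = P) //; apply: dp_eq => i _ /=.
  by case: (b <= i)%N; rewrite ?andbF ?andbT.
have JPL : J *m PL = 0.
  rewrite -{1}JP -mulmxA dpM dp0 ?mulmx0 // => i _ /=.
  by apply/negP; lia.
set K := col_mx _ _.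
have KE : K = block_mx (PL + PG *m (M *m E)) (PG *m (M *m X)) J W.
  rewrite /K rowselE mul_mx_row !mul_mx_row mulmx0 mulmx1 add_row_mx add0r.
  by [].
(* After the exchange the big determinant is block triangular: the corner [A] is lower triangular,
   with identity rows before b, minus identity rows from b to q, and rows of M cut to the columns
   after q beyond. *)
pose A : 'M[C]_n := (1%:M - P) *m (PL + PG *m (M *m E)) - P.
have SK : S *m K = block_mx A ((1%:M - P) *m (PG *m (M *m X)) - J^T *m W) 0
                            (J *m M *m X + W).
  rewrite KE mulmx_block !mulNmx JJ; congr block_mx.
    rewrite mulmxDr JPL add0r !mulmxA JPG -JP -[J *m P *m M *m E]mulmxA -[J *m P *m (M *m E)]mulmxA PME.
    by rewrite mulmx0 add0r JP mulmxBl mul1mx -mulmxA JJ JP subrr.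
  by rewrite !mulmxA JPG mulmxBl mul1mx -(mulmxA J J^T) JW mulmx0 subr0.
have dA : \det A = \prod_(i < n) (if (b <= i <= q)%N then -1 else 1).
  have AE i j : A i j = if (b <= i <= q)%N then - (i == j)%:R
                        else if (i < b)%N then (i == j)%:R else if (q < j)%N then M i j else 0.
    have -> : A = PL + PG *m (M *m E) - P.
      rewrite /A mulmxBl mul1mx mulmxDr dpM.
      rewrite [X in _ - (X + _)]dp0 => [|k _ /=]; last by apply/negP; lia.
      rewrite add0r (mulmxA P PG) dpM [X in _ - X *m _](_ : _ = P) ?PME ?subr0 //.
      by apply: dp_eq => k _ /=; case: (b <= k)%N; rewrite ?andbF ?andbT.
    rewrite !addmxE oppmxE dplE dprE !mxE.
    case: (boolP (b <= i <= q)%N) => bi.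
      have -> : (i < b)%N = false by apply/negP; lia.
      have -> : (b <= i)%N by lia.
      rewrite andbF andbT add0r; case: ifP => qj; last by rewrite sub0r.
      by rewrite tM ?sub0r //; lia.
    rewrite andbF subr0; case: (boolP (i < b)%N) => ib.
      by rewrite (_ : (b <= i)%N = false) ?andbT ?addr0 //; apply/negP; lia.
    by rewrite (_ : (b <= i)%N) ?andbF ?add0r //; lia.
  rewrite det_trig; last first.
    apply/is_trig_mxP => i j ij; rewrite AE.
    have nij : (i == j) = false by apply/negP => /eqP e; move: ij; rewrite e ltnn.
    by rewrite nij oppr0; do 3?case: ifP => // _; apply: tM.
  apply: eq_bigr => i _; rewrite AE eqxx dM; case: ifP => // bi; case: ifP => // ib.
  by rewrite ifT //; lia.
have := congr1 determinant SK; rewrite det_mulmx det_ul_upper dA => e.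
rewrite mulrAC e mulrC mulrA -big_split big1 /= ?mul1r // => i _.
by case: ifP => _; rewrite ?mulrNN mulr1.
Qed.
End BlockDeterminants.

Section Partial.
Variables (C : fieldType) (n : nat).

Definition pinj (F : 'I_n -> 'I_n) (A : pred nat) : 'M[C]_n :=
  \matrix_(k, c) (A c && (k == F c))%:R.

Lemma pinj_trE F A p (X : 'M[C]_(n, p)) i j :
  ((pinj F A)^T *m X) i j = if A i then X (F i) j else 0.
Proof.
rewrite mxE (bigD1 (F i)) //= big1 ?addr0 => [|k ki]; rewrite !mxE.
  by rewrite eqxx andbT; case: (A i); rewrite ?mul1r ?mul0r.
by rewrite (negbTE ki) andbF mul0r.
Qed.

Lemma pinjE F A p (X : 'M[C]_(p, n)) i j :
  (X *m pinj F A) i j = if A j then X i (F j) else 0.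
Proof.
rewrite mxE (bigD1 (F j)) //= big1 ?addr0 => [|k ki]; rewrite !mxE.
  by rewrite eqxx andbT; case: (A j); rewrite ?mulr1 ?mulr0.
by rewrite (negbTE ki) andbF mulr0.
Qed.

Lemma pinj_img (F : 'I_n -> 'I_n) (A B : pred nat) :
  (forall c : 'I_n, A c -> B (F c)) -> (pinj F A)^T *m dp C n B = (pinj F A)^T.
Proof.
move=> AB; apply/matrixP => i j; rewrite dprE !mxE.
case Ai: (A i) => /=; last by case: ifP.
by case: eqP => [->|_]; [rewrite AB|case: ifP].
Qed.

Lemma pinj_mulT (F : 'I_n -> 'I_n) (A B : pred nat) : (forall c : 'I_n, A c -> B (F c)) ->
  (forall k : 'I_n, B k -> exists2 c : 'I_n, A c & F c = k) ->
  (forall c c' : 'I_n, A c -> A c' -> F c = F c' -> c = c') ->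
  pinj F A *m (pinj F A)^T = dp C n B.
Proof.
move=> AB BA inj; apply/matrixP => k l; rewrite mxE [RHS]mxE.
have [Bk|nBk] := boolP (B k); last first.
  rewrite andbF big1 // => c _; rewrite !mxE.
  case Ac: (A c); rewrite /= ?mul0r //; case: eqP => [e|_]; rewrite ?mul0r //.
  by case/negP: nBk; rewrite e AB.
have [c Ac Fc] := BA k Bk; rewrite andbT (bigD1 c) //= big1 ?addr0 => [|c' c'c].
  by rewrite !mxE Ac Fc eqxx /= mul1r eq_sym.
rewrite !mxE; case Ac': (A c'); rewrite /= ?mul0r //; case: eqP => [e|_]; rewrite ?mul0r //.
by case/eqP: c'c; apply: inj => //; rewrite -e Fc.
Qed.

(** The additional rows [Y] are carried along so that the enlargement can be repeated; each time the
    carried part grows by n rows. *)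
Lemma det_extend_rows_col d b q (J : 'M[C]_n) :
  let P := dp C n (fun i => (b <= i <= q)%N) in
  J *m P = J -> J^T *m J = P ->
  exists2 c, c != 0 & forall (M : 'M[C]_n) (X Z : 'M[C]_(n, n + d)) (Y : 'M[C]_(d, n + d)),
    unip_lower M -> J^T *m Z = 0 ->
    \det (col_mx (J *m M *m X + Z) Y) =
    c * \det (col_mx (rowsel b (row_mx 1%:M 0) (M *m row_mx (dp C n (fun i => (q < i)%N)) X))
                     (row_mx (col_mx J 0) (col_mx Z Y))).
Proof.
move=> P JP JJ; pose Jd : 'M[C]_(n + d, n) := col_mx J 0.
have JdP : Jd *m P = Jd by rewrite mul_col_mx JP mul0mx.
have JdT : Jd^T = row_mx J^T 0 by rewrite tr_col_mx trmx0.
have JdJd : Jd^T *m Jd = P by rewrite JdT mul_row_col JJ mul0mx addr0.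
have [c c0 H] := @det_extend_rows C n (n + d) b q Jd JdP JdJd.
exists c => // M X Z Y uM JZ; rewrite -H //; last first.
  by rewrite JdT mul_row_col JZ mul0mx addr0.
congr (\det _); rewrite /Jd !mul_col_mx !mul0mx add_col_mx add0r.
by [].
Qed.

(* Jacobi's complementary minors: the last rows of N are traded for the first
   columns of its inverse. *)
Lemma det_jacobi d a (N : 'M[C]_n) (X Z : 'M[C]_(n, n + d)) (Y : 'M[C]_(d, n + d)) :
  unip_lower N ->
  let PL := dp C n (fun i => (i < a)%N) in
  let PG := dp C n (fun i => (a <= i)%N) in
  \det (col_mx (rowsel a Z (N *m X)) Y) =
  \det (block_mx (PG + PL *m invmx N *m PL) (PL *m X)
        (col_mx (PG *m invmx N *m PL) 0) (col_mx (PL *m Z + PG *m X) Y)).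
Proof.
move=> uN PL PG; set K := block_mx _ _ _ _; have [/is_trig_mxP tN dN] := uN.
have Nu := unip_unit uN.
have PLG : PL + PG = 1%:M.
  rewrite dpD => [|i]; last by rewrite /= (leqNgt a) andbN.
  by apply: dp1 => i _ /=; case: ltnP.
have PLL : PL *m PL = PL by rewrite dpM; apply: dp_eq => i _ /=; rewrite andbb.
have PGG : PG *m PG = PG by rewrite dpM; apply: dp_eq => i _ /=; rewrite andbb.
have PL0 : PL *m PG = 0.
  by rewrite dpM; apply: dp0 => i _ /=; rewrite (leqNgt a) andbN.
have PG0 : PG *m PL = 0.
  by rewrite dpM; apply: dp0 => i _ /=; rewrite (leqNgt a) andNb.
have PN : PL *m N *m PG = 0.
  apply/matrixP => i j; rewrite dprE dplE mxE; case: ifP => // aj; case: ifP => // ia.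
  by rewrite tN //; lia.
have PNL : PL *m N *m PL = PL *m N.
  by rewrite -[RHS]mulmx1 -PLG mulmxDr PN addr0.
pose A := PG + PL *m N *m PL; pose D := PL + PG *m N *m PG.
(* Assembled from the blocks of [N] cut at a. It has determinant one and clears the blocks of N^-1
   from the first n columns of [K]. *)
pose L : 'M[C]_(n + (n + d)) :=
  block_mx A 0 (col_mx (PG *m N *m PL) 0) (block_mx D 0 0 1%:M).
have dA : \det A = 1.
  have AE i j : A i j = if (i < a)%N then if (j < a)%N then N i j else 0 else (i == j)%:R.
    rewrite /A addmxE dprE dplE !mxE (leqNgt a); case: (i < a)%N => /=.
      by rewrite andbF add0r; case: ifP.
    by rewrite andbT; case: ifP; rewrite addr0.
  rewrite det_trig; first by rewrite big1 // => i _; rewrite AE eqxx dN; case: (i < a)%N.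
  apply/is_trig_mxP => i j ij; rewrite AE tN //.
  by rewrite (_ : (i == j) = false) ?if_same //; apply/negP => /eqP e; move: ij; rewrite e ltnn.
have dD : \det D = 1.
  have DE i j : D i j = if (a <= i)%N then if (a <= j)%N then N i j else 0 else (i == j)%:R.
    rewrite /D addmxE dprE dplE !mxE (ltnNge i); case: (a <= i)%N => /=.
      by rewrite andbF add0r; case: ifP.
    by rewrite andbT; case: ifP; rewrite addr0.
  rewrite det_trig; first by rewrite big1 // => i _; rewrite DE eqxx dN; case: (a <= i)%N.
  apply/is_trig_mxP => i j ij; rewrite DE tN //.
  by rewrite (_ : (i == j) = false) ?if_same //; apply/negP => /eqP e; move: ij; rewrite e ltnn.
have dL : \det L = 1 by rewrite det_lblock dA mul1r det_lblock dD det1 mulr1.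
have LK : L *m K = block_mx 1%:M (A *m (PL *m X)) 0 (col_mx (rowsel a Z (N *m X)) Y).
  rewrite /L /K mulmx_block !mul0mx !addr0; congr block_mx.
  - rewrite /A mulmxDl !mulmxDr PGG !mulmxA PG0 !mul0mx addr0.
    rewrite -[PL *m N *m PL *m PG]mulmxA PL0 mulmx0 add0r.
    rewrite -[PL *m N *m PL *m PL]mulmxA PLL PNL mulmxK // PLL.
    by rewrite addrC.
  - rewrite mul_col_mx mul0mx mul_block_col !mul0mx mulmx0 add_col_mx !addr0.
    rewrite /D -[RHS](@col_mx0 _ n d n); congr col_mx.
    rewrite mulmxDr -[PG *m N *m PL *m PG]mulmxA PL0 mulmx0 add0r mulmxDl.
    rewrite !mulmxA PL0 !mul0mx add0r -[PG *m N *m PL *m PL]mulmxA PLL.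
    rewrite -[PG *m N *m PG *m PG]mulmxA PGG -!mulmxDl -mulmxDr PLG mulmx1.
    by rewrite -[PG *m N *m invmx N]mulmxA mulmxV // mulmx1 PG0.
  - rewrite mul_col_mx mul0mx mul_block_col !mul0mx mul1mx add_col_mx !addr0 !add0r.
    congr col_mx; rewrite /D rowselE -/PL -/PG mulmxDl !mulmxDr !mulmxA PLL PL0 mul0mx addr0.
    rewrite -[PG *m N *m PL *m PL]mulmxA PLL -[PG *m N *m PG *m PL]mulmxA PG0 mulmx0 mul0mx add0r.
    rewrite -[PG *m N *m PG *m PG]mulmxA PGG addrCA; congr (_ + _).
    by rewrite -mulmxDl -mulmxDr PLG mulmx1.
have := congr1 determinant LK; rewrite det_mulmx dL mul1r => ->.
by rewrite (det_ublock (1%:M : 'M_n)) det1 mul1r.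
Qed.

End Partial.

(** * One step along a gamma-string *)

Section Regularity.
Variables (C : numFieldType) (n : nat) (bd : BD_triple n).
Hypothesis n_gt0 : (0 < n)%N.
Local Notation g := (gam bd).
Local Notation tg := (tgamma bd).
Local Notation dp := (dp C n).
Implicit Types (M N : 'M[C]_n).

(* The connected component [p, q] of a simple root a in Gamma1. *)
Lemma component a : Gam1 bd a -> exists p q,
  [/\ (0 < p <= a)%N, (a <= q < n)%N, seg bd p.-1 q, ~~ Gam1 bd p.-1 & ~~ Gam1 bd q.+1].
Proof.
move=> Ga; have ra := G1_range Ga.
have [q [aq sq nq]] : exists q, [/\ (a <= q < n)%N, seg bd a.-1 q & ~~ Gam1 bd q.+1].
  suff H : forall m b, (n - b <= m)%N -> (a <= b < n)%N -> seg bd a.-1 b ->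
      exists q, [/\ (a <= q < n)%N, seg bd a.-1 q & ~~ Gam1 bd q.+1].
    apply: (H n a); [lia|lia|].
    by apply/segP => c cb; have -> : c = a by lia.
  elim=> [|m IH] b; first by lia.
  move=> bm ab s; have [Gb|nGb] := boolP (Gam1 bd b.+1); last by exists b.
  have := G1_range Gb => rb; apply: (IH b.+1); [lia|lia|].
  apply/segP => c cb; have [->//|cb'] := eqVneq c b.+1.
  by move/segP: s; apply; lia.
have [p [pa sp np]] : exists p, [/\ (0 < p <= a)%N, seg bd p.-1 a & ~~ Gam1 bd p.-1].
  suff H : forall b, (0 < b <= a)%N -> seg bd b.-1 a ->
      exists p, [/\ (0 < p <= a)%N, seg bd p.-1 a & ~~ Gam1 bd p.-1].
    apply: (H a); first by lia.
    by apply/segP => c cb; have -> : c = a by lia.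
  elim=> [|b IH]; first by lia.
  move=> ab s; have [Gb|nGb] := boolP (Gam1 bd b); last by exists b.+1.
  have := G1_range Gb => rb; apply: IH; first by lia.
  apply/segP => c cb; have [->//|cb'] := eqVneq c b.
  by move/segP: s; apply => /=; lia.
exists p, q; split=> //; apply/segP => c cpq.
have [ca|ac] := leqP c a; first by move/segP: sp; apply; lia.
by move/segP: sq; apply; lia.
Qed.

Lemma nstab r M : unip_lower M -> ~~ Gam1 bd r -> stab r (tg M).
Proof. by move=> uM nG; apply: tgamma_stab => // /(negP nG). Qed.

(** The index map made total on ordinals; the default value is met only where [f c] leaves the
    matrix. *)
Definition ford (f : nat -> nat) (c : 'I_n) : 'I_n := insubd c (f c).

Lemma fordE (f : nat -> nat) (c : 'I_n) : (f c < n)%N -> ford f c = f c :> nat.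
Proof. by move=> fc; rewrite val_insubd fc. Qed.

Lemma entry_ford (f f' : nat -> nat) (c c' : 'I_n) M : (f c < n)%N -> (f' c' < n)%N ->
  entry M (f c).+1 (f' c').+1 = M (ford f c) (ford f' c').
Proof. by move=> fc fc'; rewrite -entryE !fordE. Qed.

Section Component.
Variables (a p q : nat).
Hypothesis pa : (0 < p <= a)%N.
Hypothesis aq : (a <= q < n)%N.
Hypothesis spq : seg bd p.-1 q.
Hypothesis np : ~~ Gam1 bd p.-1.
Hypothesis nq : ~~ Gam1 bd q.+1.

Let Gc c : (p <= c <= q)%N -> Gam1 bd c.
Proof. by move=> pc; move/segP: spq; apply; lia. Qed.

Let gr c : (p <= c <= q)%N -> (0 < g c < n)%N.
Proof. by move=> /Gc/gam_G2/G2_range. Qed.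

Let sub j i : (p.-1 <= j)%N -> (i <= q)%N -> seg bd j i.
Proof. by move=> pj iq; apply/segP => c cji; apply: Gc; lia. Qed.

Section Increasing.
Hypothesis le : (g p <= g q)%N.
(** Roots p, ..., q occupy the 0-based matrix indices p - 1, ..., q, one more than their number; [f]
    extends gamma to p - 1 by g p - 1. *)
Let f c := (g p + c - p)%N.
Let blk c := (p.-1 <= c <= q)%N.
Let mid c := (a <= c <= q)%N.
Let F := ford f.

Let gE c : (p <= c <= q)%N -> g c = (g p + (c - p))%N.
Proof.
move=> pc; have p0 : p = p.-1.+1 by lia.
have := @seg_inc _ bd p.-1 q c _ spq; rewrite -p0 => -> //; lia.
Qed.

Let f_n c : blk c -> (f c < n)%N.
Proof.
rewrite /blk /f => bc; have := gE (c := q); have := gr (c := p); have := gr (c := q).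
by lia.
Qed.

Let FE (c : 'I_n) : blk c -> F c = f c :> nat.
Proof. by move=> bc; apply/fordE/f_n. Qed.

(** Since p - 1 is outside Gamma1, these rows of [tgamma M] have no entries to the left of the
    block, and inside it the formula for [tgamma] copies M. *)
Let inc_entry M (i c : 'I_n) : unip_lower M -> blk i ->
  tg M i c = if blk c then M (F i) (F c) else 0.
Proof.
move=> uM bi; have uN := tgamma_unip bd n_gt0 uM.
have [/is_trig_mxP tN dN] := uN; have [/is_trig_mxP tM dM] := uM.
case: ifP => bc; last first.
  have [ic|ci] := ltnP i c; first by rewrite tN.
  by rewrite (nstab uM np) //; move: bi bc; rewrite /blk; lia.
have [ic|ci|e] := ltngtP i c; last by rewrite (val_inj e) dN dM.
  rewrite tN // tM // !FE // /f; move: bi bc; rewrite /blk.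
  by have := gr (c := p); lia.
have [bi' bc'] : (p <= i <= q)%N /\ (p.-1 <= c <= q)%N by move: bi bc; rewrite /blk; lia.
rewrite tgamma_entry // rgn_inc //; last 2 first.
- by apply: sub; lia.
- by have := gE (c := c.+1); have := gE (c := i); lia.
have ei : g i = f i by rewrite gE // /f; have := gr (c := p); lia.
have ec : g c.+1 = (f c).+1 by rewrite gE /f; have := gr (c := p); lia.
rewrite ei ec entry_ford ?f_n // -/F addmxE oppmxE [1%:M _ _]mxE.
rewrite (_ : (F i == F c) = false) ?subr0 //.
apply/negP => /eqP /(congr1 val) /=; rewrite !FE // /f.
by have := gr (c := p); lia.
Qed.

(** Rows a, ..., q of [tgamma M] are rows g a, ..., g q of M with relabelled columns, and the rows
    after q split off; the determinant is then enlarged to one that contains M from row g a on. *)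
Lemma det_step_inc d : exists2 c, c != 0 &
  forall M (X Z : 'M[C]_(n, n + d)) (Y : 'M[C]_(d, n + d)), unip_lower M ->
    \det (col_mx (rowsel a Z (tg M *m X)) Y) =
    c * \det (col_mx
          (rowsel (g a) (row_mx 1%:M 0)
             (M *m row_mx (dp (fun i => (g q < i)%N)) (pinj C F blk *m X)))
          (row_mx (col_mx (pinj C F mid)^T 0)
             (col_mx (dp (fun i => (i < a)%N) *m Z + dp (fun i => (q < i)%N) *m X) Y))).
Proof.
have blk_mid c : mid c -> blk c by rewrite /mid /blk; lia.
have ga : g a = f a by rewrite gE /f; have := gr (c := p); lia.
have gq : g q = f q by rewrite gE /f; have := gr (c := p); lia.
have JP : (pinj C F mid)^T *m dp (fun i => (g a <= i <= g q)%N) = (pinj C F mid)^T.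
  apply: pinj_img => c mc; rewrite FE ?blk_mid // ga gq /f; move: mc; rewrite /mid; lia.
have JJ : (pinj C F mid)^T^T *m (pinj C F mid)^T = dp (fun i => (g a <= i <= g q)%N).
  rewrite trmxK; apply: pinj_mulT => [c mc|k kb|c c' mc mc' e].
  - by rewrite FE ?blk_mid // ga gq /f; move: mc; rewrite /mid; lia.
  - have cn : (k + p - g p < n)%N by move: kb; rewrite ga gq /f; have := gr (c := p); lia.
    have mc : mid (Ordinal cn) by move: kb; rewrite /mid ga gq /f /=; have := gr (c := p); lia.
    exists (Ordinal cn) => //; apply: val_inj; rewrite /= FE ?blk_mid //=.
    by move: kb; rewrite ga gq /f; have := gr (c := p); lia.
  - apply: val_inj; have := congr1 val e; rewrite /= !FE ?blk_mid // /f.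
    by move: mc mc'; rewrite /mid; have := gr (c := p); lia.
have [c c0 H] := det_extend_rows_col d JP JJ.
exists c => // M X Z Y uM; set Z1 := dp _ *m Z + _.
have uN := tgamma_unip bd n_gt0 uM.
rewrite -H //; last first.
  apply/matrixP => i j; rewrite trmxK mxE [RHS]mxE big1 // => k _.
  rewrite mxE /Z1 addmxE !dplE; case mk: (mid k) => /=; last by rewrite mul0r.
  rewrite ifF; last by apply/negP; move: mk; rewrite /mid; lia.
  rewrite ifF; last by apply/negP; move: mk; rewrite /mid; lia.
  by rewrite addr0 mulr0.
(* As q + 1 is outside Gamma1, the rows of [tgamma M] after q involve only the columns after q, and
   form a unipotent factor. *)
pose L : 'M[C]_(n + d) := block_mx (rowsel q.+1 1%:M (tg M)) 0 0 1%:M.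
have dL : \det L = 1 by rewrite det_lblock det1 mulr1 -/(tdet q.+1 (tg M)) tdet_unip.
rewrite -[RHS]mul1r -dL -det_mulmx; congr (\det _).
rewrite /L mul_block_col !mul0mx mul1mx add0r addr0; congr col_mx.
apply/matrixP => i j; rewrite mxE [RHS]mxE.
have [iq|qi] := leqP i q.
  rewrite (bigD1 i) //= big1 ?addr0 => [|k ki]; last first.
    by rewrite !mxE ltnS iq eq_sym (negbTE ki) mul0r.
  rewrite [rowsel _ _ _ i i]mxE ltnS iq [1%:M i i]mxE eqxx mul1r addmxE /Z1 addmxE !dplE.
  rewrite [X in _ + (_ + X)]ifF; last by apply/negP; lia.
  rewrite addr0 -!mulmxA pinj_trE; have [ia|ai] := ltnP i a.
    by rewrite ifF ?add0r //; apply/negP; rewrite /mid; lia.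
  have mi : mid i by rewrite /mid ai.
  rewrite mi addr0 mulmxA mxE [RHS]mxE; apply: eq_bigr => k _.
  by rewrite pinjE inc_entry //; apply: blk_mid.
rewrite ifF; last by apply/negP; lia.
rewrite mxE; apply: eq_bigr => k _; rewrite [rowsel _ _ _ _ _]mxE ltnS leqNgt qi /=.
have [kq|qk] := leqP k q; first by rewrite (nstab uM nq) ?mul0r //; lia.
congr (_ * _); rewrite addmxE /Z1 addmxE !dplE qk -mulmxA pinj_trE.
rewrite ifF; last by apply/negP; rewrite /mid; lia.
by rewrite ifF ?add0r //; apply/negP; lia.
Qed.

End Increasing.

Section Decreasing.
Hypothesis le : (g q <= g p)%N.
(** The reflection of the block: it sends p - 1 to g p and a - 1 to g a, so here the indices before
    a are the ones mapped onto g a, ..., g p. *)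
Let f c := (g p + p.-1 - c)%N.
Let blk c := (p.-1 <= c <= q)%N.
Let mid c := (p.-1 <= c < a)%N.
Let F := ford f.
Let sg : 'M[C]_n := \matrix_(i, j) ((-1) ^+ i *+ (i == j)).

Let gE c : (p <= c <= q)%N -> (g c + (c - p) = g p)%N.
Proof.
move=> pc; have p0 : p = p.-1.+1 by lia.
have := @seg_dec _ bd p.-1 q c _ spq; rewrite -p0 => -> //; lia.
Qed.

Let f_n c : blk c -> (f c < n)%N.
Proof.
rewrite /blk /f => bc; have := gE (c := q); have := gr (c := p); have := gr (c := q).
by lia.
Qed.

Let FE (c : 'I_n) : blk c -> F c = f c :> nat.
Proof. by move=> bc; apply/fordE/f_n. Qed.

(** The inverse of [tgamma M] is [tgamma] of M^-1, whose reversed block copies the inverse of M^-1,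
    that is M, up to transposition and signs. *)
Let dec_entry M (i c : 'I_n) : unip_lower M -> blk i ->
  invmx (tg M) c i = (-1) ^+ i * (if blk c then M (F i) (F c) else 0) * (-1) ^+ c.
Proof.
move=> uM bi; have uN := tgamma_unip bd n_gt0 uM; have uV := unip_inv uM.
rewrite -tgammaV //.
have [/is_trig_mxP tN dN] := tgamma_unip bd n_gt0 uV; have [/is_trig_mxP tM dM] := uM.
case: ifP => bc; last first.
  rewrite mulr0 mul0r; have [ci|ic] := ltnP c i; first by rewrite tN.
  by rewrite (nstab uV nq) //; move: bi bc; rewrite /blk; lia.
have [ci|ic|e] := ltngtP c i; last first.
- by rewrite (val_inj e) dN dM mulr1 -expr2 sqrr_sign.
- have [bi' bc'] : (p.-1 <= i < q)%N /\ (p <= c <= q)%N by move: bi bc; rewrite /blk; lia.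
  rewrite tgamma_entry // rgn_dec //; last 3 first.
  + by apply: sub; lia.
  + by have := gE (c := c); have := gE (c := i.+1); lia.
  + exact: unip_consistent.
  have ei : g i.+1 = f i by rewrite /f; have := gE (c := i.+1); lia.
  have ec : g c = (f c).+1.
    by rewrite /f; have := gE (c := c); have := gr (c := c); lia.
  rewrite ei ec entry_ford ?f_n // -/F invmxK addmxE oppmxE [1%:M _ _]mxE.
  rewrite (_ : (F i == F c) = false) ?subr0; last first.
    apply/negP => /eqP /(congr1 val) /=; rewrite !FE // /f.
    by have := gE (c := c); lia.
  rewrite mulrAC -exprD; congr (_ * _).
  by rewrite -signr_odd -[in RHS]signr_odd oddB ?oddD; [rewrite addbC|lia].
rewrite tN // tM ?mulr0 ?mul0r // !FE // /f.
by have := gE (c := i); have := gr (c := i); move: bi bc; rewrite /blk; lia.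
Qed.

(** Reversal maps the rows of the block from a on to rows before g a, the wrong side for a trailing
    minor. The complementary minor of the inverse uses the indices before a instead, and [dec_entry]
    identifies these with rows g a, ..., g p of M. *)
Lemma det_step_dec d : exists2 c, c != 0 &
  forall M (X Z : 'M[C]_(n, n + d)) (Y : 'M[C]_(d, n + d)), unip_lower M ->
    let PL := dp (fun i => (i < a)%N) in
    let PG := dp (fun i => (a <= i)%N) in
    let X3 : 'M[C]_(n, n + (n + d)) := row_mx PL (row_mx PG 0) in
    let Z3 : 'M[C]_(n, n + (n + d)) := row_mx 1%:M 0 in
    \det (col_mx (rowsel a Z (tg M *m X)) Y) =
    c * \det (col_mx
          (rowsel (g a) (row_mx 1%:M 0)
             (M *m row_mx (dp (fun i => (g p < i)%N)) (pinj C F blk *m (sg *m X3))))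
          (row_mx (col_mx (sg *m (pinj C F mid)^T) 0)
             (col_mx (PG *m Z3 + dp (fun i => (i < p.-1)%N) *m X3)
                (row_mx (PL *m X)^T (col_mx (PL *m Z + PG *m X) Y)^T)))).
Proof.
have blk_mid c : mid c -> blk c by rewrite /mid /blk; lia.
have ga : g a = f a.-1 by rewrite /f; have := gE (c := a); lia.
have gp : g p = f p.-1 by rewrite /f; lia.
have JP : (pinj C F mid)^T *m dp (fun i => (g a <= i <= g p)%N) = (pinj C F mid)^T.
  apply: pinj_img => c mc; rewrite FE ?blk_mid // ga gp /f; move: mc; rewrite /mid; lia.
have JJ : pinj C F mid *m (pinj C F mid)^T = dp (fun i => (g a <= i <= g p)%N).
  apply: pinj_mulT => [c mc|k kb|c c' mc mc' e].
  - by rewrite FE ?blk_mid // ga gp /f; move: mc; rewrite /mid; lia.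
  - have ga0 := gE (c := a).
    have cn : (g p + p.-1 - k < n)%N by move: kb; rewrite ga gp /f; lia.
    have mc : mid (Ordinal cn) by move: kb ga gp; rewrite /mid /f /=; lia.
    exists (Ordinal cn) => //; apply: val_inj; rewrite /= FE ?blk_mid //=.
    by move: kb ga gp; rewrite /f; lia.
  - apply: val_inj; have := congr1 val e; rewrite /= !FE ?blk_mid // /f.
    by have := gE (c := a); move: mc mc'; rewrite /mid; lia.
have sgE k (A : 'M[C]_(n, k)) i j : (sg *m A) i j = (-1) ^+ i * A i j.
  rewrite mxE (bigD1 i) //= big1 ?addr0 => [|l li]; rewrite mxE.
    by rewrite eqxx mulr1n.
  by rewrite eq_sym (negbTE li) mulr0n mul0r.
have sgT : sg^T = sg.
  by apply/matrixP => i j; rewrite !mxE eq_sym; case: eqP => // ->.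
have sg2 : sg *m sg = 1%:M.
  apply/matrixP => i j; rewrite sgE !mxE; case: eqP => [e|_]; last by rewrite mulr0.
  by rewrite mulr1n -expr2 sqrr_sign.
have JP' : sg *m (pinj C F mid)^T *m dp (fun i => (g a <= i <= g p)%N) = sg *m (pinj C F mid)^T.
  by rewrite -mulmxA JP.
have JJ' : (sg *m (pinj C F mid)^T)^T *m (sg *m (pinj C F mid)^T) =
    dp (fun i => (g a <= i <= g p)%N).
  by rewrite trmx_mul trmxK sgT mulmxA -[pinj C F mid *m sg *m sg]mulmxA sg2 mulmx1.
have [c c0 H] := det_extend_rows_col (n + d) JP' JJ'.
exists c => // M X Z Y uM PL PG X3 Z3; set Z1 := PG *m Z3 + _; set Y3 := row_mx _ _.
have uN := tgamma_unip bd n_gt0 uM.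
rewrite -H //; last first.
  rewrite trmx_mul trmxK sgT -mulmxA; apply/matrixP => i j.
  rewrite mxE [RHS]mxE big1 // => k _.
  rewrite mxE sgE /Z1 addmxE !dplE; case mk: (mid k) => /=; last by rewrite mul0r.
  rewrite ifF; last by apply/negP; move: mk; rewrite /mid; lia.
  rewrite ifF; last by apply/negP; move: mk; rewrite /mid; lia.
  by rewrite addr0 !mulr0.
(* The complementary minor involves columns of the inverse; transposing makes them rows, to which
   the enlargement applies. *)
rewrite (det_jacobi a X Z Y uN) -/PL -/PG -det_tr.
pose V := (invmx (tg M))^T.
pose L : 'M[C]_(n + (n + d)) := block_mx (rowsel p.-1 V 1%:M) 0 0 1%:M.
have dL : \det L = 1.
  rewrite det_lblock det1 mulr1 -det_tr det_trig.
    rewrite big1 // => i _; rewrite !mxE eqxx; have [_ ->] := unip_inv uN.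
    by case: ifP.
  apply/is_trig_mxP => i j ij; rewrite !mxE; have [/is_trig_mxP tV _] := unip_inv uN.
  case: ifP => _; first by rewrite tV.
  by rewrite -val_eqE; case: eqP => //= e; lia.
rewrite -[RHS]mul1r -dL -det_mulmx; congr (\det _).
rewrite tr_block_mx /block_mx -/Y3.
have -> : (col_mx (PL *m Z + PG *m X) Y)^T = (col_mx (PL *m Z + PG *m X) Y)^T by [].
rewrite /L mul_block_col !mul0mx mul1mx add0r addr0; congr col_mx.
have PLT : PL^T = PL by rewrite tr_dp.
have PGT : PG^T = PG by rewrite tr_dp.
rewrite linearD /= tr_col_mx !trmx_mul PLT PGT trmx0 -/V.
rewrite !mulmxA.
have -> : row_mx (PG + PL *m V *m PL) (row_mx (PL *m V *m PG) 0) =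
    PG *m Z3 + PL *m V *m X3.
  by rewrite /Z3 /X3 !mul_mx_row !mulmx0 mulmx1 add_row_mx add0r.
apply/matrixP => i j; rewrite [RHS]mxE addmxE -mulmxA !dplE.
have [pi|ip] := leqP p.-1 i.
  rewrite [RHS](bigD1 i) //= big1 ?addr0 => [|k ki]; last first.
    by rewrite !mxE (leq_gtF pi) eq_sym (negbTE ki) mul0r.
  rewrite [rowsel _ _ _ _ _]mxE (leq_gtF pi) [1%:M i i]mxE eqxx mul1r addmxE /Z1 addmxE !dplE.
  rewrite [X in _ = _ + (_ + X)]ifF; last by apply/negP; lia.
  rewrite addr0 -!mulmxA sgE pinj_trE; have [ia|ai] := ltnP i a; last first.
    by rewrite ifF ?mulr0 ?add0r ?addr0 //; apply/negP; rewrite /mid; lia.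
  have mi : mid i by rewrite /mid pi.
  rewrite mi addr0 add0r mulmxA !mxE mulr_sumr; apply: eq_bigr => k _.
  by rewrite pinjE sgE mxE dec_entry ?(blk_mid _ mi) // !mulrA.
have ia : (i < a)%N by lia.
rewrite (leqNgt a) ia /= add0r mxE; apply: eq_bigr => k _.
rewrite [rowsel _ _ _ _ _]mxE ip.
have [kp|pk] := ltnP k p.-1; last first.
  by rewrite mxE (stab_inv uN (nstab uM np)) ?mul0r.
congr (_ * _); rewrite addmxE /Z1 addmxE !dplE kp -!mulmxA sgE pinj_trE.
rewrite ifF; last by apply/negP; rewrite /mid; lia.
by rewrite ifF ?mulr0 ?add0r //; apply/negP; lia.
Qed.

End Decreasing.

End Component.
End Regularity.

(** * Polynomiality of products along strings *)

Section TrailingPolynomials.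
Variables (C : numFieldType) (n : nat) (bd : BD_triple n).
Hypothesis n_gt0 : (0 < n)%N.
Local Notation g := (gam bd).
Local Notation tg := (tgamma bd).
Local Notation F := (@Fmap C n bd).
Local Notation poly := (@polyfun C n).

Lemma rowsel_stab p r (W : 'M[C]_n) (Z A : 'M[C]_(n, p)) : stab r W ->
  rowsel r Z (W *m A) = rowsel r 1%:M W *m rowsel r Z A.
Proof.
move=> sW; apply/matrixP => k m; rewrite !mxE; case: ifP => kr.
  rewrite (bigD1 k) //= big1 => [|l lk]; first by rewrite !mxE kr eqxx mul1r addr0.
  by rewrite !mxE kr eq_sym (negbTE lk) mul0r.
apply: eq_bigr => l _; rewrite !mxE kr; case: ifP => // lr.
by rewrite sW ?mul0r //; move: kr lr; lia.
Qed.

Lemma det_rowsel_stab d r (W : 'M[C]_n) (Z A : 'M[C]_(n, n + d)) (Y : 'M[C]_(d, n + d)) :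
  stab r W ->
  \det (col_mx (rowsel r Z (W *m A)) Y) = tdet r W * \det (col_mx (rowsel r Z A) Y).
Proof.
move=> sW; rewrite rowsel_stab //.
have -> : col_mx (rowsel r 1%:M W *m rowsel r Z A) Y =
    block_mx (rowsel r 1%:M W) 0 0 1%:M *m col_mx (rowsel r Z A) Y.
  by rewrite mul_block_col !mul0mx mul1mx addr0 add0r.
by rewrite det_mulmx det_lblock det1 mulr1.
Qed.

Lemma S_mx_rowsel (T : Type) (S : (T -> C) -> Prop) p r (Z A : T -> 'M[C]_(n, p)) :
  S_mx S Z -> S_mx S A -> S_mx S (fun x => rowsel r (Z x) (A x)).
Proof.
move=> SZ SA i j; have [ir|ri] := boolP (i < r)%N.
  by apply: (S_ext (SZ i j)) => x; rewrite mxE ir.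
by apply: (S_ext (SA i j)) => x; rewrite mxE (negbTE ri).
Qed.

Lemma det_step a d : Gam1 bd a -> exists c d',
  forall (X Z : 'M[C]_n -> 'M[C]_(n, n + d)) (Y : 'M[C]_n -> 'M[C]_(d, n + d)),
  S_mx poly X -> S_mx poly Z -> S_mx poly Y ->
  exists (X' Z' : 'M[C]_n -> 'M[C]_(n, n + d')) (Y' : 'M[C]_n -> 'M[C]_(d', n + d')),
    [/\ S_mx poly X', S_mx poly Z', S_mx poly Y' &
      forall U M, unip_lower M ->
        \det (col_mx (rowsel a (Z U) (tg M *m X U)) (Y U)) =
        c * \det (col_mx (rowsel (g a) (Z' U) (M *m X' U)) (Y' U))].
Proof.
move=> Ga; have [p [q [pa aq spq np nq]]] := component n_gt0 Ga.
have SR := polyfun_funring C n.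
have cst m1 m2 (A : 'M[C]_(m1, m2)) : S_mx poly (fun=> A) by apply: S_mx_cst.
have [le|lt] := leqP (g p) (g q).
  have [c _ H] := @det_step_inc C n bd n_gt0 a p q pa aq spq np nq le d.
  exists c, (n + d)%N => X Z Y PX PZ PY; do 3!eexists; split; last first.
    by move=> U M uM; rewrite H.
  - by do ![apply: S_mx_row|apply: S_mx_col|apply: S_mx_add|apply: S_mx_mul|exact: cst|assumption].
  - exact: cst.
  - by do ![apply: S_mx_row|apply: S_mx_mul|exact: cst|assumption].
have [c _ H] := @det_step_dec C n bd n_gt0 a p q pa aq spq np nq (ltnW lt) d.
exists c, (n + (n + d))%N => X Z Y PX PZ PY; do 3!eexists; split; last first.
  by move=> U M uM; rewrite H.
- by do ![apply: S_mx_row|apply: S_mx_col|apply: S_mx_add|apply: S_mx_tr|apply: S_mx_mul|exact: cst|assumption].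
- exact: cst.
- by do ![apply: S_mx_row|apply: S_mx_mul|exact: cst|assumption].
Qed.

(** End of a string: in F(U) = [tgamma] (F(U)_-) U the unipotent factor preserves the parabolic of
    a, so F(U) may be replaced by U in the determinant. *)
Lemma trailing_poly0 a d (X Z : 'M[C]_n -> 'M[C]_(n, n + d)) (Y : 'M[C]_n -> 'M[C]_(d, n + d)) :
  (0 < a < n)%N -> ~~ Gam1 bd a -> S_mx poly X -> S_mx poly Z -> S_mx poly Y ->
  exists2 h, poly h & forall U, goodF bd U ->
    \det (col_mx (rowsel a (Z U) (F U *m X U)) (Y U)) *
    \prod_(1 <= t < (steps bd a).+1) tdet (iter t g a) (F U) = h U.
Proof.
move=> ra nGa PX PZ PY; have SR := polyfun_funring C n.
exists (fun U => \det (col_mx (rowsel a (Z U) (U *m X U)) (Y U))).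
  apply: (S_det SR); apply: S_mx_col => //; apply: S_mx_rowsel => //.
  by apply: S_mx_mul => //; apply: polyfun_mx.
move=> U gU; rewrite steps0 //; last by case/andP: ra.
rewrite big_geq // mulr1 Fmap_eq // -mulmxA.
have uL := low_part_unip (F U).
have uN := tgamma_unip bd n_gt0 uL.
rewrite [LHS]det_rowsel_stab; last exact: (nstab n_gt0 uL nGa).
by rewrite (tdet_unip _ uN) mul1r.
Qed.

(** Writing F(U) = [tgamma] (F(U)_-) U, [det_step] passes to a determinant in F(U)_- at gamma(a).
    Turning F(U)_- into F(U) = W F(U)_- costs the trailing minor of W at gamma(a), which is that of
    F(U): exactly the next factor of the product along the string. Induction on the remaining steps
    applies. *)
Lemma trailing_poly a d (X Z : 'M[C]_n -> 'M[C]_(n, n + d)) (Y : 'M[C]_n -> 'M[C]_(d, n + d)) :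
  (0 < a < n)%N -> S_mx poly X -> S_mx poly Z -> S_mx poly Y ->
  exists2 h, poly h & forall U, goodF bd U ->
    \det (col_mx (rowsel a (Z U) (F U *m X U)) (Y U)) *
    \prod_(1 <= t < (steps bd a).+1) tdet (iter t g a) (F U) = h U.
Proof.
have SR := polyfun_funring C n.
move: {2}(steps bd a) (leqnn (steps bd a)) => s.
elim: s a d X Z Y => [|s IH] a d X Z Y sa ra PX PZ PY; have a0 : (0 < a)%N by lia.
  apply: trailing_poly0 => //; apply/negP => Ga.
  by move: sa; rewrite stepsS.
have PUX : S_mx poly (fun U => U *m X U) by apply: S_mx_mul => //; apply: polyfun_mx.
have [Ga|nGa] := boolP (Gam1 bd a); last exact: trailing_poly0.
have [c [d' H]] := det_step d Ga.
have [X' [Z' [Y' [PX' PZ' PY' {}H]]]] := H _ _ _ PUX PZ PY.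
have rg := G2_range (gam_G2 Ga).
have sg : (steps bd (g a) <= s)%N by move: sa; rewrite stepsS.
have [h Ph hE] := IH (g a) d' X' Z' Y' sg rg PX' PZ' PY'.
exists (fun U => c * h U); first by apply: (S_mul SR) => //; apply: (S_cst SR).
move=> U gU; rewrite -hE // {1}Fmap_eq // -mulmxA H; last exact: low_part_unip.
have [W lu] := low_partP (Fmap_factorable n_gt0 gU); have [uW _ FE] := lu.
(* The upper triangular factor of F(U) comes out as a trailing minor, absorbed below by the first
   factor of the product. *)
have e : \det (col_mx (rowsel (g a) (Z' U) (F U *m X' U)) (Y' U)) =
    tdet (g a) W * \det (col_mx (rowsel (g a) (Z' U) (low_part (F U) *m X' U)) (Y' U)).
  by rewrite {1}FE -mulmxA [LHS]det_rowsel_stab //; apply: stab_upper.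
rewrite e stepsS // big_ltn // big_add1 /= (tdet_lu _ lu).
rewrite -!mulrA; congr (_ * _); rewrite mulrCA; congr (_ * (_ * _)).
by apply: eq_bigr => t _; rewrite -iterSr.
Qed.

(** The matrix A serves two purposes: A = 1 gives the marked variables, a column replacement gives
    the numerators in Cramer's rule for the unipotent factor of F(U). *)
Lemma trailing_polyM a (A : 'M[C]_n) : (0 < a < n)%N ->
  exists2 h, poly h & forall U, goodF bd U ->
    tdet a (F U *m A) * \prod_(1 <= t < (steps bd a).+1) tdet (iter t g a) (F U) = h U.
Proof.
move=> ra; have SR := polyfun_funring C n.
have [h Ph hE] := @trailing_poly a 0 (fun=> row_mx A 0) (fun=> row_mx 1%:M 0)
  (fun=> row_mx 0 1%:M) ra (S_mx_cst SR _) (S_mx_cst SR _) (S_mx_cst SR _).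
exists h => // U gU; rewrite -hE //; congr (_ * _).
rewrite mul_mx_row mulmx0.
have -> : rowsel a (row_mx 1%:M 0) (row_mx (F U *m A) 0) =
    row_mx (rowsel a 1%:M (F U *m A)) (0 : 'M_(n, 0)).
  by rewrite !rowselE !mul_mx_row !mulmx0 add_row_mx addr0.
by rewrite [RHS](det_lblock (rowsel a 1%:M (F U *m A)) 0 1%:M) det1 mulr1.
Qed.

Lemma colrepE (i j : 'I_n) (X : 'M[C]_n) : colrep i j X = X *m colrep i j 1%:M.
Proof.
apply/matrixP => k l; rewrite !mxE (bigD1 (if l == i then j else l)) //= big1 ?addr0 => [|m mj].
  by rewrite !mxE eqxx mulr1.
by rewrite !mxE (negbTE mj) mulr0.
Qed.

End TrailingPolynomials.

(** * The isomorphism of localizations *)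

Section Localization.
Variables (C : numFieldType) (n : nat) (G : group_kind).
Hypothesis n_gt0 : (0 < n)%N.
Implicit Types (f : 'M[C]_n -> C) (U : 'M[C]_n).

Lemma group_det_neq0 U : in_group G U -> \det U != 0.
Proof. by move/in_group_unit; rewrite unitmxE unitfE. Qed.

Lemma generically_eq f f' (P : 'M[C]_n -> Prop) : generically G P ->
  (forall U, in_group G U -> P U -> f U = f' U) -> eq_rat G f f'.
Proof. by move=> gP H; apply: generically_mono gP. Qed.

Lemma regular_funring : funring (regular_fun G : ('M[C]_n -> C) -> Prop).
Proof.
split=> [c|f f' [p [e fE]] [p' [e' fE']]|f f' [p [e fE]] [p' [e' fE']]].
- exists c%:MP_[n * n], 0%N; apply: generically_all => // U _.
  by rewrite peval_cst expr0 divr1.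
- have [d dE] := @polyfun_det C n.
  exists (p * d ^+ e' + p' * d ^+ e), (e + e')%N.
  apply: generically_eq (generically_and n_gt0 fE fE') _ => U GU [-> ->].
  have d0 := group_det_neq0 GU; have pX k : peval (d ^+ k) U = \det U ^+ k.
    elim: k => [|k IH]; first by rewrite !expr0 -mpolyC1 peval_cst.
    by rewrite !exprS pevalM IH -dE.
  rewrite pevalD !pevalM !pX exprD; move: (expf_neq0 e d0) (expf_neq0 e' d0).
  by move: (\det U ^+ e) (\det U ^+ e') => x y x0 y0; field; rewrite ?x0 ?y0.
- exists (p * p'), (e + e')%N.
  apply: generically_eq (generically_and n_gt0 fE fE') _ => U GU [-> ->].
  have d0 := group_det_neq0 GU.
  rewrite pevalM exprD; move: (expf_neq0 e d0) (expf_neq0 e' d0).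
  by move: (\det U ^+ e) (\det U ^+ e') => x y x0 y0; field; rewrite ?x0 ?y0.
Qed.

Lemma regular_poly f : polyfun f -> regular_fun G f.
Proof.
move=> [p fp]; exists p, 0%N; apply: generically_all => // U _.
by rewrite fp expr0 divr1.
Qed.

Lemma regular_eq f f' : regular_fun G f -> eq_rat G f f' -> regular_fun G f'.
Proof.
move=> [p [e fE]] ff'; exists p, e.
by apply: generically_eq (generically_and n_gt0 fE ff') _ => U _ [<- <-].
Qed.

Section Ring.
Variables (I : eqType) (r : seq I) (gf : I -> 'M[C]_n -> C).
Hypothesis reg : forall i, i \in r -> regular_fun G (gf i).
Hypothesis nz : forall i, i \in r -> generically G (fun U => gf i U != 0).
Local Notation loc := (in_localization G [seq gf i | i <- r]).

Let P U := \prod_(i <- r) gf i U.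

Let PE U : \prod_(g <- [seq gf i | i <- r]) g U = P U.
Proof. by rewrite big_map. Qed.

Let P_neq0 : generically G (fun U => P U != 0).
Proof.
apply: generically_mono (generically_in n_gt0 nz) => U _ H.
by rewrite prodf_seq_neq0; apply/allP => i /H ->.
Qed.

Let P_reg : regular_fun G P.
Proof. by apply: S_prod_seq => //; apply: regular_funring. Qed.

Lemma loc_eq f f' : loc f -> eq_rat G f f' -> loc f'.
Proof.
move=> [a [e [ra fE]]] ff'; exists a, e; split=> //.
by apply: generically_mono (generically_and n_gt0 fE ff') => U _ [<- <-].
Qed.

Lemma loc_regular f : regular_fun G f -> loc f.
Proof.
move=> rf; exists f, 0%N; split=> //; apply: generically_all => // U _.
by rewrite expr0 divr1.
Qed.

Lemma loc_funring : funring loc.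
Proof.
have SR := regular_funring.
split=> [c|f f' [a [e [ra fE]]] [a' [e' [ra' fE']]]|f f' [a [e [ra fE]]] [a' [e' [ra' fE']]]].
- exact/loc_regular/(S_cst SR).
- exists (fun U => a U * P U ^+ e' + a' U * P U ^+ e), (e + e')%N; split.
    by apply: (S_add SR); apply: (S_mul SR) => //; apply: (S_exp SR).
  apply: generically_mono (generically_and n_gt0 (generically_and n_gt0 fE fE') P_neq0).
  move=> U GU [[-> ->] P0]; rewrite !PE exprD; move: (expf_neq0 e P0) (expf_neq0 e' P0).
  by move: (P U ^+ e) (P U ^+ e') => x y x0 y0; field; rewrite ?x0 ?y0.
- exists (fun U => a U * a' U), (e + e')%N; split; first exact: (S_mul SR).
  apply: generically_mono (generically_and n_gt0 (generically_and n_gt0 fE fE') P_neq0).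
  move=> U GU [[-> ->] P0]; rewrite !PE exprD; move: (expf_neq0 e P0) (expf_neq0 e' P0).
  by move: (P U ^+ e) (P U ^+ e') => x y x0 y0; field; rewrite ?x0 ?y0.
Qed.

Lemma loc_inv i : i \in r -> loc (fun U => (gf i U)^-1).
Proof.
move=> ir; exists (fun U => \prod_(j <- rem i r) gf j U), 1%N; split.
  by apply: S_prod_seq => [|j /mem_rem]; [exact: regular_funring|exact: reg].
apply: generically_mono P_neq0 => U _; rewrite PE expr1 /P (big_rem i) //= mulf_eq0 negb_or.
by move=> /andP[g0 R0]; field; rewrite ?g0 ?R0.
Qed.

Lemma loc_det_inv : loc (fun U => (\det U)^-1).
Proof.
apply: loc_regular; exists 1, 1%N; apply: generically_all => // U _.
by rewrite -mpolyC1 peval_cst mul1r expr1.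
Qed.

End Ring.

(** It is enough to control the entries of Q and the inverses of the pulled-back generators;
    invariance of the determinant takes care of its inverse. *)
Lemma loc_pullback (I I' : eqType) (r : seq I) (gf : I -> 'M[C]_n -> C)
    (r' : seq I') (gf' : I' -> 'M[C]_n -> C) (Q : 'M[C]_n -> 'M[C]_n) f :
  (forall i, i \in r' -> regular_fun G (gf' i)) ->
  (forall i, i \in r' -> generically G (fun U => gf' i U != 0)) ->
  dominant G Q -> (forall U, \det (Q U) = \det U) ->
  S_mx (in_localization G [seq gf' i | i <- r']) Q ->
  (forall i, i \in r -> in_localization G [seq gf' i | i <- r'] (fun U => (gf i (Q U))^-1)) ->
  in_localization G [seq gf i | i <- r] f ->
  in_localization G [seq gf' i | i <- r'] (pullback Q f).
Proof.
move=> reg nz dQ detQ SQ SV [a [e [[p [k aE]] fE]]].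
have SR := loc_funring reg nz.
have S1 : in_localization G [seq gf' i | i <- r'] (fun U => peval p (Q U) *
    ((\det U)^-1) ^+ k * (\prod_(i <- r) (gf i (Q U))^-1) ^+ e).
  apply: (S_mul SR); first apply: (S_mul SR).
  - exact: peval_comp.
  - by apply: (S_exp SR); apply: loc_det_inv.
  - by apply: (S_exp SR); apply: S_prod_seq.
apply: loc_eq S1 _.
apply: generically_mono (generically_and n_gt0 (dQ _ aE) (dQ _ fE)) => U _ [aU fU].
by rewrite /pullback fU aU detQ big_map prodfV !exprVn.
Qed.

End Localization.

Section Marked.
Variables (C : numFieldType) (n : nat) (bd : BD_triple n) (G : group_kind).
Hypothesis n_gt0 : (0 < n)%N.
Local Notation g := (gam bd).
Local Notation F := (@Fmap C n bd).
Implicit Types (U : 'M[C]_n).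

Lemma tdet_mul_unip a (X N : 'M[C]_n) : unip_lower N -> (a < n)%N ->
  tdet a (X *m N) = tdet a X.
Proof.
move=> uN an; rewrite -[LHS]tdet_minor // -[RHS]tdet_minor //.
have -> : (n - a = (n - a.+1).+1)%N by lia.
by rewrite minor_mul_unip //; lia.
Qed.

Lemma h_diagE i U : (0 < i < n)%N -> h_fun bd i.+1 i.+1 U =
  tdet i (F U) * \prod_(1 <= t < (steps bd i).+1) tdet (iter t g i) (F U).
Proof.
move=> ri; rewrite h_funE //=.
rewrite subnn mul0n expr0 mul1r -[X in _ = X * _]tdet_minor //; last by case/andP: ri.
by congr (minor _ _ _ _ * _); lia.
Qed.

Lemma h_diag_std i U : (0 < i < n)%N -> h_fun (BD_std n) i.+1 i.+1 U = tdet i U.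
Proof. by move=> ri; rewrite h_fun_std // ?h_std_diag //; lia. Qed.

Lemma h_diag_Q i U : (0 < i < n)%N -> goodQ bd U -> h_fun bd i.+1 i.+1 (Qmap bd U) =
  \prod_(0 <= t < (steps bd i).+1) tdet (iter t g i) U.
Proof.
move=> ri gU; rewrite h_fun_Q //; [|lia|lia].
by rewrite h_std_diag ?[RHS]big_ltn //; case/andP: ri.
Qed.

Lemma prod_tdetF_neq0 i U : (0 < i < n)%N -> goodF bd U ->
  \prod_(1 <= t < (steps bd i).+1) tdet (iter t g i) (F U) != 0.
Proof.
move=> ri gU; rewrite prodf_seq_neq0; apply/allP => t _; apply/implyP => _.
by apply: tdet_neq0; [exact: Fmap_unit|exact: Fmap_factorable].
Qed.

Lemma h_diag_neq0 i : (0 < i < n)%N -> generically G (fun U => h_fun bd i.+1 i.+1 U != 0).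
Proof.
move=> ri; apply/near1_generically => //; apply: near1_mono (near1_goodF C bd n_gt0) => U gU.
rewrite h_diagE // mulf_neq0 ?prod_tdetF_neq0 //.
by apply: tdet_neq0; [exact: Fmap_unit|exact: Fmap_factorable].
Qed.

Lemma h_diag_std_neq0 i : (0 < i < n)%N ->
  generically G (fun U : 'M[C]_n => h_fun (BD_std n) i.+1 i.+1 U != 0).
Proof.
move=> ri; apply/near1_generically => //; apply: near1_mono (near1_factorable C n_gt0).
by move=> U [Uu fU]; rewrite h_diag_std // tdet_neq0.
Qed.

Lemma h_diag_regular i : (0 < i < n)%N -> regular_fun G (@h_fun C n bd i.+1 i.+1).
Proof.
move=> ri; have [h Ph hE] := trailing_polyM bd n_gt0 (1%:M : 'M[C]_n) ri.
apply: (regular_eq n_gt0 (regular_poly G Ph)).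
apply/near1_generically => //; apply: near1_mono (near1_goodF C bd n_gt0) => U gU.
by rewrite -hE // mulmx1 h_diagE.
Qed.

Lemma h_diag_std_regular i : (0 < i < n)%N -> regular_fun G (@h_fun C n (BD_std n) i.+1 i.+1).
Proof.
move=> ri; apply: regular_poly => //; apply: S_ext (@polyfun_tdet C n i) _ => U.
by rewrite h_diag_std.
Qed.

Let ms := [seq i <- iota 1 n.-1 | Gam2 bd i].

Let msP i : (i \in ms) = Gam2 bd i.
Proof.
rewrite mem_filter mem_iota; case: (boolP (Gam2 bd i)) => //= /G2_range; lia.
Qed.

Let ms_range i : i \in ms -> (0 < i < n)%N.
Proof. by rewrite msP => /G2_range. Qed.

Local Notation loc := (in_localization G [seq @h_fun C n bd i.+1 i.+1 | i <- ms]).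
Local Notation loc_std := (in_localization G [seq @h_fun C n (BD_std n) i.+1 i.+1 | i <- ms]).

Let SR : funring loc.
Proof.
apply: loc_funring => // i /ms_range ri; [exact: h_diag_regular|exact: h_diag_neq0].
Qed.

Let SRstd : funring loc_std.
Proof.
apply: loc_funring => // i /ms_range ri; [exact: h_diag_std_regular|exact: h_diag_std_neq0].
Qed.

Let polyfun_colrep i (j k : 'I_n) : polyfun (fun U : 'M[C]_n => tdet i (colrep j k U)).
Proof.
apply: (@polyfun_comp C n _ (@polyfun C n) (colrep j k) (tdet i) (polyfun_funring C n)) => [k' l|]; last exact: polyfun_tdet.
apply: (S_ext (@polyfun_mx C n k' (if l == j then k else l))) => U.
by rewrite mxE.
Qed.

(** By [S_rho] only the entries of U_- in rows i of Gamma2 matter; their denominators [tdet i] are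
    the marked variables of the trivial triple. *)
Lemma loc_std_Qmap : S_mx loc_std (@Qmap C n bd).
Proof.
have Srho : S_mx loc_std (fun U => rho bd U).
  apply: S_rho => // i j ji s.
  have G2i : (i : nat) \in ms by rewrite msP; apply: s; rewrite ji leqnn.
  apply: (@loc_eq _ _ _ n_gt0 _ _ _ (fun U : 'M[C]_n => tdet i (colrep i j U) *
     (h_fun (BD_std n) i.+1 i.+1 U)^-1)).
    apply: (S_mul SRstd); first by apply: loc_regular => //; apply: regular_poly.
    by apply: (loc_inv n_gt0 (r := ms)) => // k /ms_range rk;
      [exact: h_diag_std_regular|exact: h_diag_std_neq0].
  apply/near1_generically => //; apply: near1_mono (near1_factorable C n_gt0).
  by move=> U [Uu fU]; rewrite low_part_entry // h_diag_std //; apply: ms_range.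
apply: (S_mx_mul SRstd) (Srho); apply: (S_mx_mul SRstd).
  apply: S_unip_inv_all Srho; first exact: SRstd.
  by move=> U; apply: rho_unip.
by move=> i j; apply: loc_regular => //; apply: regular_poly => //; apply: polyfun_mx.
Qed.

(** In Cramer's rule for F(U)_- neither numerator nor denominator need be polynomial in U.
    Multiplied by the product along the string both become so, and the new denominator is a marked
    variable. *)
Lemma loc_Qinv : S_mx loc (@Qinv C n bd).
Proof.
have Snu : S_mx loc (fun U => nu bd U).
  apply: S_tgamma => // [U|i j ji s]; first exact: low_part_unip.
  have G2i : (i : nat) \in ms by rewrite msP; apply: s; rewrite ji leqnn.
  have ri := ms_range G2i.
  have [h Ph hE] := trailing_polyM bd n_gt0 (colrep i j (1%:M : 'M[C]_n)) ri.
  apply: (@loc_eq _ _ _ n_gt0 _ _ _ (fun U : 'M[C]_n => h U * (h_fun bd i.+1 i.+1 U)^-1)).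
    apply: (S_mul SR); first by apply: loc_regular => //; apply: regular_poly.
    by apply: (loc_inv n_gt0 (r := ms)) => // k /ms_range rk;
      [exact: h_diag_regular|exact: h_diag_neq0].
  apply/near1_generically => //; apply: near1_mono (near1_goodF C bd n_gt0) => U gU.
  have [Fu fF] := (Fmap_unit n_gt0 gU, Fmap_factorable n_gt0 gU).
  rewrite low_part_entry // -hE // -colrepE h_diagE //.
  have P0 := prod_tdetF_neq0 ri gU; have D0 := tdet_neq0 i Fu fF.
  by rewrite -mulf_div divff // mulr1.
apply: (S_mx_mul SR); first apply: (S_mx_mul SR) => //.
  by move=> i j; apply: loc_regular => //; apply: regular_poly => //; apply: polyfun_mx.
apply: S_unip_inv_all Snu; first exact: SR.
by move=> U; apply: nu_unip.
Qed.

Lemma iter_ms i t : i \in ms -> (t <= steps bd i)%N -> iter t g i \in ms.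
Proof.
rewrite !msP => G2i; case: t => // t ts; rewrite iterS; apply: gam_G2.
by apply: steps_G1 => //; have := G2_range G2i; lia.
Qed.

Lemma loc_std_h i : i \in ms -> loc_std (fun U => (h_fun bd i.+1 i.+1 (Qmap bd U))^-1).
Proof.
move=> im; have ri := ms_range im.
apply: (@loc_eq _ _ _ n_gt0 _ _ _ (fun U : 'M[C]_n => \prod_(t <- index_iota 0 (steps bd i).+1)
   (h_fun (BD_std n) (iter t g i).+1 (iter t g i).+1 U)^-1)).
  apply: S_prod_seq => // t; rewrite mem_index_iota => /andP[_ ts].
  apply: (loc_inv n_gt0 (r := ms)) => [k /ms_range rk|k /ms_range rk|].
  - exact: h_diag_std_regular.
  - exact: h_diag_std_neq0.
  - exact: iter_ms.
apply/near1_generically => //; apply: near1_mono (near1_goodQ C bd n_gt0) => U gU.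
rewrite h_diag_Q // prodfV; congr _^-1; rewrite big_nat_cond [RHS]big_nat_cond.
apply: eq_bigr => t /andP[tb _]; by rewrite h_diag_std //; apply: iter_range.
Qed.

(** On U the function to be inverted is the trailing minor of F(U) at i, the ratio of two successive
    h-functions on the string, or a single one at its end. *)
Lemma loc_h i : i \in ms -> loc (fun U => (h_fun (BD_std n) i.+1 i.+1 (Qinv bd U))^-1).
Proof.
move=> im; have ri := ms_range im.
have Sreg k : k \in ms -> loc (@h_fun C n bd k.+1 k.+1).
  by move=> /ms_range rk; apply: loc_regular => //; apply: h_diag_regular.
have Sinv k : k \in ms -> loc (fun U => (h_fun bd k.+1 k.+1 U)^-1).
  by move=> km; apply: (loc_inv n_gt0 (r := ms)) => // l /ms_range rl;
      [exact: h_diag_regular|exact: h_diag_neq0].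
have e U : goodF bd U -> h_fun (BD_std n) i.+1 i.+1 (Qinv bd U) = tdet i (F U).
  move=> gU; have uN := nu_unip bd n_gt0 U; rewrite h_diag_std // QinvE // tdet_mul_unip //.
    exact: unip_inv.
  by case/andP: ri.
have [Gi|nGi] := boolP (Gam1 bd i).
  have gim : g i \in ms by rewrite msP gam_G2.
  apply: (@loc_eq _ _ _ n_gt0 _ _ _
    (fun U : 'M[C]_n => h_fun bd (g i).+1 (g i).+1 U * (h_fun bd i.+1 i.+1 U)^-1)).
    by apply: (S_mul SR); [exact: Sreg|exact: Sinv].
  apply/near1_generically => //; apply: near1_mono (near1_goodF C bd n_gt0) => U gU.
  have gr := ms_range gim.
  have pE : \prod_(1 <= t < (steps bd i).+1) tdet (iter t g i) (F U) =
            tdet (g i) (F U) * \prod_(1 <= t < (steps bd (g i)).+1) tdet (iter t g (g i)) (F U).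
    rewrite stepsS // big_ltn // big_add1 /=; congr (_ * _).
    by apply: eq_bigr => t _; rewrite -iterSr.
  rewrite e // [in h_fun bd i.+1 _ _]h_diagE // pE h_diagE //.
  have P0 := prod_tdetF_neq0 gr gU.
  have D0 := tdet_neq0 (g i) (Fmap_unit n_gt0 gU) (Fmap_factorable n_gt0 gU).
  by rewrite invfM mulrCA mulfV ?mulr1 // mulf_neq0.
apply: (@loc_eq _ _ _ n_gt0 _ _ _ (fun U : 'M[C]_n => (h_fun bd i.+1 i.+1 U)^-1)); first exact: Sinv.
apply/near1_generically => //; apply: near1_mono (near1_goodF C bd n_gt0) => U gU.
by rewrite e // h_diagE // steps0 ?big_geq ?mulr1 //; case/andP: ri.
Qed.

Lemma pullback_iso_Qmap : pullback_iso G (@Qmap C n bd)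
  [seq @h_fun C n bd i.+1 i.+1 | i <- ms] [seq @h_fun C n (BD_std n) i.+1 i.+1 | i <- ms].
Proof.
have dQ := @dominant_Qmap C n bd n_gt0 G; have dQ' := @dominant_Qinv C n bd n_gt0 G.
have QK := @generically_QmapK C n bd n_gt0 G.
split=> [f lf|f f' lf lf' ff'|f lf].
- apply: (loc_pullback n_gt0 _ _ dQ) lf => [i|i|U||].
  + by move=> /ms_range; apply: h_diag_std_regular.
  + by move=> /ms_range; apply: h_diag_std_neq0.
  + exact: det_Qmap.
  + exact: loc_std_Qmap.
  + exact: loc_std_h.
- apply: generically_mono (generically_and n_gt0 (dQ' _ ff') QK) => U _ [].
  by rewrite /pullback => e QU; rewrite QU in e.
- exists (pullback (@Qinv C n bd) f).
    apply: (loc_pullback n_gt0 _ _ dQ') lf => [i|i|U||].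
    + by move=> /ms_range; apply: h_diag_regular.
    + by move=> /ms_range; apply: h_diag_neq0.
    + exact: det_Qinv.
    + exact: loc_Qinv.
    + exact: loc_h.
  apply: generically_mono (@generically_QinvK C n bd n_gt0 G) => U _ QU.
  by rewrite /pullback QU.
Qed.

End Marked.

(** * Mutations of related seeds *)

Section IntegerParts.

Definition sgb (e : bool) (z : int) : bool := if e then 0 < z else z < 0.

Definition part (e : bool) (z : int) : int := if sgb e z then `|z|%N%:Z else 0.

Lemma part_sub z : part true z - part false z = z.
Proof. by rewrite /part /sgb; case: ltrgtP; lia. Qed.

(* The matrix mutation correction is b_ik times the positive or the negative
   part of b_kj, according to the sign of b_ik alone. *)
Lemma double_corr (p : int) : exists e : bool, forall q : int,
  `|p| * q + p * `|q| = p * part e q * 2.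
Proof.
have [p0|p0] := lerP 0 p; [exists true|exists false] => q; rewrite /part /sgb.
- rewrite (ger0_norm p0); case: (ltrP 0 q) => q0.
    by rewrite (gtr0_norm q0) gtz0_abs //; ring.
  by rewrite (ler0_norm q0); ring.
- rewrite (ltr0_norm p0); case: (ltrP q 0) => q0.
    by rewrite (ltr0_norm q0) ltz0_abs //; ring.
  by rewrite (ger0_norm q0); ring.
Qed.

Definition corr (p q : int) : int := ((`|p| * q + p * `|q|) %/ 2)%Z.

Lemma corrE (p : int) : exists e : bool, forall q : int, corr p q = p * part e q.
Proof. by have [e H] := double_corr p; exists e => q; rewrite /corr H mulzK. Qed.

Lemma corr2 (p q : int) : corr p q * 2 = `|p| * q + p * `|q|.
Proof. by have [e H] := double_corr p; rewrite /corr H mulzK. Qed.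

(** Skew-symmetrizability passes to the mutation correction; multiplying by twice the weight of the
    mutated label removes the division by 2 and lets both hypotheses be applied. *)
Lemma corr_skew (a b c p q p' q' : int) : 0 < a -> 0 < b -> 0 < c ->
  a * p = - (c * q') -> c * q = - (b * p') -> a * corr p q = - (b * corr p' q').
Proof.
move=> a0 b0 c0 e1 e2; have c2 : c * 2 != 0 by rewrite mulf_neq0 // gt_eqF.
apply: (mulfI c2).
have -> : c * 2 * (a * corr p q) = c * a * (corr p q * 2) by ring.
have -> : c * 2 * - (b * corr p' q') = - (c * b * (corr p' q' * 2)) by ring.
rewrite !corr2.
have n1 : a * `|p| = c * `|q'|.
  by rewrite -{1}(gtr0_norm a0) -normrM e1 normrN normrM (gtr0_norm c0).
have n2 : c * `|q| = b * `|p'|.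
  by rewrite -{1}(gtr0_norm c0) -normrM e2 normrN normrM (gtr0_norm b0).
have -> : c * a * (`|p| * q + p * `|q|) = (a * `|p|) * (c * q) + (a * p) * (c * `|q|) by ring.
by rewrite n1 n2 e1 e2; ring.
Qed.

End IntegerParts.

Lemma divf_cancel (K : fieldType) (z c a b : K) :
  c != 0 -> z * (c * a) / (c * b) = z * a / b.
Proof.
move=> c0; have -> : z * (c * a) / (c * b) = c / c * (z * a / b) by rewrite invfM; ring.
by rewrite divff // mul1r.
Qed.

(** * Exchange relations with rounding confined to fixed frozen variables *)

Section SeedNormalForm.
Variables (C : fieldType) (n : nat).
Implicit Types (s : ext_seed C n) (U : 'M[C]_n).
Variables (E : seq label) (Z : pred label).

(* Labels in Z are frozen and may appear in the strings; for the other labels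
   the exponents are divisible by the multiplicity, so that no rounding occurs. *)
Definition regular_at s k :=
  [/\ perm_eq (cluster s ++ frozen s) E, {in cluster s, forall x, ~~ Z x},
      {in E, forall x, ~~ Z x -> (mult s k %| `|exmx s k x|)%N} &
      {in E, forall x, ~~ Z x -> forall r, pstr s k r x = 0%N}].

Definition mono s e k U := \prod_(x <- E | ~~ Z x && sgb e (exmx s k x))
  var s x U ^+ (`|exmx s k x| %/ mult s k)%N.

Definition zmono s e k r U := \prod_(x <- E | Z x && sgb e (exmx s k x))
  var s x U ^+ (r * `|exmx s k x| %/ mult s k)%N.

Definition zstr s k r U := \prod_(x <- E | Z x) var s x U ^+ pstr s k r x.

Definition u_e (e : bool) s k U := if e then u_gt s k U else u_lt s k U.
Definition v_e (e : bool) s k r U := if e then v_gt s k r U else v_lt s k r U.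

Lemma u_eE e s k U : u_e e s k U =
  \prod_(i <- cluster s | sgb e (exmx s k i)) var s i U ^+ (`|exmx s k i| %/ mult s k)%N.
Proof. by case: e. Qed.

Lemma v_eE e s k r U : v_e e s k r U =
  \prod_(i <- frozen s | sgb e (exmx s k i)) var s i U ^+ (r * `|exmx s k i| %/ mult s k)%N.
Proof. by case: e. Qed.

Definition fmono s e k U := \prod_(x <- frozen s | ~~ Z x && sgb e (exmx s k x))
  var s x U ^+ (`|exmx s k x| %/ mult s k)%N.

Lemma frozen_E s k x : regular_at s k -> x \in frozen s -> x \in E.
Proof. by move=> [pE _ _ _] xf; rewrite -(perm_mem pE) mem_cat xf orbT. Qed.

Lemma zmonoE s e k r U : regular_at s k -> zmono s e k r U =
  \prod_(x <- frozen s | Z x && sgb e (exmx s k x)) var s x U ^+ (r * `|exmx s k x| %/ mult s k)%N.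
Proof.
move=> [pE cZ _ _]; rewrite /zmono -(perm_big _ pE) big_cat /=.
rewrite big1_seq ?mul1r // => x /andP[/andP[Zx _] /cZ].
by rewrite Zx.
Qed.

(** Outside [Z] divisibility makes the rounded exponent linear in r, so that part is an r-th
    power. *)
Lemma v_e_split s e k r U : regular_at s k ->
  v_e e s k r U = fmono s e k U ^+ r * zmono s e k r U.
Proof.
move=> R; have [pE cZ dE _] := R; rewrite v_eE zmonoE // (bigID Z) /= mulrC.
congr (_ * _); last by apply: eq_bigl => x; rewrite andbC.
rewrite /fmono -prodrXl big_seq_cond [RHS]big_seq_cond; apply: eq_big => [x|x].
  by rewrite [sgb _ _ && _]andbC.
case/and3P => xf _ nZ; rewrite -exprM; congr (_ ^+ _).
have dv : (mult s k %| `|exmx s k x|)%N by apply: dE => //; apply: (frozen_E R).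
by rewrite -muln_divA // mulnC.
Qed.

Lemma u_v_split s e k r U : regular_at s k ->
  u_e e s k U ^+ r * v_e e s k r U = mono s e k U ^+ r * zmono s e k r U.
Proof.
move=> R; have [pE cZ _ _] := R; rewrite v_e_split // mulrA -exprMn; congr (_ ^+ _ * _).
rewrite /mono -(perm_big _ pE) big_cat /= u_eE; congr (_ * _).
rewrite big_seq_cond [RHS]big_seq_cond; apply: eq_bigl => x.
by case xc: (x \in cluster s) => //=; rewrite cZ.
Qed.

Lemma p_val_zstr s k r U : regular_at s k -> p_val s k r U = zstr s k r U.
Proof.
move=> R; have [pE cZ _ pZ] := R; rewrite /p_val /zstr -(perm_big _ pE) big_cat /=.
rewrite [X in _ = X * _]big1_seq ?mul1r => [|x /andP[Zx /cZ]]; last by rewrite Zx.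
rewrite (bigID Z) /= mulrC big1_seq ?mul1r // => x /andP[nZ xf].
by rewrite pZ ?(frozen_E R).
Qed.

Lemma exchange_rhs_normal s k U : regular_at s k -> exchange_rhs s k U =
  \sum_(r < (mult s k).+1) zstr s k r U
    * (mono s true k U ^+ r * zmono s true k r U)
    * (mono s false k U ^+ (mult s k - r) * zmono s false k (mult s k - r) U).
Proof.
move=> R; apply: eq_bigr => r _; rewrite -!u_v_split // -p_val_zstr //.
by rewrite /u_e /v_e !mulrA.
Qed.

(** A frozen variable outside [Z] occurs to the same power in numerator and denominator and cancels,
    so only the variables in [Z] are left. *)
Lemma p_hat_normal s k r U : regular_at s k ->
  (forall x, x \in frozen s -> ~~ Z x -> var s x U != 0) ->
  p_hat s k r U = zstr s k r U ^+ mult s k *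
    (zmono s true k r U * zmono s false k (mult s k - r) U) ^+ mult s k
    / (zmono s true k (mult s k) U ^+ r * zmono s false k (mult s k) U ^+ (mult s k - r)).
Proof.
move=> R nz; set d := mult s k.
have f0 e : fmono s e k U != 0.
  rewrite /fmono prodf_seq_neq0; apply/allP => x xf; apply/implyP => /andP[nZ _].
  by rewrite expf_neq0 // nz.
rewrite /p_hat p_val_zstr // -/d.
have v e r' := v_e_split e r' U R.
rewrite -![v_gt s k _ U]/(v_e true s k _ U) -![v_lt s k _ U]/(v_e false s k _ U) !v.
rewrite !exprMn -!exprM [(r * d)%N]mulnC [((d - r) * d)%N]mulnC.
move: (expf_neq0 (d * r) (f0 true)) (expf_neq0 (d * (d - r)) (f0 false)).
move: (fmono s true k U ^+ _) (fmono s false k U ^+ _) => x y x0 y0.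
have e (a b : C) : x * a * (y * b) = x * y * (a * b) by ring.
have xy0 : x * y != 0 by rewrite mulf_neq0.
by rewrite !e divf_cancel.
Qed.

End SeedNormalForm.

Section RelatedSeeds.
Variables (C : numFieldType) (n : nat) (G : group_kind).
Hypothesis n_gt0 : (0 < n)%N.
Implicit Types (s st : ext_seed C n) (U : 'M[C]_n).
Variable Q : 'M[C]_n -> 'M[C]_n.
(* Non-marked cluster labels, marked labels, remaining frozen labels. *)
Variables (Cl Mk Fz : seq label) (Z : pred label) (w : label -> int).
Local Notation E := (Cl ++ Fz ++ Mk).

Hypothesis E_uniq : uniq E.
Hypothesis Z_Fz : {in E, forall x, Z x -> x \in Fz}.
Hypothesis w_gt0 : forall x, 0 < w x.

Record related s st (lam : label -> label -> int) : Prop := Related {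
  rel_cl : perm_eq (cluster s) (Cl ++ Mk);
  rel_fr : perm_eq (frozen s) Fz;
  rel_clt : perm_eq (cluster st) Cl;
  rel_frt : perm_eq (frozen st) (Fz ++ Mk);
  rel_mult : mult s =1 mult st;
  rel_mult_gt0 : forall k, (0 < mult s k)%N;
  rel_b : forall i j, i \in Cl -> j \in Cl ++ Fz -> exmx s i j = exmx st i j;
  rel_lam : forall i m, i \in Cl -> m \in Mk ->
    \sum_(x <- E) exmx s i x * lam x m = exmx st i m;
  rel_pstr : forall k r x, pstr s k r x = pstr st k r x;
  rel_pZ : forall k r x, x \in E -> ~~ Z x -> pstr s k r x = 0%N;
  rel_div : forall k x, k \in Cl -> x \in E -> ~~ Z x -> (mult s k %| `|exmx s k x|)%N;
  rel_divt : forall k x, k \in Cl -> x \in E -> ~~ Z x -> (mult s k %| `|exmx st k x|)%N;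
  rel_skew : forall i j, i \in Cl -> j \in Cl -> w i * exmx s i j = - (w j * exmx s j i);
  rel_lamZ : forall x m, x \in E -> Z x -> lam x m = 0;
  rel_var : generically G (fun U => forall x, x \in E ->
    var s x (Q U) = (if x \in Mk then 1 else var st x U) *
                    \prod_(m <- Mk) var st m U ^ lam x m);
  rel_nz : generically G (fun U => forall x, x \in Fz ++ Mk -> ~~ Z x -> var st x U != 0)
}.

Let disj x : (x \in E) -> [/\ (x \in Cl) = ~~ (x \in Fz ++ Mk) & (x \in Mk) = ~~ (x \in Cl ++ Fz)].
Proof.
move: E_uniq; rewrite catA cat_uniq => /and3P[uCF /hasPn dM _].
move: E_uniq; rewrite cat_uniq => /and3P[_ /hasPn dC _].
rewrite !mem_cat => xE; split.
  case xC: (x \in Cl); last by move: xE; rewrite xC /= => ->.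
  by apply/esym/negP => xFM; have := dC x; rewrite mem_cat xFM xC => /(_ isT).
case xM: (x \in Mk); last by move: xE; rewrite xM orbF => ->.
by have := dM x xM; rewrite mem_cat => ->.
Qed.

Let ClE x : x \in Cl -> x \in E.
Proof. by move=> xC; rewrite mem_cat xC. Qed.

Let MkE x : x \in Mk -> x \in E.
Proof. by move=> xM; rewrite !mem_cat xM !orbT. Qed.

Let FzE x : x \in Fz -> x \in E.
Proof. by move=> xM; rewrite !mem_cat xM !orbT. Qed.

Let Cl_Z x : x \in Cl -> ~~ Z x.
Proof.
move=> xC; apply/negP => /(Z_Fz (ClE xC)) xF.
by have [e _] := disj (ClE xC); move: e; rewrite xC mem_cat xF.
Qed.

Let Mk_Z x : x \in Mk -> ~~ Z x.
Proof.
move=> xM; apply/negP => /(Z_Fz (MkE xM)) xF.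
by have [_ e] := disj (MkE xM); move: e; rewrite xM mem_cat xF orbT.
Qed.

Let Cl_Mk x : x \in Cl -> (x \in Mk) = false.
Proof. by move=> xC; have [_ ->] := disj (ClE xC); rewrite mem_cat xC. Qed.

Lemma related_regular s st lam k : related s st lam -> k \in Cl -> regular_at E Z s k.
Proof.
move=> R kC; split.
- have := perm_cat (rel_cl R) (rel_fr R) => /perm_trans; apply.
  by rewrite -catA perm_cat2l perm_catC.
- move=> x; rewrite (perm_mem (rel_cl R)) mem_cat => /orP[/Cl_Z|/Mk_Z] //.
- by move=> x xE nZ; apply: (rel_div R).
- by move=> x xE nZ r; apply: (rel_pZ R).
Qed.

Lemma related_regulart s st lam k : related s st lam -> k \in Cl -> regular_at E Z st k.
Proof.
move=> R kC; split.
- exact: perm_cat (rel_clt R) (rel_frt R).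
- by move=> x; rewrite (perm_mem (rel_clt R)) => /Cl_Z.
- by move=> x xE nZ; rewrite -(rel_mult R); apply: (rel_divt R).
- by move=> x xE nZ r; rewrite -(rel_pstr R); apply: (rel_pZ R).
Qed.

Definition lam_part s st (lam : label -> label -> int) (e : bool) k m : int :=
  \sum_(x <- E | ~~ Z x && sgb e (exmx s k x)) (`|exmx s k x| %/ mult s k)%N%:Z * lam x m
  - (if sgb e (exmx st k m) then (`|exmx st k m| %/ mult st k)%N%:Z else 0).

Lemma mul_lam_part s st lam e k m : related s st lam -> k \in Cl -> m \in Mk ->
  (mult s k)%:Z * lam_part s st lam e k m =
  \sum_(x <- E) part e (exmx s k x) * lam x m - part e (exmx st k m).
Proof.
move=> R kC mM; rewrite /lam_part mulrBr mulr_sumr; congr (_ - _).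
  rewrite [RHS](bigID (fun x => ~~ Z x && sgb e (exmx s k x))) /=.
  rewrite [X in _ = _ + X]big1_seq ?addr0 => [|x /andP[nx xE]]; last first.
    move: nx; rewrite negb_and negbK => /orP[Zx|ns].
      by rewrite (rel_lamZ R) ?mulr0.
    by rewrite /part (negbTE ns) mul0r.
  rewrite big_seq_cond [RHS]big_seq_cond; apply: eq_bigr => x /and3P[xE nZ sx].
  rewrite /part sx mulrA -PoszM mulnC divnK //.
  by apply: (rel_div R).
rewrite /part; case: ifP => _; last by rewrite mulr0.
rewrite (rel_mult R) -PoszM mulnC divnK // -(rel_mult R).
by apply: (rel_divt R) => //; [exact: MkE|exact: Mk_Z].
Qed.

(** Positive minus negative parts is the full exchange matrix, so the difference of the two sides is
    [rel_lam] divided by the multiplicity. *)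
Lemma lam_part_eq s st lam k m : related s st lam -> k \in Cl -> m \in Mk ->
  lam_part s st lam true k m = lam_part s st lam false k m.
Proof.
move=> R kC mM; have d0 : (mult s k)%:Z != 0.
  by have := rel_mult_gt0 R k; rewrite eqz_nat -lt0n.
apply: (mulfI d0); rewrite !mul_lam_part //.
have e1 : \sum_(x <- E) part true (exmx s k x) * lam x m =
    \sum_(x <- E) part false (exmx s k x) * lam x m + exmx st k m.
  rewrite -(rel_lam R kC mM) -big_split /=; apply: eq_bigr => x _.
  by rewrite -[X in _ = _ + X * _]part_sub; ring.
have e2 := part_sub (exmx st k m).
by rewrite e1 -{1}e2; ring.
Qed.

Definition good_point s st lam U :=
  (forall x, x \in E ->
    var s x (Q U) = (if x \in Mk then 1 else var st x U) *
                    \prod_(m <- Mk) var st m U ^ lam x m) /\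
  (forall x, x \in Fz ++ Mk -> ~~ Z x -> var st x U != 0).

Lemma generically_good s st lam : related s st lam -> generically G (good_point s st lam).
Proof. by move=> R; apply: (generically_and n_gt0 (rel_var R) (rel_nz R)). Qed.

Section AtPoint.
Variables (s st : ext_seed C n) (lam : label -> label -> int) (U : 'M[C]_n) (k : label).
Hypothesis R : related s st lam.
Hypothesis kC : k \in Cl.
Hypothesis gU : good_point s st lam U.

Let Mk_nz m : m \in Mk -> var st m U != 0.
Proof. by move=> mM; apply: gU.2; rewrite ?mem_cat ?mM ?orbT //; apply: Mk_Z. Qed.

Let Z_var x : x \in E -> Z x -> var s x (Q U) = var st x U.
Proof.
move=> xE Zx; rewrite gU.1 // big1 ?mulr1 => [|m _]; last by rewrite (rel_lamZ R).
by case: ifP => // /Mk_Z; rewrite Zx.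
Qed.

Let Z_exmx x : x \in E -> Z x -> exmx s k x = exmx st k x.
Proof. by move=> xE Zx; apply: (rel_b R) => //; rewrite mem_cat (Z_Fz xE Zx) orbT. Qed.

Lemma zstr_Q r : zstr E Z s k r (Q U) = zstr E Z st k r U.
Proof.
rewrite /zstr big_seq_cond [RHS]big_seq_cond; apply: eq_bigr => x /andP[xE Zx].
by rewrite Z_var // (rel_pstr R).
Qed.

Lemma zmono_Q e r : zmono E Z s e k r (Q U) = zmono E Z st e k r U.
Proof.
rewrite /zmono big_seq_cond [RHS]big_seq_cond; apply: eq_big => [x|x /and3P[xE Zx _]].
  by case xE: (x \in E) => //=; case Zx: (Z x) => //=; rewrite Z_exmx.
by rewrite Z_var // Z_exmx // (rel_mult R).
Qed.

Lemma mono_Q e : mono E Z s e k (Q U) =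
  mono E Z st e k U * \prod_(m <- Mk) var st m U ^ lam_part s st lam e k m.
Proof.
have prodU (P : pred label) (F : label -> nat) :
    \prod_(x <- E | P x) (\prod_(m <- Mk) var st m U ^ lam x m) ^+ F x =
    \prod_(m <- Mk) var st m U ^ (\sum_(x <- E | P x) (F x)%:Z * lam x m).
  rewrite (eq_bigr (fun x => \prod_(m <- Mk) var st m U ^ ((F x)%:Z * lam x m))).
    rewrite exchange_big /= big_seq [RHS]big_seq; apply: eq_bigr => m mM.
    have m0 := Mk_nz mM; elim: (E) => [|y r IH]; first by rewrite !big_nil.
    by rewrite !big_cons; case: ifP => // _; rewrite IH expfzDr.
  move=> x _; rewrite -prodrXl; apply: eq_bigr => m _.
  by rewrite mulrC -exprz_exp.
have -> : mono E Z s e k (Q U) =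
   \prod_(x <- E | ~~ Z x && sgb e (exmx s k x))
       (if x \in Mk then 1 else var st x U) ^+ (`|exmx s k x| %/ mult s k)%N
   * \prod_(m <- Mk) var st m U ^ (\sum_(x <- E | ~~ Z x && sgb e (exmx s k x))
        (`|exmx s k x| %/ mult s k)%N%:Z * lam x m).
  rewrite -prodU -big_split /= /mono big_seq_cond [RHS]big_seq_cond.
  by apply: eq_bigr => x /andP[xE _]; rewrite gU.1 // exprMn.
have -> : mono E Z st e k U =
   \prod_(x <- E | ~~ Z x && sgb e (exmx s k x))
       (if x \in Mk then 1 else var st x U) ^+ (`|exmx s k x| %/ mult s k)%N
   * \prod_(m <- Mk) var st m U ^ (if sgb e (exmx st k m)
        then (`|exmx st k m| %/ mult st k)%N%:Z else 0).
  rewrite /mono !catA [LHS]big_cat [X in _ = X * _]big_cat /= -mulrA; congr (_ * _).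
    rewrite big_seq_cond [RHS]big_seq_cond.
    have eb x : x \in Cl ++ Fz -> exmx s k x = exmx st k x by apply: (rel_b R).
    apply: eq_big => [x|x /andP[xCF _]].
      by case xCF: (x \in Cl ++ Fz) => //=; rewrite eb.
    have xE : x \in E by rewrite catA mem_cat xCF.
    have [_ ->] := disj xE; rewrite xCF /= eb // (rel_mult R) //.
  rewrite [X in _ = X * _]big1_seq ?mul1r => [|x /andP[_ xM]]; last by rewrite xM expr1n.
  rewrite big_mkcond big_seq [RHS]big_seq; apply: eq_bigr => m mM.
  by rewrite (Mk_Z mM) /=; case: ifP.
rewrite -mulrA; congr (_ * _); rewrite -big_split /= big_seq [RHS]big_seq.
apply: eq_bigr => m mM; rewrite -expfzDr ?Mk_nz // /lam_part.
by congr (_ ^ _); rewrite addrC subrK.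
Qed.

(** Both monomials acquire the same factor c, so the r-th summand acquires c^r c^(d-r) = c^d,
    independent of r. *)
Lemma exchange_rhs_Q : exchange_rhs s k (Q U) = exchange_rhs st k U *
  \prod_(m <- Mk) var st m U ^ ((mult s k)%:Z * lam_part s st lam true k m).
Proof.
rewrite (exchange_rhs_normal _ (related_regular R kC)).
rewrite (exchange_rhs_normal _ (related_regulart R kC)) -(rel_mult R) mulr_suml.
apply: eq_bigr => r _; rewrite zstr_Q !zmono_Q !mono_Q.
have -> : \prod_(m <- Mk) var st m U ^ lam_part s st lam false k m =
          \prod_(m <- Mk) var st m U ^ lam_part s st lam true k m.
  by rewrite big_seq [RHS]big_seq; apply: eq_bigr => m mM; rewrite lam_part_eq.
have -> : \prod_(m <- Mk) var st m U ^ ((mult s k)%:Z * lam_part s st lam true k m) =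
    (\prod_(m <- Mk) var st m U ^ lam_part s st lam true k m) ^+ mult s k.
  by rewrite -prodrXl; apply: eq_bigr => m _; rewrite mulrC -exprz_exp.
move: (\prod_(m <- Mk) _) => c; rewrite !exprMn.
have cE : c ^+ mult s k = c ^+ r * c ^+ (mult s k - r) by rewrite -exprD subnKC // -ltnS.
by rewrite cE; ring.
Qed.

Lemma p_hat_Q r : p_hat s k r (Q U) = p_hat st k r U.
Proof.
rewrite (p_hat_normal r (related_regular R kC)); last first.
  move=> x; rewrite (perm_mem (rel_fr R)) => xF nZ; rewrite gU.1 ?FzE //.
  have xFM : x \in Fz ++ Mk by rewrite mem_cat xF.
  rewrite mulf_neq0 //; first by case: ifP => _; rewrite ?oner_eq0 // gU.2.
  rewrite big_seq prodf_seq_neq0; apply/allP => m mM; rewrite mM /= expfz_neq0 //.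
  exact: Mk_nz.
rewrite (p_hat_normal r (related_regulart R kC)); last first.
  by move=> x; rewrite (perm_mem (rel_frt R)) => xFM nZ; apply: gU.2.
by rewrite !zmono_Q zstr_Q (rel_mult R).
Qed.

End AtPoint.

(** The exponent of the exchange polynomial minus that of the old variable, since the new variable
    is their quotient. *)
Definition mut_lam s st lam k (x m : label) : int :=
  if x == k then (mult s k)%:Z * lam_part s st lam true k m - lam k m else lam x m.

Lemma exmx_kk s st lam k : related s st lam -> k \in Cl -> exmx s k k = 0.
Proof.
move=> R kC; have /eqP := rel_skew R kC kC; rewrite -addr_eq0 -mulr2n -mulr_natr.
by rewrite !mulf_eq0 (gt_eqF (w_gt0 k)) /= orbF => /eqP.
Qed.

Lemma mutate_div s k i x (d : nat) : (d %| `|exmx s i x|)%N ->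
  (d %| `|exmx s i k|)%N -> (d %| `|exmx (mutate s k) i x|)%N.
Proof.
move=> dx dk; rewrite /=; case: ifP => _; first by rewrite abszN.
have [e ce] := corrE (exmx s i k); rewrite -/(corr _ _) ce.
have -> : (d %| `|(exmx s i x + exmx s i k * part e (exmx s k x))%R|)%N =
          (d%:Z %| exmx s i x + exmx s i k * part e (exmx s k x))%Z by [].
by apply: rpredD => //; apply: dvdz_mulr.
Qed.

Lemma related_mutate s st lam k : related s st lam -> k \in Cl ->
  related (mutate s k) (mutate st k) (mut_lam s st lam k).
Proof.
move=> R kC; have [R1 R2 R3 R4 Rm Rm0 Rb Rl Rp RpZ Rd Rdt Rw RlZ Rv Rn] := R.
have kE := ClE kC; have kZ := Cl_Z kC; have bkk := exmx_kk R kC.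
have kM := Cl_Mk kC.
split=> //.
- move=> i j iC jCF; rewrite /=.
  have -> : exmx st i k = exmx s i k by rewrite Rb // mem_cat kC.
  by rewrite -(Rb i j) // -(Rb k j).
- move=> i m iC mM; rewrite /= /mut_lam.
  have km : (m == k) = false by apply/negP => /eqP e; move: kM; rewrite -e mM.
  have dl e : (mult s k)%:Z * lam_part s st lam true k m =
      \sum_(x <- E) part e (exmx s k x) * lam x m - part e (exmx st k m).
    by case: e; rewrite -(mul_lam_part _ R kC mM) // (lam_part_eq R kC mM).
  rewrite km orbF; have [->|ik] := eqVneq i k.
    rewrite -(Rl _ _ kC mM) -sumrN; apply: eq_bigr => x _.
    by case: eqP => [->|_]; rewrite ?bkk ?oppr0 ?mul0r // mulNr.
  (* The sign e depends on b_ik alone, hence is common to all columns and to both seeds; as [dl]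
     holds for either sign, the correction becomes linear and the balance follows. *)
  have [e ce] := corrE (exmx s i k).
  have bik : exmx st i k = exmx s i k by rewrite Rb // mem_cat kC.
  rewrite -/(corr (exmx st i k) (exmx st k m)) bik ce -(Rl _ _ iC mM) (bigD1_seq k) //= eqxx.
  rewrite (dl e) [X in _ = X + _](bigD1_seq k) //=.
  rewrite [\sum_(x <- E) part e _ * _](bigD1_seq k) //= bkk.
  have -> : part e 0 = 0 by rewrite /part /sgb ltxx; case: e {ce}.
  rewrite mul0r add0r.
  have -> : \sum_(x <- E | x != k)
      (if x == k then - exmx s i x
       else exmx s i x + corr (exmx s i k) (exmx s k x)) *
      (if x == k then \sum_(y <- E | y != k) part e (exmx s k y) * lam y m
         - part e (exmx st k m) - lam k m else lam x m) =
      \sum_(x <- E | x != k) exmx s i x * lam x m +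
      exmx s i k * \sum_(x <- E | x != k) part e (exmx s k x) * lam x m.
    rewrite mulr_sumr -big_split /=; apply: eq_bigr => x xk.
    by rewrite (negbTE xk) ce mulrDl mulrA.
  by ring.
- by move=> i r x /=; case: ifP => _; rewrite Rp ?Rm.
- by move=> i r x xE nZ /=; case: ifP => _; apply: RpZ.
- by move=> i x iC xE nZ; apply: mutate_div; apply: Rd.
- by move=> i x iC xE nZ; apply: mutate_div; apply: Rdt.
- move=> i j iC jC /=; have [ik|ik] /= := eqVneq i k.
    by rewrite orbT ik !mulrN Rw // opprK.
  have [jk|jk] /= := eqVneq j k; first by rewrite jk !mulrN Rw.
  rewrite -/(corr (exmx s i k) (exmx s k j)) -/(corr (exmx s j k) (exmx s k i)).
  rewrite !mulrDr opprD (Rw i j iC jC).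
  by rewrite (corr_skew (w_gt0 i) (w_gt0 j) (w_gt0 k) (Rw i k iC kC) (Rw k j kC jC)).
- move=> x m xE Zx; rewrite /mut_lam; case: eqP => [e|_]; last exact: RlZ.
  by move: kZ; rewrite -e Zx.
- have gg := generically_good R.
  apply: generically_mono gg => U _ gU x xE; rewrite /mut_lam /=.
  have -> : \prod_(m <- Mk) (if m == k then exchange_rhs st k U / var st k U else var st m U)
      ^ (if x == k then (mult s k)%:Z * lam_part s st lam true k m - lam k m else lam x m) =
     \prod_(m <- Mk) var st m U ^
      (if x == k then (mult s k)%:Z * lam_part s st lam true k m - lam k m else lam x m).
    rewrite big_seq [RHS]big_seq; apply: eq_bigr => m mM.
    by case: eqP => // e; move: kM; rewrite -e mM.
  case: eqP => [->|_]; last exact: gU.1.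
  rewrite kM (exchange_rhs_Q R kC gU) gU.1 // kM invfM mulrACA; congr (_ * _).
  rewrite -prodfV -big_split /= big_seq [RHS]big_seq; apply: eq_bigr => m mM.
  rewrite expfzDr ?exprzN //; first by rewrite invr_expz.
  by apply: gU.2; rewrite ?mem_cat ?mM ?orbT //; apply: Mk_Z.
- apply: generically_mono Rn => U _ H x xFM nZ /=; case: (x =P k) => [e|_]; last exact: H.
  by have [] := disj kE; rewrite kC -e xFM.
Qed.

Lemma related_mutations s st lam ks : related s st lam ->
  (forall k, k \in ks -> k \in Cl) ->
  exists lam', related (mutations s ks) (mutations st ks) lam'.
Proof.
elim: ks s st lam => [|k ks IH] s st lam R kC; first by exists lam.
apply: (IH _ _ (mut_lam s st lam k)) => [|l lks]; last by apply: kC; rewrite inE lks orbT.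
by apply: related_mutate => //; apply: kC; rewrite inE eqxx.
Qed.

End RelatedSeeds.

(** * The initial quivers *)

Section Labels.

Lemma eqH a b c d : (H a b == H c d) = (a == c) && (b == d).
Proof. by apply/eqP/andP => [[-> ->]|[/eqP-> /eqP->]]. Qed.

Lemma eqPhi a b c d : (Phi a b == Phi c d) = (a == c) && (b == d).
Proof. by apply/eqP/andP => [[-> ->]|[/eqP-> /eqP->]]. Qed.

Lemma mem_mapH (s : seq (nat * nat)) i j :
  (H i j \in [seq H p.1 p.2 | p <- s]) = ((i, j) \in s).
Proof. by apply/mapP/idP => [[[a b] ab [-> ->]]|ij] //; exists (i, j). Qed.

Lemma mem_mapPhi (s : seq (nat * nat)) i j :
  (Phi i j \in [seq Phi p.1 p.2 | p <- s]) = ((i, j) \in s).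
Proof. by apply/mapP/idP => [[[a b] ab [-> ->]]|ij] //; exists (i, j). Qed.

Lemma mem_mapC (s : seq nat) i : (Cc i \in [seq Cc i | i <- s]) = (i \in s).
Proof. by apply/mapP/idP => [[a b [->]]|ij] //; exists i. Qed.

Lemma mem_mapD (s : seq nat) i j :
  (H i j \in [seq H i.+1 i.+1 | i <- s]) = [&& i == j, (0 < i)%N & i.-1 \in s].
Proof.
apply/mapP/and3P => [[a b [-> ->]]|[/eqP<- i0 ij]]; first by rewrite eqxx.
by exists i.-1; rewrite ?prednK.
Qed.

Lemma notin_map (T : eqType) (f : T -> label) (s : seq T) x :
  (forall t, f t != x) -> (x \in [seq f t | t <- s]) = false.
Proof. by move=> fx; apply/negP => /mapP[t _ e]; have := fx t; rewrite -e eqxx. Qed.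

Variable n : nat.

Lemma mem_pairs i j : ((i, j) \in pairs n) = (0 < i <= n)%N && (0 < j <= n)%N.
Proof.
rewrite /pairs; apply/allpairsP/idP => [[[a b]] /= []|/andP[ri rj]].
  by rewrite !mem_iota => ra rb [-> ->]; lia.
by exists (i, j); split=> //=; rewrite mem_iota; lia.
Qed.

Lemma pairs_uniq : uniq (pairs n).
Proof.
apply: allpairs_uniq; rewrite ?iota_uniq // => -[a b] [c d] _ _ /= [-> ->] //.
Qed.

Lemma eq_count_in (T : eqType) (s : seq T) (a b : pred T) :
  {in s, a =1 b} -> count a s = count b s.
Proof.
move=> ab; rewrite -!sum1_count big_seq_cond [RHS]big_seq_cond; apply: eq_bigl => x.
by case xs: (x \in s) => //=; apply: ab.
Qed.

Lemma count_pairs_row a (q : pred nat) (c : pred (nat * nat)) :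
  (forall i j, (0 < i <= n)%N -> (0 < j <= n)%N -> c (i, j) = (i == a) && q j) ->
  count c (pairs n) = ((0 < a <= n)%N * count q (iota 1 n))%N.
Proof.
move=> cE; rewrite (eq_count_in (b := fun p => (p.1 == a) && q p.2)); last first.
  by move=> [i j]; rewrite mem_pairs => /andP[ri rj]; apply: cE.
rewrite /pairs count_flatten -map_comp.
rewrite (eq_map (g := fun i => ((i == a) * count q (iota 1 n))%N)) => [|i]; last first.
  rewrite /= count_map; case: (eqVneq i a) => ia; rewrite ?mul1n ?mul0n.
    by apply: eq_count => j /=; rewrite ia eqxx.
  by rewrite (eq_count (a2 := pred0)) ?count_pred0 // => j /=; rewrite (negbTE ia).
transitivity (count_mem a (iota 1 n) * count q (iota 1 n))%N.
  by elim: (iota 1 n) (count q _) => //= i r IH K; rewrite IH mulnDl.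
by rewrite count_uniq_mem ?iota_uniq // mem_iota add1n ltnS.
Qed.

Lemma iota_last (q : pred nat) : (0 < n)%N ->
  count q (iota 1 n) = (count q (iota 1 n.-1) + q n)%N.
Proof.
move=> n0; have -> : iota 1 n = iota 1 n.-1 ++ [:: n].
  by rewrite -[in LHS](prednK n0) -(addn1 n.-1) iotaD add1n prednK.
by rewrite count_cat /= addn0.
Qed.

Lemma iota_shift (q : pred nat) : (0 < n)%N ->
  count (fun j => (1 < j)%N && q j.-1) (iota 1 n) = count q (iota 1 n.-1).
Proof.
move=> n0; rewrite -{1}(prednK n0) /= add0n (iotaDl 1 1) count_map.
by apply: eq_count_in => j; rewrite mem_iota /= => jr; rewrite add1n ltnS; case/andP: jr => ->.
Qed.

End Labels.

(** * Arrows between a vertex and a row of the h-quiver *)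

Section Quiver.
Variables (n : nat).
Hypothesis hn : (3 <= n)%N.

(** Net number of arrows from y into T; for T a duplicate-free list, the sum of the contributions to
    a(y, x) over x in T. *)
Definition flow (ar : seq (label * label)) (y : label) (T : pred label) : int :=
  (count (fun e => (e.1 == y) && T e.2) ar)%:Z - (count (fun e => T e.1 && (e.2 == y)) ar)%:Z.

Lemma flow_cat ar ar' y T : flow (ar ++ ar') y T = flow ar y T + flow ar' y T.
Proof. by rewrite /flow !count_cat !PoszD; ring. Qed.

Lemma flow_sum ar y r : uniq r ->
  \sum_(x <- r) ((count_mem (y, x) ar)%:Z - (count_mem (x, y) ar)%:Z) = flow ar y (mem r).
Proof.
move=> ur; rewrite sumrB /flow; congr (_ - _).
  elim: ar => [|e ar IH] /=; first by rewrite big1.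
  rewrite PoszD -IH; under eq_bigr do rewrite PoszD.
  rewrite big_split /=; congr (_ + _).
  transitivity ((e.1 == y)%:Z * (count_mem e.2 r)%:Z).
    elim: (r) => [|x r' IHr] /=; first by rewrite big_nil mulr0.
    rewrite big_cons IHr PoszD mulrDr; congr (_ + _).
    by rewrite -PoszM mulnb {1}(surjective_pairing e) xpair_eqE /= [e.2 == x]eq_sym.
  by rewrite count_uniq_mem // -PoszM mulnb.
elim: ar => [|e ar IH] /=; first by rewrite big1.
rewrite PoszD -IH; under eq_bigr do rewrite PoszD.
rewrite big_split /=; congr (_ + _).
transitivity ((e.2 == y)%:Z * (count_mem e.1 r)%:Z).
  elim: (r) => [|x r' IHr] /=; first by rewrite big_nil mulr0.
  rewrite big_cons IHr PoszD mulrDr; congr (_ + _).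
  by rewrite -PoszM mulnb {1}(surjective_pairing e) xpair_eqE /= [e.1 == x]eq_sym andbC.
by rewrite count_uniq_mem // -PoszM mulnb andbC.
Qed.

Definition hrow i := [seq H i.+1 j | j <- iota i.+1 (n - i)].

Lemma mem_hrow i a b : (H a b \in hrow i) = (a == i.+1) && (i < b <= n)%N.
Proof.
apply/mapP/andP => [[j]|[/eqP-> bb]]; last by exists b; rewrite // mem_iota; lia.
by rewrite mem_iota => jr [-> ->]; split=> //; lia.
Qed.

Lemma mem_hrow_Phi i a b : (Phi a b \in hrow i) = false.
Proof. exact: notin_map. Qed.

Lemma hrow_uniq i : uniq (hrow i).
Proof. by rewrite map_inj_uniq ?iota_uniq // => a b []. Qed.

Lemma HvH i j : (1 < i)%N -> Hv n i j = H i j.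
Proof. by rewrite /Hv; case: i => [|[|i]]. Qed.

Lemma HvD j : (0 < j)%N -> Hv n j j = H j j.
Proof. by rewrite /Hv; case: j => [|[|j]]. Qed.

(* Non-marked cluster labels are not of the form h_jj. *)
Definition nondiag y := forall j, H j j != y.

(** All that remains of the arrows between y and row i + 1: one vertex at the end of that row and
    one at the end of the row above. *)
Definition ends i y : int := (Hv n i n == y)%:Z - (Hv n i.+1 n == y)%:Z.

Lemma flow_a i y : flow (arrows_a n) y (mem (hrow i)) = 0.
Proof.
rewrite /arrows_a !flow_cat /flow !count_map.
by rewrite !(eq_count (a2 := pred0)) ?count_pred0 ?subrr ?addr0 // => p /=; rewrite mem_hrow_Phi ?andbF.
Qed.

Lemma count_row_map (T : Type) (s : seq T) (c : pred T) (f : T -> label * label) (e : pred (label * label)) :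
  count e [seq f p | p <- s & c p] = count (fun p => e (f p) && c p) s.
Proof. by rewrite count_map count_filter. Qed.

Lemma flow_b i y : (0 < i < n)%N -> nondiag y -> flow (arrows_b n) y (mem (hrow i)) = ends i y.
Proof.
move=> ri nd; have n0 : (0 < n)%N by lia.
rewrite /arrows_b !flow_cat.
have b4 : flow [:: (H 1 1, Phi 1 n.-1); (Phi 1 1, H 1 1)] y (mem (hrow i)) = 0.
  by rewrite /flow /= !mem_hrow_Phi mem_hrow (_ : (1 == i.+1)%N = false) ?andbF //; lia.
rewrite b4 addr0 /flow !count_row_map /=.
pose q1 j := (i < j)%N && (Hv n i j == y).
pose q2 j := (i < j)%N && (H i.+1 j == y).
pose q3 j := (i.+2 < j)%N && (H i.+2 j == y).
have nH a : (H a a == y) = false by apply/negbTE/nd.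
have iN : (0 < i <= n)%N by lia.
have iN1 : (0 < i.+1 <= n)%N by lia.
have O1 : count (fun p : nat * nat => (Hv n p.1 p.2 == y) && (Hv n p.1.+1 p.2 \in hrow i)
      && (p.1 < p.2)%N) (pairs n) = count q1 (iota 1 n).
  rewrite (@count_pairs_row n i q1) => [|a b ra rb /=]; first by rewrite iN mul1n.
  have a1 : (1 < a.+1)%N by lia.
  rewrite (HvH b a1) mem_hrow eqSS /q1; have [->|nia] := eqVneq a i; rewrite ?andbF //=.
  case: (Hv n i b == y); rewrite ?andbF ?andbT //=; lia.
have I3 : count (fun p : nat * nat => (Hv n p.1 p.2 \in hrow i) && (Hv n p.1.-1 p.2.-1 == y)
      && (2 <= p.1 < p.2)%N) (pairs n) = count q1 (iota 1 n.-1).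
  rewrite -iota_shift // (@count_pairs_row n i.+1 (fun j => (1 < j)%N && q1 j.-1)) => [|a b ra rb /=].
    by rewrite iN1 mul1n.
  rewrite /q1; have [->|nia] := eqVneq a i.+1.
    rewrite HvH ?mem_hrow ?eqxx /=; last by lia.
    case: (Hv n i b.-1 == y); rewrite ?andbF ?andbT //=; lia.
  case: (ltnP 1 a) => a1; last by rewrite andbF.
  by rewrite HvH // mem_hrow (negbTE nia).
have O2 : count (fun p : nat * nat => (Hv n p.1 p.2 == y) && (Hv n p.1 p.2.+1 \in hrow i)
      && ((2 <= p.1 <= p.2) && (p.2 <= n.-1))%N) (pairs n) = count q2 (iota 1 n.-1).
  rewrite (@count_pairs_row n i.+1 (fun j => (j < n)%N && q2 j)) => [|a b ra rb /=].
    rewrite iN1 mul1n iota_last // ltnn addn0; apply: eq_count_in => j.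
    by rewrite mem_iota => jr; rewrite (_ : (j < n)%N) //; lia.
  rewrite /q2; have [->|nia] := eqVneq a i.+1.
    rewrite !HvH ?mem_hrow ?eqxx /=; [|lia|lia].
    case: (H i.+1 b == y); rewrite ?andbF ?andbT //=; lia.
  case: (ltnP 1 a) => a1; last by rewrite !andbF.
  by rewrite !HvH // mem_hrow (negbTE nia) andbF.
have I2 : count (fun p : nat * nat => (Hv n p.1 p.2 \in hrow i) && (Hv n p.1 p.2.+1 == y)
      && ((2 <= p.1 <= p.2) && (p.2 <= n.-1))%N) (pairs n) = count q2 (iota 1 n).
  pose q4 j := (i < j)%N && (H i.+1 j.+1 == y).
  rewrite (@count_pairs_row n i.+1 (fun j => (j < n)%N && q4 j)) => [|a b ra rb /=].
    rewrite iN1 mul1n iota_last // ltnn addn0.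
    transitivity (count q4 (iota 1 n.-1)).
      by apply: eq_count_in => j; rewrite mem_iota => jr; rewrite (_ : (j < n)%N) //; lia.
    rewrite -iota_shift //; apply: eq_count_in => j; rewrite mem_iota /q4 /q2 => jr.
    rewrite prednK; last by lia.
    have [->|ji] := eqVneq j i.+1; first by rewrite nH !andbF.
    case: (H i.+1 j == y); rewrite ?andbF ?andbT //=; lia.
  rewrite /q4; have [->|nia] := eqVneq a i.+1.
    rewrite !HvH ?mem_hrow ?eqxx /=; [|lia|lia].
    case: (H i.+1 b.+1 == y); rewrite ?andbF ?andbT //=; lia.
  case: (ltnP 1 a) => a1; last by rewrite !andbF.
  by rewrite !HvH // mem_hrow (negbTE nia).
have O3 : count (fun p : nat * nat => (Hv n p.1 p.2 == y) && (Hv n p.1.-1 p.2.-1 \in hrow i)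
      && (2 <= p.1 < p.2)%N) (pairs n) = ((0 < i.+2 <= n)%N * count q3 (iota 1 n))%N.
  apply: count_pairs_row => a b ra rb /=; rewrite /q3; have [->|nia] := eqVneq a i.+2.
    rewrite !HvH ?mem_hrow ?eqxx /=; [|lia|lia].
    case: (H i.+2 b == y); rewrite ?andbF ?andbT //=; lia.
  case: (ltnP 1 a) => a1; last by rewrite !andbF.
  have [a2|a2] := ltnP 1 a.-1; first by rewrite (HvH b.-1 a2) mem_hrow (_ : (a.-1 == i.+1) = false) ?andbF //; lia.
  have -> : a.-1 = 1%N by lia.
  rewrite [X in X \in _]/Hv eqxx /=; case: ifP => _; first by rewrite mem_hrow_Phi andbF.
  by rewrite mem_hrow (_ : (1 == i.+1)%N = false) ?andbF //; lia.
have I1 : count (fun p : nat * nat => (Hv n p.1 p.2 \in hrow i) && (Hv n p.1.+1 p.2 == y)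
      && (p.1 < p.2)%N) (pairs n) = ((0 < i.+2 <= n)%N * count q3 (iota 1 n))%N.
  rewrite (@count_pairs_row n i.+1 q3) => [|a b ra rb /=].
    rewrite iN1 mul1n; case: (leqP i.+2 n) => i2; first by rewrite mul1n.
    rewrite mul0n; apply/eqP; rewrite -leqn0 leqNgt -has_count; apply/hasPn => j.
    by rewrite mem_iota /q3 => jr; rewrite negb_and; apply/orP; left; lia.
  rewrite /q3; have [->|nia] := eqVneq a i.+1.
    rewrite !HvH ?mem_hrow ?eqxx /=; [|lia|lia].
    have [->|bi] := eqVneq b i.+2; first by rewrite nH !andbF.
    case: (H i.+2 b == y); rewrite ?andbF ?andbT //=; lia.
  have [a2|a2] := ltnP 1 a; first by rewrite (HvH b a2) mem_hrow (negbTE nia).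
  have -> : a = 1%N by lia.
  rewrite {1}/Hv eqxx /=; case: ifP => b2; first by rewrite mem_hrow_Phi.
  by rewrite andbF.
(* O and I count outgoing and incoming arrows of the types (b1), (b2), (b3). O1 and I3 differ by the
   last column of row i, O2 and I2 by that of row i + 1, and O3 equals I1; off the diagonal there is
   no other boundary term. *)
rewrite O1 O2 O3 I1 I2 I3 !(@iota_last n _ n0) /q1 /q2 /ends (@HvH i.+1); last by lia.
have -> : (i < n)%N by lia.
by rewrite /= !PoszD; ring.
Qed.

Variable bd : BD_triple n.
Local Notation gs := (gams bd).

(** The last kind of (c)-arrows joins two diagonal vertices and misses y; the two other kinds meet T
    at the diagonal vertex of b only. *)
Lemma flow_c y (T : pred label) b : (0 < b < n)%N -> nondiag y ->
  (forall j, (0 < j)%N -> T (H j.+1 j.+1) = (j == b)) ->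
  flow (arrows_c bd) y T = if Gam2 bd b then - ends (gs b) y else 0.
Proof.
move=> rb nd TH; rewrite /arrows_c !flow_cat.
have nH a : (H a a == y) = false by apply/negbTE/nd.
have g0 j : j \in [seq j <- iota 1 n.-1 | Gam2 bd j] -> (0 < j)%N.
  by rewrite mem_filter mem_iota => /andP[_]; lia.
have cb (q : pred nat) : count (fun j => (j == b) && q j) [seq j <- iota 1 n.-1 | Gam2 bd j] =
    (Gam2 bd b && q b).
  rewrite count_filter (eq_count (a2 := fun j => (j == b) && (Gam2 bd b && q b))).
    case: (_ && q b); last by rewrite -[RHS](count_pred0 (iota 1 n.-1)); apply: eq_count => j; rewrite andbF.
    rewrite (eq_count (a2 := pred1 b)) => [|j]; last by rewrite /= andbT.
    by rewrite count_uniq_mem ?iota_uniq // mem_iota; congr nat_of_bool; lia.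
  by move=> j /=; have [->|//] := eqVneq j b; rewrite andbC.
set G2 := [seq _ <- _ | Gam2 bd _] in g0 cb *.
have f1 : flow [seq (Hv n (gs j).+1 n, Hv n j.+1 j.+1) | j <- G2] y T =
    (Gam2 bd b && (Hv n (gs b).+1 n == y))%:Z.
  rewrite /flow !count_map -(cb (fun j => Hv n (gs j).+1 n == y)) [X in _ - X%:Z](_ : _ = 0%N) ?subr0.
    congr Posz; apply: eq_count_in => j /g0 j0 /=.
    by rewrite HvD // TH // andbC; have [->|] := eqVneq j b.
  rewrite -(count_pred0 G2); apply: eq_count_in => j /g0 j0 /=.
  by rewrite HvD // nH andbF.
have f2 : flow [seq (Hv n j.+1 j.+1, Hv n (gs j) n) | j <- G2] y T =
    - (Gam2 bd b && (Hv n (gs b) n == y))%:Z.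
  rewrite /flow !count_map -(cb (fun j => Hv n (gs j) n == y)) [X in X%:Z - _](_ : _ = 0%N) ?sub0r.
    congr (- Posz _); apply: eq_count_in => j /g0 j0 /=.
    by rewrite HvD // TH //; have [->|] := eqVneq j b.
  rewrite -(count_pred0 G2); apply: eq_count_in => j /g0 j0 /=.
  by rewrite HvD // nH.
have f3 : flow [seq (Hv n j.+1 j.+1, Hv n j j) | j <- iota 1 n.-1 &
     [&& Gam2 bd j & ~~ Gam2 bd j.-1 || gamma_neg bd j]] y T = 0.
  rewrite /flow !count_map.
  rewrite (eq_count_in (b := pred0)) ?count_pred0 => [|j]; last first.
    by rewrite mem_filter mem_iota /= => jr; rewrite HvD // nH.
  rewrite (eq_count_in (b := pred0)) ?count_pred0 ?subrr // => j.
  by rewrite mem_filter mem_iota /= => jr; rewrite (@HvD j) ?nH ?andbF //; lia.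
have -> : [seq j <- G2 | ~~ Gam2 bd j.-1 || gamma_neg bd j] = [seq j <- iota 1 n.-1 |
     [&& Gam2 bd j & ~~ Gam2 bd j.-1 || gamma_neg bd j]].
  by rewrite -filter_predI; apply: eq_filter => j /=; rewrite andbC.
rewrite f1 f2 f3 addr0 /ends; case: (Gam2 bd b) => //=.
by ring.
Qed.

End Quiver.

(** * The initial seeds are related *)

Section InitialSeeds.
Variables (C : numFieldType) (n : nat).
Hypothesis hn : (3 <= n)%N.
Variables (bd : BD_triple n) (G : group_kind).
Let n_gt0 : (0 < n)%N := ltn_trans (isT : (0 < 2)%N) hn.
Implicit Types (b : BD_triple n) (x y m : label).
Local Notation g := (gam bd).
Local Notation gs := (gams bd).
Local Notation Cl := (init_cluster (BD_std n)).
Local Notation Fz := (init_frozen G bd).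
Local Notation Mk := (marked_labels bd).
Local Notation E := (Cl ++ Fz ++ Mk).

Lemma cluster_H b i j : (H i j \in init_cluster b) =
  [&& 1 < i, i <= j <= n & (i == j) ==> Gam2 b i.-1]%N.
Proof.
rewrite mem_cat (notin_map (f := fun p => Phi p.1 p.2)) // mem_mapH mem_filter mem_pairs /=.
case: (_ ==> _); rewrite ?andbF ?andbT //=; lia.
Qed.

Lemma cluster_Phi b k l : (Phi k l \in init_cluster b) = [&& 0 < k, 0 < l & k + l <= n]%N.
Proof.
rewrite mem_cat orbC (notin_map (f := fun p => H p.1 p.2)) // mem_mapPhi mem_filter mem_pairs /=.
lia.
Qed.

Lemma cluster_C b i : (Cc i \in init_cluster b) = false.
Proof. by rewrite mem_cat !notin_map. Qed.

Lemma marked_H b i j : (H i j \in marked_labels b) = [&& i == j, 1 < i & Gam2 b i.-1]%N.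
Proof.
rewrite mem_mapD mem_filter mem_iota; have [|] := boolP (Gam2 b i.-1); last by rewrite !andbF.
by move=> /G2_range; case: (i == j); lia.
Qed.

Lemma marked_Phi b k l : (Phi k l \in marked_labels b) = false.
Proof. exact: notin_map. Qed.

Lemma marked_C b i : (Cc i \in marked_labels b) = false.
Proof. exact: notin_map. Qed.

Lemma frozen_C b i : (Cc i \in init_frozen G b) = (0 < i < n)%N.
Proof.
rewrite mem_cat mem_mapC mem_iota mem_cat (notin_map (f := fun i => H i.+1 i.+1)) //.
have -> : (Cc i \in if G is GL then [:: H 1 1] else [::]) = false by case: G.
by rewrite !orbF; lia.
Qed.

Lemma frozen_Phi b k l : (Phi k l \in init_frozen G b) = false.
Proof. by rewrite !mem_cat !notin_map //; case: G. Qed.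

Lemma frozen_H b i j : (H i j \in init_frozen G b) =
  (if G is GL then true else false) && (i == 1)%N && (j == 1)%N ||
  [&& i == j, 1 < i <= n & ~~ Gam2 b i.-1]%N.
Proof.
rewrite !mem_cat (notin_map (f := Cc)) //= mem_mapD mem_filter mem_iota.
have -> : (H i j \in if G is GL then [:: H 1 1] else [::]) =
  (if G is GL then true else false) && (i == 1)%N && (j == 1)%N.
  by case: G => //; rewrite inE eqH.
congr (_ || _); case: (~~ _); rewrite ?andbF ?andbT //=; lia.
Qed.

Lemma cluster_uniq b : uniq (init_cluster b).
Proof.
have HI : injective (fun p : nat * nat => H p.1 p.2) by move=> [? ?] [? ?] /= [-> ->].
have PI : injective (fun p : nat * nat => Phi p.1 p.2) by move=> [? ?] [? ?] /= [-> ->].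
rewrite cat_uniq !map_inj_uniq // !filter_uniq ?pairs_uniq //= andbT.
by apply/hasPn => x /mapP[p _ ->]; apply/negbT/notin_map.
Qed.

Lemma frozen_uniq b : uniq (init_frozen G b).
Proof.
have uC : uniq [seq Cc i | i <- iota 1 n.-1] by rewrite map_inj_uniq ?iota_uniq // => ? ? [].
have uH : uniq [seq H i.+1 i.+1 | i <- iota 1 n.-1 & ~~ Gam2 b i].
  by rewrite map_inj_uniq ?filter_uniq ?iota_uniq // => ? ? [].
rewrite cat_uniq uC cat_uniq uH andbT /=; apply/and3P; split; last 1 first.
- apply/hasPn => x /mapP[k]; rewrite mem_filter mem_iota => /andP[_ rk] ->.
  by case: G => //; rewrite inE eqH; lia.
- apply/hasPn => x; rewrite mem_cat => xHD; apply/negP => /mapP[i _ xC].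
  by move: xHD; rewrite xC (notin_map (f := fun i => H i.+1 i.+1)) //; case: G.
- by case: G.
Qed.

Lemma marked_uniq b : uniq (marked_labels b).
Proof. by rewrite map_inj_uniq ?filter_uniq ?iota_uniq // => ? ? /= []. Qed.

Lemma E_uniq : uniq E.
Proof.
rewrite cat_uniq cluster_uniq cat_uniq frozen_uniq marked_uniq andbT /=.
apply/andP; split; apply/hasPn => -[a c|a c|a] /=; rewrite ?(mem_cat _ Fz).
- by rewrite frozen_Phi marked_Phi.
- rewrite frozen_H marked_H cluster_H /=; case: (G) (Gam2 bd a.-1) => [] [] /=; rewrite ?andbF ?andbT ?orbF ?implybF; lia.
- by rewrite cluster_C.
- by rewrite marked_Phi.
- rewrite frozen_H marked_H; case: (G) (Gam2 bd a.-1) => [] [] /=; rewrite ?andbF ?andbT ?orbF; lia.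
- by rewrite marked_C.
Qed.

Lemma cluster_perm : perm_eq (init_cluster bd) (Cl ++ Mk).
Proof.
apply: uniq_perm; first exact: cluster_uniq.
  by move: E_uniq; rewrite uniq_catCA cat_uniq => /and3P[].
move=> [a c|a c|a]; rewrite (mem_cat _ Cl Mk).
- by rewrite !cluster_Phi marked_Phi orbF.
- rewrite !cluster_H marked_H /= implybF; have [|] := boolP (Gam2 bd a.-1).
    by move=> /G2_range; lia.
  by rewrite !andbF implybF orbF.
- by rewrite !cluster_C marked_C.
Qed.

Lemma frozen_perm : perm_eq (init_frozen G (BD_std n)) (Fz ++ Mk).
Proof.
apply: uniq_perm; first exact: frozen_uniq.
  by move: E_uniq; rewrite cat_uniq => /and3P[].
move=> [a c|a c|a]; rewrite (mem_cat _ Fz Mk).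
- by rewrite !frozen_Phi marked_Phi.
- rewrite !frozen_H marked_H /=; have [/G2_range|] := boolP (Gam2 bd a.-1);
    case: (G) => /=; rewrite ?andbF ?andbT ?orbF; lia.
- by rewrite !frozen_C marked_C orbF.
Qed.

Lemma mem_E_H i j : (1 < i)%N -> (H i j \in E) = (i <= j <= n)%N.
Proof.
move=> i1; rewrite (mem_cat _ Cl) (mem_cat _ Fz) cluster_H frozen_H marked_H /= implybF.
have [/G2_range|] := boolP (Gam2 bd i.-1); case: (G) => /=; rewrite ?andbF ?andbT ?orbF; lia.
Qed.

Definition is_h x := if x is H i _ then (1 < i)%N else false.

Lemma sum_h (f : label -> int) : (forall x, x \in E -> ~~ is_h x -> f x = 0) ->
  \sum_(x <- E) f x = \sum_(i <- iota 1 n.-1) \sum_(x <- hrow n i) f x.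
Proof.
move=> f0; rewrite (bigID is_h) /= addrC big1_seq ?add0r => [|x /andP[]]; last by move=> ? ?; rewrite f0.
rewrite -big_filter.
have pE : perm_eq [seq x <- E | is_h x] [seq H i.+1 j | i <- iota 1 n.-1, j <- iota i.+1 (n - i)].
  apply: uniq_perm; first exact/filter_uniq/E_uniq.
    apply: allpairs_uniq_dep => [|i _|[i j] [i' j'] _ _ /= [-> ->] //]; exact: iota_uniq.
  move=> x; rewrite mem_filter; apply/andP/allpairsPdep => [|[i [j []]]].
    case: x => [? ?|i j|?] [] //= i1; rewrite mem_E_H // => ij; exists i.-1, j.
    by rewrite !mem_iota prednK; [split=> //; lia|lia].
  rewrite !mem_iota => ri rj ->; have i1 : (1 < i.+1)%N by lia.
  by rewrite mem_E_H //=; split; lia.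
rewrite (perm_big _ pE) /= big_allpairs_dep.
by apply: eq_bigr => i _; rewrite big_map.
Qed.

Lemma Hv_Phi11 i j : Hv n i j != Phi 1 1.
Proof.
rewrite /Hv; case: ifP => // _; rewrite eqPhi; apply/negP; lia.
Qed.

(** For n >= 3 none of the phi-labels identified with the first row of the h-quiver is phi_11. Thus
    the multiplicity n never meets the variables that Q rescales. *)
Lemma arrow_Phi11 b x : is_h x -> arrow_count b (Phi 1 1) x = 0.
Proof.
pose e0 (e : label * label) :=
  ~~ ((e.1 == Phi 1 1) && is_h e.2) && ~~ (is_h e.1 && (e.2 == Phi 1 1)).
have nP i j : (Hv n i j == Phi 1 1) = false by apply/negbTE/Hv_Phi11.
have aE : all e0 (arrows_a n ++ arrows_b n ++ arrows_c b).
  rewrite !all_cat !all_map /=; repeat (apply/andP; split) => //;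
    by apply/allP => p _; rewrite /e0 /= ?nP ?andbF.
move=> hx; rewrite /arrow_count !(count_memPn _) ?subrr //; apply/negP => /(allP aE);
  by rewrite /e0 /= hx ?eqxx ?andbF.
Qed.

Lemma arrow_countE b y x : arrow_count b y x = flow (arrows_a n) y (mem [:: x]) +
  (flow (arrows_b n) y (mem [:: x]) + flow (arrows_c b) y (mem [:: x])).
Proof. by rewrite -!flow_cat -flow_sum // big_seq1. Qed.

Lemma arrows_c_std : arrows_c (BD_std n) = [::].
Proof. by rewrite /arrows_c filter_pred0. Qed.

Lemma arrow_nonmarked x y : x \notin Mk -> y \notin Mk ->
  arrow_count bd x y = arrow_count (BD_std n) x y.
Proof.
move=> xM yM; rewrite !arrow_countE arrows_c_std; congr (_ + (_ + _)).
have mj j : j \in [seq j <- iota 1 n.-1 | Gam2 bd j] -> Hv n j.+1 j.+1 \in Mk.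
  by move=> jG; rewrite HvD //; apply: (map_f (fun i => H i.+1 i.+1)).
have aE : all (fun e => (e.1 \in Mk) || (e.2 \in Mk)) (arrows_c bd).
  rewrite /arrows_c !all_cat !all_map; apply/and3P; split; apply/allP => j; rewrite ?mem_filter.
  - by rewrite -mem_filter => /mj /= ->; rewrite orbT.
  - by rewrite -mem_filter => /mj /= ->.
  - by case/andP=> _; rewrite -mem_filter => /mj /= ->.
rewrite -flow_sum // big_seq1 !(count_memPn _) ?subrr //; apply/negP => /(allP aE) /=;
  by rewrite (negbTE xM) (negbTE yM).
Qed.

Lemma arrow_marked y j : nondiag y -> Gam2 bd j ->
  arrow_count bd y (H j.+1 j.+1) = arrow_count (BD_std n) y (H j.+1 j.+1) - ends n (gs j) y.
Proof.
move=> nd Gj; have rj := G2_range Gj.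
rewrite !arrow_countE arrows_c_std (flow_c hn bd rj nd) ?Gj => [|i i0].
  by rewrite [flow [::] _ _]subrr; ring.
by rewrite [LHS]mem_seq1 eqH eqSS andbb.
Qed.

Lemma arrow_row y i : nondiag y -> (0 < i < n)%N ->
  \sum_(x <- hrow n i) arrow_count bd y x =
  ends n i y - (if Gam2 bd i then ends n (gs i) y else 0).
Proof.
move=> nd ri; rewrite /arrow_count flow_sum ?hrow_uniq // (flow_cat (arrows_a n)) (flow_cat (arrows_b n)) flow_a flow_b //.
rewrite (flow_c hn bd ri nd) => [|j j0]; first by case: ifP => _; ring.
rewrite [LHS]mem_hrow; lia.
Qed.

(** The exponent of the variable m in the product over the elements of the string that follow i. *)
Definition string_mult i m : int :=
  \sum_(1 <= t < (steps bd i).+1) (H (iter t g i).+1 (iter t g i).+1 == m)%:Z.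

Lemma string_multS i m : (0 < i)%N -> string_mult i m =
  if Gam1 bd i then (H (g i).+1 (g i).+1 == m)%:Z + string_mult (g i) m else 0.
Proof.
move=> i0; rewrite /string_mult; case: ifP => [Gi|/negbT nG]; last first.
  by rewrite steps0 // big_geq.
rewrite stepsS // big_ltn // big_add1 /=; congr (_ + _).
by apply: eq_bigr => t _; rewrite -iterSr.
Qed.

Lemma Gam1_perm : perm_eq [seq i <- iota 1 n.-1 | Gam1 bd i]
  [seq gs j | j <- [seq j <- iota 1 n.-1 | Gam2 bd j]].
Proof.
apply: uniq_perm; first by rewrite filter_uniq ?iota_uniq.
  rewrite map_inj_in_uniq ?filter_uniq ?iota_uniq // => i j.
  rewrite !mem_filter => /andP[Gi _] /andP[Gj _] e.
  by rewrite -(gamsK Gi) e gamsK.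
move=> i; rewrite mem_filter; apply/andP/mapP => [[Gi ri]|[j]].
  have Gg := gam_G2 Gi; have := G2_range Gg; exists (g i); last by rewrite gamK.
  by rewrite mem_filter Gg mem_iota; lia.
rewrite mem_filter => /andP[Gj _] ->; have Gs := gams_G1 Gj.
by have := G1_range Gs; split=> //; rewrite mem_iota; lia.
Qed.

(* The string recursion makes the sum over Gamma1 telescope, via gamma, against
   the one over Gamma2. *)
Lemma string_mult_sum y c : Gam2 bd c ->
  \sum_(i <- iota 1 n.-1) string_mult i (H c.+1 c.+1) *
    (ends n i y - (if Gam2 bd i then ends n (gs i) y else 0)) = ends n (gs c) y.
Proof.
move=> Gb; set m := H _ _; have rb := G2_range Gb.
under eq_bigr do rewrite mulrBr.
rewrite sumrB.
have -> : \sum_(i <- iota 1 n.-1) string_mult i m * (if Gam2 bd i then ends n (gs i) y else 0) =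
    \sum_(i <- iota 1 n.-1 | Gam2 bd i) string_mult i m * ends n (gs i) y.
  by rewrite [RHS]big_mkcond; apply: eq_bigr => i _; case: ifP; rewrite ?mulr0.
have -> : \sum_(i <- iota 1 n.-1) string_mult i m * ends n i y =
    \sum_(i <- iota 1 n.-1 | Gam1 bd i)
      ((H (g i).+1 (g i).+1 == m)%:Z + string_mult (g i) m) * ends n i y.
  rewrite [RHS]big_mkcond big_seq [RHS]big_seq; apply: eq_bigr => i.
  rewrite mem_iota => ri; rewrite string_multS; last by lia.
  by case: ifP; rewrite ?mul0r.
rewrite -big_filter (perm_big _ Gam1_perm) big_map big_filter.
rewrite (eq_bigr (fun j => (j == c)%:Z * ends n (gs j) y + string_mult j m * ends n (gs j) y)).
  rewrite big_split /= addrK -big_filter (bigD1_seq c) ?filter_uniq ?iota_uniq //=; last first.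
    by rewrite mem_filter Gb mem_iota; lia.
  by rewrite eqxx mul1r big1 ?addr0 // => j /negbTE->; rewrite mul0r.
by move=> j Gj; rewrite gamsK // eqH eqSS andbb mulrDl.
Qed.

(** The Kronecker term is there for marked x, whose relation has 1 in place of the variable; the
    string term is the same for all labels of a row. *)
Definition init_lam x m : int :=
  if x is H i _ then if (1 < i)%N then (x == m)%:Z + string_mult i.-1 m else 0 else 0.

Lemma init_lam_sum y m : nondiag y -> m \in Mk ->
  \sum_(x <- E) arrow_count bd y x * init_lam x m = arrow_count (BD_std n) y m.
Proof.
move=> nd; case: m => [k l|i j|k]; rewrite ?marked_Phi ?marked_C // marked_H => /and3P[/eqP<- i1 Gi].
have ii : i.-1.+1 = i by rewrite prednK //; lia.
set m := H i i; have mE : m = H i.-1.+1 i.-1.+1 by rewrite ii.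
have mM : H i i \in E by rewrite mem_E_H // leqnn; have := G2_range Gi; lia.
(* The Kronecker part of the exponents gives a single arrow count; the string part is constant on
   rows, so that the row sums [arrow_row] enter. *)
pose f1 x := arrow_count bd y x * (if x is H k _ then (x == m)%:Z else 0).
pose f2 x := arrow_count bd y x * (if x is H k _ then if (1 < k)%N then string_mult k.-1 m else 0 else 0).
rewrite (eq_bigr (fun x => f1 x + f2 x)); last first.
  move=> [k l|k l|k] _; rewrite /f1 /f2 /= ?mulr0 ?addr0 //.
  case: ifP => k1; first by rewrite mulrDr.
  by rewrite eqH [(k == i)%N](_ : _ = false) ?mulr0 //; apply/eqP; lia.
rewrite big_split /= (bigD1_seq m) ?E_uniq //= {1}/f1 eqxx mulr1.
rewrite big1 => [|x xm]; last by rewrite /f1 (negbTE xm); case: x {xm} => *; rewrite mulr0.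
rewrite addr0 sum_h => [|[k l|k l|k] _]; rewrite /f2 /= ?mulr0 //; last by move=> /negbTE->; rewrite mulr0.
rewrite [in LHS]mE arrow_marked // -mE.
rewrite (_ : \sum_(_ <- _) _ = ends n (gs i.-1) y); first by rewrite subrK.
rewrite -(string_mult_sum y Gi) -mE big_seq [RHS]big_seq; apply: eq_bigr => k.
rewrite mem_iota => rk; have rk' : (0 < k < n)%N by lia.
rewrite -arrow_row // mulr_sumr [LHS]big_seq [RHS]big_seq; apply: eq_bigr => x.
case: x => [a c|a c|a]; rewrite ?mem_hrow_Phi ?mem_hrow ?mulr0 //.
- by case/andP=> /eqP-> _; case/andP: rk' => k0 _; rewrite ltnS k0 mulrC.
- by move=> /mapP[].
Qed.

(* The frozen labels c_i and h_11: the former occur in the string of phi_11. *)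
Definition fixed_label : pred label := fun x => (x \in Fz) && ~~ is_h x.

(** Only the row of phi_11 carries the factor n; weight n on all other rows restores
    skew-symmetry. *)
Definition skew_weight x : int := if x == Phi 1 1 then 1 else n%:Z.

Let disjCM x : x \in Cl -> x \notin Mk.
Proof.
move=> xC; apply/negP => xM; move: E_uniq; rewrite cat_uniq => /and3P[_ /hasPn dC _].
by have := dC x; rewrite mem_cat xM orbT /= xC => /(_ isT).
Qed.

Let disjFM x : x \in Fz -> x \notin Mk.
Proof.
move=> xC; apply/negP => xM; move: E_uniq; rewrite !cat_uniq => /and5P[_ _ _ /hasPn dC _].
by have := dC x xM; rewrite /= xC.
Qed.

Lemma cluster_nondiag x : x \in Cl -> nondiag x.
Proof.
by move=> xC j; apply/eqP => e; move: xC; rewrite -e cluster_H eqxx !andbF.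
Qed.

Lemma marked_is_h x : x \in Mk -> is_h x.
Proof. by case: x => [k l|i j|k]; rewrite ?marked_Phi ?marked_C // marked_H => /and3P[]. Qed.

Lemma unfixed_is_h x : x \in Fz ++ Mk -> ~~ fixed_label x -> is_h x.
Proof.
rewrite (mem_cat _ Fz) /fixed_label => /orP[->|/marked_is_h //]; by rewrite negbK.
Qed.

(** Only k = phi_11 is at stake: its entries at cluster variables carry the factor n, and it has no
    arrows to the h-variables. *)
Lemma exmx_dvd b k x : (x \in init_cluster b) || is_h x ->
  (mult (init_seed C G b) k %| `|exmx (init_seed C G b) k x|)%N.
Proof.
rewrite /=; case: eqP => [->|_] xb; last by rewrite dvd1n.
have [_|xC] /= := boolP (x \in init_cluster b); first by rewrite abszM dvdn_mulr.
by move: xb; rewrite (negbTE xC) /= => /(arrow_Phi11 b)->.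
Qed.

Lemma exmx_skew x y : x \in Cl -> y \in Cl ->
  skew_weight x * exmx (init_seed C G bd) x y = - (skew_weight y * exmx (init_seed C G bd) y x).
Proof.
have key u v : v \in Cl -> skew_weight u * exmx (init_seed C G bd) u v = n%:Z * arrow_count bd u v.
  move=> vC; have vb : v \in init_cluster bd by rewrite (perm_mem cluster_perm) mem_cat vC.
  by rewrite /skew_weight /= vb andbT; case: eqP => _; rewrite ?mul1r.
by move=> xC yC; rewrite !key // -mulrN /arrow_count opprB.
Qed.

Lemma prod_expz_sum (K : fieldType) (I : Type) (r : seq I) (F : I -> int) (v : K) : v != 0 ->
  \prod_(i <- r) v ^ F i = v ^ (\sum_(i <- r) F i).
Proof.
move=> v0; elim: r => [|i r IH]; first by rewrite !big_nil.
by rewrite !big_cons IH expfzDr.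
Qed.

Lemma prod_expz_eq (K : fieldType) (r : seq label) x (v : label -> K) : uniq r ->
  \prod_(m <- r) v m ^ (x == m)%:Z = if x \in r then v x else 1.
Proof.
move=> ur; case: ifPn => xr; last first.
  by rewrite big1_seq // => m /andP[_ mr]; case: eqP => // e; move: xr; rewrite e mr.
rewrite (bigD1_seq x) //= eqxx big1 ?mulr1 // => m /negbTE; by rewrite eq_sym => ->.
Qed.

Lemma init_var_Q U x : goodQ bd U -> x \in E ->
  init_var bd x (Qmap bd U : 'M[C]_n) =
  (if x \in Mk then 1 else init_var (BD_std n) x U) *
  \prod_(m <- Mk) init_var (BD_std n) m U ^ init_lam x m.
Proof.
move=> gU xE; have uR := rho_unip bd n_gt0 U.
have lam0 y : ~~ is_h y -> \prod_(m <- Mk) init_var (BD_std n) m U ^ init_lam y m = 1.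
  by move=> yh; rewrite big1 // => m _; case: y yh => //= i j /negbTE->.
have [xh|xh] := boolP (is_h x); last first.
  rewrite lam0 // mulr1 (negbTE (contra (@marked_is_h x) xh)).
  case: x xE xh => [k l|i j|k]; rewrite (mem_cat _ Cl) (mem_cat _ Fz).
  - rewrite cluster_Phi frozen_Phi marked_Phi !orbF => /and3P[_ _ kl] _.
    exact: phi_conj.
  - rewrite /= cluster_H marked_H frozen_H => + i1.
    rewrite (negbTE i1) !andbF !orbF => /andP[/andP[_ /eqP->] /eqP->].
    by rewrite /h_fun /= det_Qmap.
  - by move=> _ _; apply: c_conj.
case: x xE xh => //= i j; rewrite /is_h => + i1; rewrite mem_E_H // i1 => ij.
have nz m : m \in Mk -> init_var (BD_std n) m U != 0.
  case: m => [k l|k l|k]; rewrite ?marked_Phi ?marked_C // marked_H => /and3P[/eqP<- k1 Gk].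
  have kk : k = k.-1.+1 by rewrite prednK //; lia.
  rewrite /= kk h_diag_std //; last by have := G2_range Gk; lia.
  by case: gU => Uu fU _; apply: tdet_neq0.
(* The Kronecker term supplies the variable itself when x is marked; otherwise it stands in the
   first factor. Either way one copy of [h_std] results. *)
have -> : \prod_(m <- Mk) init_var (BD_std n) m U ^ ((H i j == m)%:Z + string_mult i.-1 m) =
    (if H i j \in Mk then init_var (BD_std n) (H i j) U else 1) *
    \prod_(m <- Mk) init_var (BD_std n) m U ^ string_mult i.-1 m.
  rewrite -(prod_expz_eq _ (fun m => init_var (BD_std n) m U) (marked_uniq bd)) -big_split /=.
  by rewrite big_seq [RHS]big_seq; apply: eq_bigr => m mM; rewrite expfzDr // nz.
rewrite mulrA; have -> : (if H i j \in Mk then 1 else h_fun (BD_std n) i j U) *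
    (if H i j \in Mk then h_fun (BD_std n) i j U else 1) = h_std i j U.
  by rewrite h_fun_std //; case: ifP; rewrite ?mul1r ?mulr1.
rewrite h_fun_Q //; congr (_ * _).
rewrite [RHS]big_seq [RHS](eq_bigr (fun m => \prod_(1 <= t < (steps bd i.-1).+1)
    init_var (BD_std n) m U ^ (H (iter t g i.-1).+1 (iter t g i.-1).+1 == m)%:Z)); last first.
  by move=> m mM; rewrite prod_expz_sum ?nz.
rewrite -[RHS]big_seq exchange_big /= big_nat [RHS]big_nat; apply: eq_bigr => -[//|t] /andP[_ ts].
have i0 : (0 < i.-1)%N by lia.
have Gt := gam_G2 (steps_G1 n_gt0 i0 ts).
rewrite (prod_expz_eq _ (fun m => init_var (BD_std n) m U) (marked_uniq bd)).
have /andP[g0 gn] := G2_range Gt.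
by rewrite marked_H eqxx /= Gt ltnS g0 /= h_diag_std ?g0 ?gn.
Qed.

Lemma related_init : related G (Qmap bd) Cl Mk Fz fixed_label skew_weight
  (init_seed C G bd) (init_seed C G (BD_std n)) init_lam.
Proof.
have subC b x : x \in Cl -> x \in init_cluster b.
  by case: x => [k l|i j|k]; rewrite ?cluster_C // ?cluster_Phi // !cluster_H /= implybF; lia.
have ZE x : x \in E -> ~~ fixed_label x -> (x \in Cl) || is_h x.
  by rewrite (mem_cat _ Cl) => /orP[->//|] xF nZ; rewrite (unfixed_is_h xF nZ) orbT.
have gQ := near1_generically G (near1_goodQ C bd n_gt0).
split => //=.
- exact: cluster_perm.
- exact: frozen_perm.
- by move=> k; case: ifP.
- move=> x y xC yCF; have xM := disjCM xC.
  have yM : y \notin Mk by move: yCF; rewrite (mem_cat _ Cl) => /orP[/disjCM|/disjFM].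
  by rewrite (perm_mem cluster_perm) mem_cat (negbTE yM) orbF arrow_nonmarked.
(* For phi_11 both sides vanish: exponents are supported on the h-variables, which are not adjacent
   to it. *)
- move=> y m yC mM; have [->|y11] /= := eqVneq y (Phi 1 1).
    rewrite (arrow_Phi11 _ (marked_is_h mM)) mulr0 if_same big1 // => x _.
    have [xh|] := boolP (is_h x); first by rewrite arrow_Phi11 // mulr0 if_same mul0r.
    by case: x => [k l|i j|k] //=; rewrite ?mulr0 // => /negbTE->; rewrite mulr0.
  by apply: init_lam_sum => //; apply: cluster_nondiag.
- move=> k r x xE; case: eqP => //= _; case: eqP => [e|_]; last by rewrite andbF.
  by move: xE; rewrite e (mem_cat _ Cl) (mem_cat _ Fz) cluster_C marked_C orbF /fixed_label => /= ->.
- move=> k x kC xE nZ; apply: exmx_dvd; case/orP: (ZE x xE nZ) => [/subC->//|->].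
  by rewrite orbT.
- by move=> k x kC xE nZ; apply: (exmx_dvd (b := BD_std n)); apply: ZE.
- exact: exmx_skew.
- move=> x m xE /andP[_]; case: x xE => //= i j _ /negbTE->//.
- by apply: generically_mono gQ => U _ gU x; apply: init_var_Q.
- apply: generically_mono gQ => U _ [Uu fU _] x xF nZ.
  have := unfixed_is_h xF nZ; case: x xF {nZ} => // i j; rewrite (mem_cat _ Fz) frozen_H marked_H /= => + i1.
  have ii : i = i.-1.+1 by rewrite prednK //; lia.
  move=> xF; have [/eqP<- iN] : i == j /\ (i <= n)%N.
    case/orP: xF => [/orP[|/and3P[-> /andP[_ ->]] //]|/and3P[->] _ /G2_range]; last by lia.
    by rewrite (gtn_eqF i1) andbF.
  rewrite ii h_diag_std ?tdet_neq0 //; lia.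
Qed.

End InitialSeeds.

Theorem proposition4p15 (R : realType) (n : nat) (hn : (3 <= n)%N)
    (bd : BD_triple n) (G : group_kind) :
  let s := init_seed R[i] G bd in
  let st := init_seed R[i] G (BD_std n) in
  let Q := @Qmap R[i] n bd in
  [/\ (* 1) *)
      forall psi, psi \in ext_cluster s -> is_phi_or_c psi ->
        eq_rat G (pullback Q (var s psi)) (var s psi),
      (* 2) *)
      forall (i j : nat), (2 <= i)%N -> (i <= j)%N -> (j <= n)%N ->
      forall (alpha : nat -> nat) (m k : nat),
        gamma_string bd alpha m -> (k <= m)%N -> i.-1 = alpha k ->
        eq_rat G (pullback Q (var s (H i j)))
          (fun U => var st (H i j) U
             * \prod_(k.+1 <= t < m.+1) var st (H (alpha t).+1 (alpha t).+1) U),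
      forall (i j : nat), (2 <= i)%N -> (i <= j)%N -> (j <= n)%N ->
        eq_rat G (var st (H i j)) (@h_std R[i] n i j) &
      birational_quasi_isomorphism G Q st s (marked_labels bd)].
Proof.
move=> s st Q; have n_gt0 : (0 < n)%N := ltn_trans (isT : (0 < 2)%N) hn.
have gQ := near1_generically G (near1_goodQ R[i] bd n_gt0).
have R0 := related_init R[i] hn bd G.
have uE := E_uniq hn bd G.
have fixE : {in init_cluster (BD_std n) ++ init_frozen G bd ++ marked_labels bd,
    forall x, fixed_label bd G x -> x \in init_frozen G bd} by move=> x _ /andP[].
have w0 x : 0 < skew_weight n x by rewrite /skew_weight; case: ifP => _ //; rewrite ltz_nat.
have nonmarked k s1 : perm_eq (cluster s1) (init_cluster (BD_std n) ++ marked_labels bd) ->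
    (k \in cluster s1) && (k \notin marked_labels bd) -> k \in init_cluster (BD_std n).
  by move=> /perm_mem->; rewrite (mem_cat _ (init_cluster _)) => /andP[/orP[//|->]].
have reach ks : (forall k, k \in ks -> (k \in cluster s) && (k \notin marked_labels bd)) ->
    exists lam, related G Q (init_cluster (BD_std n)) (marked_labels bd) (init_frozen G bd)
      (fixed_label bd G) (skew_weight n) (mutations s ks) (mutations st ks) lam.
  move=> kC; apply: (related_mutations n_gt0 uE fixE w0 R0) => k /kC.
  exact: nonmarked (rel_cl R0).
split.
(* Equality holds at every point, because [rho U] is unipotent even where U has no factorization. *)
- move=> psi psiE phic; apply: generically_all => U _; rewrite /pullback.
  have uR := rho_unip bd n_gt0 U.
  case: psi psiE phic => [k l|//|k] + _; last by move=> _; apply: c_conj.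
  rewrite [ext_cluster s]/(_ ++ init_frozen G bd) (mem_cat _ (init_cluster _)).
  rewrite (cluster_Phi hn) frozen_Phi orbF => /and3P[_ _ kl].
  exact: phi_conj.
- move=> i j i1 ij jn alpha m k str km ik.
  have [ra sa alphaE] := gamma_string_iter n_gt0 str km.
  apply: generically_mono gQ => U _ gU; rewrite /pullback /= h_fun_Q // ?ij //.
  rewrite h_fun_std // ik sa -[k.+1]add1n big_addn subSn //; congr (_ * _).
  rewrite big_nat [RHS]big_nat; apply: eq_bigr => t rt.
  rewrite addnC alphaE; last by lia.
  by rewrite h_diag_std // iter_range // sa; lia.
- by move=> i j i1 ij jn; apply: generically_all => U _; apply: h_fun_std.
split.
- exact: birational_Qmap.
- move=> x /mapP[j]; rewrite mem_filter mem_iota => /andP[_ rj] ->.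
  by split; [apply: h_diag_std_regular|apply: h_diag_regular]; lia.
- by have := pullback_iso_Qmap R[i] bd G n_gt0; rewrite /marked_labels -!map_comp.
- move=> ks /reach[lam Rel]; exists lam => x xE.
  apply: generically_mono (rel_var Rel) => U _; apply; move: xE; rewrite mem_cat.
  rewrite (perm_mem (rel_cl Rel)) (perm_mem (rel_fr Rel)) !(mem_cat _ (init_cluster _)).
  by rewrite (mem_cat _ (init_frozen _ _)) -orbA [X in _ || X]orbC.
- move=> ks /reach[lam Rel] s1 st1 x /(nonmarked _ _ _ _ (rel_cl Rel)) xC r _.
  apply: generically_mono (generically_good n_gt0 Rel) => U _ gU.
  exact: (p_hat_Q uE fixE Rel xC gU).
Qed.
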